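(* Let $d\ge1$, $K\ge1$ be integers, $T>0$, $B\in\mathbb{R}$, and let $\overline\Pi$, $\Pi_i$, $L$ be the multi-dimensional junction described in the context. Assume that $u_0\in BUC(\overline\Pi)$ and that, for each $i\in\{1,\dots,K\}$, the Hamiltonian $H_i=H_i(p,u,x,t)$ is coercive in $p$ uniformly in $x,t$ and for bounded $u$, Lipschitz continuous in $u$ and $t$, and uniformly continuous in $(p,u,x,t)$ for bounded $p$ and $u$. For $\epsilon>0$ let $u_\epsilon\in BUC(\overline\Pi\times[0,T])$ be the unique solution of $$ \begin{cases} u_{i,\epsilon,t}-\epsilon\Delta u_{i,\epsilon}+H_i(Du_{i,\epsilon},u_{i,\epsilon},x,t)=0 & \text{in }\Pi_i\times(0,T],\ i=1,\dots,K,\\ \sum_{i=1}^K u_{i,\epsilon,x_i}=B & \text{on } L\times(0,T],\\ u_{i,\epsilon}(\cdot,0)=u_{0,i} & \text{on }\overline\Pi_i,\ i=1,\dots,K. \end{cases} $$ Then $u=\lim_{\epsilon\to0}u_\epsilon$ exists on $\overline\Pi\times[0,T]$, and $u$ is the unique generalized viscosity solution, with $u(\cdot,0)=u_0$ on $\overline\Pi$, of $$ \begin{cases} u_{i,t}+H_i(Du_i,u_i,x,t)=0 & \text{in } \Pi_i\times(0,T],\ i=1,\dots,K,\\ \min\Big(\sum_{i=1}^K u_{i,x_i}-B,\ \min_i\big(u_{i,t}+H_i(Du_i,u_i,x,t)\big)\Big)\le 0 & \text{on } L\times(0,T],\\ \max\Big(\sum_{i=1}^K u_{i,x_i}-B,\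 \max_i\big(u_{i,t}+H_i(Du_i,u_i,x,t)\big)\Big)\ge 0 & \text{on } L\times(0,T]. \end{cases} \qquad(\ast) $$
   Context: Points of $\mathbb{R}^d$ are written $(x',x_d)$ with $x'\in\mathbb{R}^{d-1}$. For $i=1,\dots,K$, $\overline\Pi_i=\{(x',x_i): x'\in\mathbb{R}^{d-1},\ x_i\le 0\}$ are $K$ closed half-spaces glued together along their common boundary $L=\{(x',0):x'\in\mathbb{R}^{d-1}\}$ (the junction), and $\overline\Pi=\bigcup_{i=1}^K\overline\Pi_i$ is the resulting space; away from $L$ the branches are disjoint. Equations ''in $\Pi_i$'' are meant at the points with $x_i<0$. A function $u$ on $\overline\Pi$ is identified with the tuple $(u_1,\dots,u_K)$ of its restrictions $u_i(x',x_i)$ to $\overline\Pi_i$; all the $u_i$ agree on $L$. Likewise $u_{0,i}$ and $u_{i,\epsilon}$ are the restrictions of $u_0$ and $u_\epsilon$ to the $i$-th branch. $Du_i$ and $\Delta u_i$ are the full spatial gradient and Laplacian of $u_i$ on the branch $\overline\Pi_i$ (in the variables $(x',x_i)$), $u_{i,x_i}$ is the derivative in $x_i$ (on $L$ it is the exterior normal derivative), $u_{i,t}$ is the time derivative. $BUC$ denotes bounded uniformly continuous functions; uniqueness of $u$ is in the class $BUC(\overline\Pi\times[0,T])$. Each $H_i$ is a real-valued function of $(p,u,x,t)\in\mathbb{R}^d\times\mathbb{R}\times\overline\Pi_i\times[0,T]$; coercive in $p$ uniformly in $x,t$ and for bounded $u$ means that for every $R>0$, $H_i(p,u,x,t)\to+\infty$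 as $|p|\to\infty$ uniformly in $x,t$ and $|u|\le R$. Under the stated assumptions the $\epsilon$-problem has a unique solution $u_\epsilon\in BUC(\overline\Pi\times[0,T])$. All solutions are understood in the viscosity sense. Generalized viscosity solutions of $(\ast)$. Test functions are $\phi\in C(\overline\Pi\times[0,T])$ such that each restriction $\phi_i$ is $C^1$ on $\overline\Pi_i\times[0,T]$ (up to $L$; the derivatives in $x_i$ on $L$ may differ from branch to branch). A function $u\in C(\overline\Pi\times[0,T])$ is a sub-solution of $(\ast)$ if, whenever $u-\phi$ has a local maximum over $\overline\Pi\times[0,T]$ at $(x_0,t_0)$ with $t_0\in(0,T]$: if $x_0\in\Pi_i\setminus L$, then $\phi_{i,t}+H_i(D\phi_i,u,x_0,t_0)\le 0$; if $x_0\in L$, then $\min\big(\sum_i\phi_{i,x_i}-B,\ \min_i(\phi_{i,t}+H_i(D\phi_i,u,x_0,t_0))\big)\le 0$ (all evaluated at $(x_0,t_0)$). It is a super-solution if, whenever $u-\phi$ has a local minimum at such $(x_0,t_0)$: if $x_0\in\Pi_i\setminus L$, then $\phi_{i,t}+H_i(D\phi_i,u,x_0,t_0)\ge 0$; if $x_0\in L$, then $\max\big(\sum_i\phi_{i,x_i}-B,\ \max_i(\phi_{i,t}+H_i(D\phi_i,u,x_0,t_0))\big)\ge 0$. A solution is both a sub- and a super-solution. *)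

(* Defs.v *)
From HB Require Import structures.
From mathcomp Require Import all_boot all_order all_algebra.
From mathcomp Require Import all_classical all_reals all_analysis.
Set Implicit Arguments.
Unset Strict Implicit.
Unset Printing Implicit Defensive.
Import Order.TTheory GRing.Theory Num.Theory.
Import numFieldNormedType.Exports.
Local Open Scope classical_set_scope.
Local Open Scope ring_scope.

(* The dimension is d = n.+1, and points of space-time are pairs (x, t) with
   x = (x', x_d) a row vector whose last coordinate is x_d.  Row vectors and
   products carry the max norm; the notions below (uniform continuity,
   coercivity) do not depend on the choice of an equivalent norm. *)
Definition spacetime (R : realType) (n : nat) : normedModType R :=
  ('rV[R]_n.+1 * R)%type.

Section domains.
Context {R : realType} (n : nat) (T : R).

Definition halfspace : set 'rV[R]_n.+1 := [set x | x ord0 ord_max <= 0].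

Definition junction : set 'rV[R]_n.+1 := [set x | x ord0 ord_max = 0].

Definition cylinder (X : set 'rV[R]_n.+1) : set (spacetime R n) :=
  [set z | X z.1 /\ 0 <= z.2 <= T].

End domains.

Section calculus_on_a_set.
Context {R : realType} {V : normedModType R}.
Implicit Types (A : set V) (f : V -> R).

Definition bounded_unif_cont_on A f :=
  (exists M, forall z, A z -> `|f z| <= M) /\
  (forall e, 0 < e -> exists2 r, 0 < r &
     forall y z, A y -> A z -> `|y - z| < r -> `|f y - f z| < e).

(* Filter of the difference quotients of f at z in the direction v, along the
   steps that stay in A: at a boundary point of A this is one-sided. *)
Definition diff_quot_on A f (v z : V) : set_system R :=
  (fun h : R => h^-1 * (f (z + h *: v) - f z))
    @ within [set h | A (z + h *: v)] 0^'.

Definition derive_on A f (v z : V) : R := lim (diff_quot_on A f v z).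

Definition cont_derivable_on A f (v : V) :=
  (forall z, A z -> cvg (diff_quot_on A f v z)) /\
  {within A, continuous (derive_on A f v)}.

End calculus_on_a_set.

Section branch_functions.
Context {R : realType} (n : nat) (T : R).
Let branch := cylinder T (@halfspace R n).
Implicit Types phi : spacetime R n -> R.

Definition e_space (j : 'I_n.+1) : spacetime R n := (delta_mx ord0 j, 0).

Definition e_time : spacetime R n := (0, 1).

Definition dt phi := derive_on branch phi e_time.

Definition dx (j : 'I_n.+1) phi := derive_on branch phi (e_space j).

Definition grad phi z : 'rV[R]_n.+1 := \row_j dx j phi z.

Definition laplacian phi z : R := \sum_j dx j (dx j phi) z.

Definition C1 phi :=
  [/\ {within branch, continuous phi},
      cont_derivable_on branch phi e_time &
      forall j, cont_derivable_on branch phi (e_space j)].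

Definition C2x_C1t phi :=
  C1 phi /\
  forall j k, cont_derivable_on branch (dx j phi) (e_space k).

End branch_functions.

(* Functions on the glued space are families indexed by the branches whose
   members agree on the junction. *)
Section junction_functions.
Context {R : realType} {V : normedModType R} (K : nat).
Implicit Types (A L : set V) (u : 'I_K -> V -> R).

Definition agree_on L u := forall i j z, L z -> u i z = u j z.

Definition continuous_on_junction A L u :=
  agree_on L u /\ forall i, {within A, continuous (u i)}.

(* As there are finitely many branches glued along L, uniform continuity on
   the glued space amounts to uniform continuity on each branch. *)
Definition BUC A L u :=
  agree_on L u /\ forall i, bounded_unif_cont_on A (u i).

End junction_functions.

Section viscosity.
Context {R : realType} (n K : nat) (T B : R).
Let st := spacetime R n.
Let branch := cylinder T (@halfspace R n).
Let L := cylinder T (@junction R n).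
Implicit Types u phi : 'I_K -> st -> R.

(* A neighbourhood of a point of branch i off the junction lies in branch i;
   a neighbourhood of a point of the junction meets all the branches. *)
Definition local_max (f : 'I_K -> st -> R) (i : 'I_K) (z0 : st) :=
  forall j, (j = i \/ L z0) ->
    \forall z \near within branch (nbhs z0), f j z <= f i z0.

Definition local_min (f : 'I_K -> st -> R) (i : 'I_K) (z0 : st) :=
  forall j, (j = i \/ L z0) ->
    \forall z \near within branch (nbhs z0), f i z0 <= f j z.

Definition kirchhoff phi (z : st) : R := \sum_i dx T ord_max (phi i) z - B.

(* smooth is the class of test functions on a branch, and F i psi r z the
   value at z of the operator of branch i, with derivatives taken from psi and
   zeroth order term r.  The iterated minimum (maximum) starts from the
   Kirchhoff term, i.e. it is min(kirchhoff, min_i ...). *)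
Variables (smooth : (st -> R) -> Prop).
Variable (F : 'I_K -> (st -> R) -> R -> st -> R).

Definition test_function phi :=
  continuous_on_junction branch L phi /\ forall i, smooth (phi i).

Definition subsolution u :=
  continuous_on_junction branch L u /\
  forall phi i z0, test_function phi -> branch z0 -> 0 < z0.2 ->
    local_max (fun j z => u j z - phi j z) i z0 ->
    (~ L z0 -> F i (phi i) (u i z0) z0 <= 0) /\
    (L z0 ->
      \big[Num.min/kirchhoff phi z0]_(j < K) F j (phi j) (u j z0) z0 <= 0).

Definition supersolution u :=
  continuous_on_junction branch L u /\
  forall phi i z0, test_function phi -> branch z0 -> 0 < z0.2 ->
    local_min (fun j z => u j z - phi j z) i z0 ->
    (~ L z0 -> 0 <= F i (phi i) (u i z0) z0) /\
    (L z0 ->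
      0 <= \big[Num.max/kirchhoff phi z0]_(j < K) F j (phi j) (u j z0) z0).

Definition solution u := subsolution u /\ supersolution u.

End viscosity.

Section problems.
Context {R : realType} (n K : nat) (T B : R).
(* The arguments of H are i p u x t. *)
Variable (H : 'I_K -> 'rV[R]_n.+1 -> R -> 'rV[R]_n.+1 -> R -> R).
Let st := spacetime R n.
Implicit Types u : 'I_K -> st -> R.

Definition first_order_op (i : 'I_K) (psi : st -> R) (r : R) (z : st) : R :=
  dt T psi z + H i (grad T psi z) r z.1 z.2.

Definition viscous_op (eps : R) (i : 'I_K) (psi : st -> R) (r : R) (z : st)
    : R :=
  dt T psi z - eps * laplacian T psi z + H i (grad T psi z) r z.1 z.2.

Definition generalized_solution u := solution T B (C1 T) first_order_op u.

(* The Kirchhoff condition on the junction is understood in the usual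
   viscosity sense for boundary conditions: it or one of the equations holds
   for the test function.  For eps > 0 this gives the same solutions as asking
   for the inequality on the Kirchhoff term alone: adding the function
   - a * x_d - M * x_d ^+ 2 (x_d <= 0, small a > 0, large M) to the test
   function excludes the equations, and similarly for minima. *)
Definition viscous_solution (eps : R) u :=
  solution T B (C2x_C1t T) (viscous_op eps) u.

Definition initial_value (u0 : 'I_K -> 'rV[R]_n.+1 -> R) u :=
  forall i x, halfspace x -> u i (x, 0) = u0 i x.

Definition BUC_space (u0 : 'I_K -> 'rV[R]_n.+1 -> R) :=
  BUC (@halfspace R n) (@junction R n) u0.

Definition BUC_spacetime u :=
  BUC (cylinder T (@halfspace R n)) (cylinder T (@junction R n)) u.

Definition coercive (i : 'I_K) :=
  forall r M : R, 0 < r -> exists P : R, forall p s x t,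
    P <= `|p| -> `|s| <= r -> halfspace x -> 0 <= t <= T -> M <= H i p s x t.

Definition lipschitz_ut (i : 'I_K) :=
  exists C : R, forall p s1 s2 x t1 t2,
    halfspace x -> 0 <= t1 <= T -> 0 <= t2 <= T ->
    `|H i p s1 x t1 - H i p s2 x t2| <= C * (`|s1 - s2| + `|t1 - t2|).

Definition unif_cont_bounded (i : 'I_K) :=
  forall r e : R, 0 < r -> 0 < e -> exists2 a : R, 0 < a &
    forall p1 p2 s1 s2 x1 x2 t1 t2,
      `|p1| <= r -> `|p2| <= r -> `|s1| <= r -> `|s2| <= r ->
      halfspace x1 -> halfspace x2 -> 0 <= t1 <= T -> 0 <= t2 <= T ->
      `|p1 - p2| < a -> `|s1 - s2| < a -> `|x1 - x2| < a -> `|t1 - t2| < a ->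
      `|H i p1 s1 x1 t1 - H i p2 s2 x2 t2| < e.

End problems.

(* Main.v *)
Require Import Defs.
From HB Require Import structures.
From mathcomp Require Import all_boot all_order all_algebra.
From mathcomp Require Import all_classical all_reals all_analysis.
From mathcomp Require Import ring lra.
Set Implicit Arguments.
Unset Strict Implicit.
Unset Printing Implicit Defensive.
Import Order.TTheory GRing.Theory Num.Theory.
Import numFieldNormedType.Exports.
Local Open Scope classical_set_scope.
Local Open Scope ring_scope.

(** The solution is obtained by half-relaxed limits, and the heart of the matter
    is a comparison principle for the limit problem.

    Formulation. A super-solution u for H and B is the opposite of a sub-solution
    for the reflected Hamiltonian - H (- p) (- u) and for - B, so that everything
    is proved for sub-solutions only. Those are tested with paraboloids whose
    normal slope depends on the branch (psub): viscous solutions satisfy the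
    inequality up to a multiple of eps, generalized solutions without error.
    Conversely, the limits are sub-solutions for superdifferentials (ssub), which
    covers all C^1 test functions.

    Comparison (doubling_estimate). Let u be a sub-solution and - v a
    super-solution. Time and the tangential variables are doubled, while the last
    coordinate is kept common, with an exponential weight in time that absorbs
    the dependence of H on u and makes the two equations at a maximum point
    incompatible by a definite amount (doubled_gap). Off the junction the last
    coordinate is doubled in turn, and both equations hold at one common slope
    (interior_contradiction). On the junction the normal slopes of different
    branches are unrelated. There one considers, on each branch, the slopes r
    such that u minus its tangential part stays below r * x_d near the point.
    The largest of them is critical: it satisfies the equation of that branch
    (critical_slope), and coercivity together with the Kirchhoff condition makes
    it finite. For every r, a slope slightly larger than r works for u or one
    slightly larger than - r works for v (slope_dichotomy), so the intermediate
    value theorem provides a slope s_j on each branch j for which both u and v can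
    be touched while neither equation holds (slope_between). If the sum of the
    slopes is at least B, the junction condition of u is violated, and otherwise
    that of v (junction_contradiction).

    Bounds. A barrier with normal slope m, K * m > B, is never touched through
    the Kirchhoff condition (barrier_principle). Barriers give three things: the
    existence of the bounded solutions u_1 and - u_1 makes H bounded for bounded
    p and u, which the hypotheses do not say directly (hamiltonian_upper_bound);
    the u_eps are bounded uniformly in eps (uniform_upper_bound); and they attain
    the initial value uniformly in eps (initial_upper_bound).

    Conclusion. The upper half-relaxed limits u of u_eps and v of - u_eps are
    sub-solutions of the two problems (rlim_stability). Comparison gives
    u + v <= 0, and u + v >= 0 by construction. Hence v = - u, the family
    converges to u, and u is both a sub- and a super-solution. Comparison also
    gives uniqueness, and applied to u and - u at nearby points a modulus of
    continuity in time and along the junction; across the junction coercivity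
    forbids steep cones from touching u (lipschitz_in_xd). *)

(** Linear arithmetic slows down with the size of the context and the number of
    subterms, hence these variants. In the same spirit, auxiliary quantities are
    introduced below as opaque variables together with a defining equation. *)
Tactic Notation "lra_on" hyp_list(hs) := clear - hs; lra.
Ltac lra_goal := clear; lra.

(** * Geometry of space-time *)

Section spacetime_geometry.
Context {R : realType} {n : nat}.
Notation st := (spacetime R n).
Implicit Types z w x y : st.

(** Paraboloids are built on the Euclidean product, whose square is smooth,
    whereas neighbourhoods refer to the max norm. *)
Definition ip z w : R :=
  (\sum_k z.1 ord0 k * w.1 ord0 k) + z.2 * w.2.

Definition xd z : R := z.1 ord0 ord_max.

Definition ed : st := (delta_mx ord0 ord_max, 0).

Definition sq z : R := ip z z.

Lemma ipC z w : ip z w = ip w z.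
Proof. by rewrite /ip mulrC; congr (_ + _); apply: eq_bigr => k _; rewrite mulrC. Qed.

Lemma ipDl x y w : ip (x + y) w = ip x w + ip y w.
Proof.
rewrite /ip /= mulrDl addrACA -big_split /=; congr (_ + _).
by apply: eq_bigr => k _; rewrite mxE mulrDl.
Qed.

Lemma ipZl (a : R) x w : ip (a *: x) w = a * ip x w.
Proof.
rewrite /ip /= mulrDr mulr_sumr; congr (_ + _); last by rewrite mulrA.
by apply: eq_bigr => k _; rewrite mxE mulrA.
Qed.

Lemma ipDr x y w : ip w (x + y) = ip w x + ip w y.
Proof. by rewrite ipC ipDl !(ipC w). Qed.

Lemma ipZr (a : R) x w : ip w (a *: x) = a * ip w x.
Proof. by rewrite ipC ipZl ipC. Qed.

Lemma ipNl x w : ip (- x) w = - ip x w.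
Proof. by rewrite -scaleN1r ipZl mulN1r. Qed.

Lemma ipNr x w : ip w (- x) = - ip w x.
Proof. by rewrite ipC ipNl ipC. Qed.

Lemma ipBr x y w : ip w (x - y) = ip w x - ip w y.
Proof. by rewrite ipDr ipNr. Qed.

Lemma ip0l w : ip 0 w = 0.
Proof. by rewrite -(scale0r w) ipZl mul0r. Qed.

Lemma ip0r w : ip w 0 = 0.
Proof. by rewrite ipC ip0l. Qed.

Lemma ip_ed z : ip ed z = xd z.
Proof.
rewrite /ip /xd /= mul0r addr0 (bigD1 ord_max)//= mxE !eqxx mul1r.
by rewrite big1 ?addr0// => k /negPf kn; rewrite mxE kn andbF mul0r.
Qed.

Lemma xdD z w : xd (z + w) = xd z + xd w.
Proof. by rewrite /xd mxE. Qed.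

Lemma xdN z : xd (- z) = - xd z.
Proof. by rewrite /xd mxE. Qed.

Lemma xdB z w : xd (z - w) = xd z - xd w.
Proof. by rewrite xdD xdN. Qed.

Lemma xdZ (a : R) z : xd (a *: z) = a * xd z.
Proof. by rewrite /xd mxE. Qed.

Lemma xd_ed : xd ed = 1.
Proof. by rewrite /xd mxE !eqxx. Qed.

Lemma st_normE z : `|z| = Num.max `|z.1| `|z.2|.
Proof. by []. Qed.

Lemma space_le z : `|z.1| <= `|z|.
Proof. by rewrite st_normE le_max lexx. Qed.

Lemma time_le z : `|z.2| <= `|z|.
Proof. by rewrite st_normE le_max lexx orbT. Qed.

Lemma entry_le (p : 'rV[R]_n.+1) k : `|p ord0 k| <= `|p|.
Proof.
rewrite [leRHS]/Num.Def.normr/= mx_normrE.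
by apply/bigmax_geP; right => /=; exists (ord0, k).
Qed.

Lemma rV_norm_le (p : 'rV[R]_n.+1) c : 0 <= c ->
  (forall k, `|p ord0 k| <= c) -> `|p| <= c.
Proof.
move=> c0 h; rewrite [leLHS]/Num.Def.normr/= mx_normrE.
by apply: bigmax_le => // -[i k] _ /=; rewrite (ord1 i).
Qed.

Lemma coord_le z k : `|z.1 ord0 k| <= `|z|.
Proof. exact: le_trans (entry_le _ _) (space_le _). Qed.

Lemma xd_le z : `|xd z| <= `|z|.
Proof. exact: coord_le. Qed.

Lemma norm_ed : `|ed| = 1.
Proof.
apply/eqP; rewrite eq_le; apply/andP; split.
  rewrite st_normE /= normr0 ge_max ler01 andbT; apply: rV_norm_le => // k.
  by rewrite mxE; case: (_ && _); rewrite ?normr0 ?normr1.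
by have := xd_le ed; rewrite xd_ed normr1.
Qed.

Lemma ip_le z w : `|ip z w| <= (n.+2)%:R * (`|z| * `|w|).
Proof.
apply: le_trans (ler_normD _ _) _.
rewrite -natr1 mulrDl mul1r; apply: lerD; last first.
  by rewrite normrM; apply: ler_pM => //; apply: time_le.
apply: le_trans (ler_norm_sum _ _ _) _.
have -> : n.+1%:R * (`|z| * `|w|) = \sum_(k < n.+1) (`|z| * `|w|).
  by rewrite sumr_const card_ord mulr_natl.
by apply: ler_sum => k _; rewrite normrM; apply: ler_pM => //; apply: coord_le.
Qed.

Lemma sq_ge0 z : 0 <= sq z.
Proof.
by apply: addr_ge0; [apply: sumr_ge0 => k _|]; rewrite -expr2 sqr_ge0.
Qed.

Lemma coord_sq z k : z.1 ord0 k ^+ 2 <= sq z.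
Proof.
rewrite /sq /ip (bigD1 k)//= -addrA expr2 lerDl.
by apply: addr_ge0; [apply: sumr_ge0 => i _|]; rewrite -expr2 sqr_ge0.
Qed.

Lemma xd_sq z : xd z ^+ 2 <= sq z.
Proof. exact: coord_sq. Qed.

Lemma time_sq z : z.2 ^+ 2 <= sq z.
Proof.
by rewrite /sq /ip expr2 lerDr; apply: sumr_ge0 => k _; rewrite -expr2 sqr_ge0.
Qed.

Lemma norm_sq z : `|z| ^+ 2 <= sq z.
Proof.
suff : `|z| <= Num.sqrt (sq z).
  move=> h; rewrite -(sqr_sqrtr (sq_ge0 z)).
  by rewrite ler_sqr ?nnegrE ?sqrtr_ge0.
have aux (a : R) : a ^+ 2 <= sq z -> `|a| <= Num.sqrt (sq z).
  by move=> h; rewrite -sqrtr_sqr ler_wsqrtr.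
rewrite st_normE ge_max (aux _ (time_sq z)) andbT.
by apply: rV_norm_le; [exact: sqrtr_ge0|move=> k; exact/aux/coord_sq].
Qed.

Lemma sq_le z : sq z <= (n.+2)%:R * `|z| ^+ 2.
Proof. by rewrite expr2; apply: le_trans (ler_norm _) (ip_le _ _). Qed.

Lemma sqD z w : sq (z + w) = sq z + 2 * ip z w + sq w.
Proof. rewrite /sq ipDl !ipDr (ipC w z); ring. Qed.

Lemma sqN z : sq (- z) = sq z.
Proof. by rewrite /sq ipNl ipNr opprK. Qed.

Lemma sqZ a z : sq (a *: z) = a ^+ 2 * sq z.
Proof. by rewrite /sq ipZl ipZr mulrA expr2. Qed.

Lemma sq0 : sq 0 = 0.
Proof. exact: ip0l. Qed.

Lemma sq_recenter z z0 z1 :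
  sq (z - z0) = sq (z1 - z0) + ip (2 *: (z1 - z0)) (z - z1) + sq (z - z1).
Proof.
have -> : z - z0 = (z1 - z0) + (z - z1) by rewrite [RHS]addrC addrA subrK.
by rewrite sqD ipZl.
Qed.

Lemma sq_bound z c : 0 <= c -> sq z <= c ^+ 2 -> `|z| <= c.
Proof.
move=> c0 h; rewrite -(@ler_pXn2r _ 2)// ?nnegrE//.
exact: le_trans (norm_sq z) h.
Qed.

Lemma ip_young z w : 2 * ip z w <= sq z + sq w.
Proof.
by have := sq_ge0 (z - w); rewrite sqD sqN ipNr; lra.
Qed.

Lemma sqB_le z w : sq (z - w) <= 2 * sq z + 2 * sq w.
Proof. by have := ip_young z (- w); rewrite sqD sqN; lra. Qed.

End spacetime_geometry.

(** * Semicontinuous functions on compact sets *)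

Section compactness.
Context {R : realType}.

Lemma nbhs_distP (X : normedModType R) (z : X) (P : set X) :
  nbhs z P <-> exists2 r : R, 0 < r & forall w, `|w - z| < r -> P w.
Proof.
split=> [/nbhs_normP[r /= r0 h]|[r r0 h]].
  by exists r => // w wz; apply: h; rewrite /ball_ /= distrC.
by apply/nbhs_normP; exists r => // w; rewrite /ball_ /= distrC => /h.
Qed.

Lemma continuous_distP (X : normedModType R) (f : X -> R) :
  continuous f <-> forall z (e : R), 0 < e -> exists2 r : R, 0 < r &
    forall w, `|w - z| < r -> `|f w - f z| < e.
Proof.
split=> [cf z e e0|h z].
  have /cvgrPdist_lt/(_ _ e0)/nbhs_distP[r r0 hr] := cf z.
  by exists r => // w /hr; rewrite distrC.
apply/cvgrPdist_lt => e e0; apply/nbhs_distP.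
by have [r r0 hr] := h z e e0; exists r => // w /hr; rewrite distrC.
Qed.

(** A property that holds near every point of a compact set, once a small
    parameter is small enough there, holds everywhere for one threshold. *)
Lemma near_compact (X : normedModType R) (A : set X) (Pr : R -> X -> Prop) :
  compact A ->
  (forall x, A x -> exists2 r : R, 0 < r &
     forall (h : R) y, 0 < h -> h < r -> A y -> `|y - x| < r -> Pr h y) ->
  exists2 h0 : R, 0 < h0 & forall (h : R) y, 0 < h -> h < h0 -> A y -> Pr h y.
Proof.
move=> /compact_near_coveringP cA loc.
have [h0 h00 hh0] : \forall h \near (0 : R)^'+, A `<=` (fun y => A y -> Pr h y).
- apply: cA => x /loc[r r0 hr].
  exists ([set y | `|y - x| < r], [set h | 0 < h < r]).
    split=> /=.
      by apply/nbhs_normP; exists r => //= y; rewrite /ball_ /= distrC.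
    near=> h; apply/andP; split; first by near: h; exact: nbhs_right_gt.
    by near: h; exact: nbhs_right_lt.
  by move=> [y h] /= [yx /andP[? ?]] Ay; apply: hr.
- exists h0 => // h y hp hh Ay.
  by apply: (hh0 h) => //=; rewrite sub0r normrN gtr0_norm.
Unshelve. all: by end_near. Qed.

Definition usc_on (X : normedModType R) (A : set X) (f : X -> R) :=
  forall x, A x -> forall e : R, 0 < e -> exists2 r : R, 0 < r &
    forall y, A y -> `|y - x| < r -> f y < f x + e.

Lemma usc_on_max (X : normedModType R) (A : set X) (f : X -> R) x0 :
  compact A -> A x0 -> usc_on A f ->
  exists2 x, A x & forall y, A y -> f y <= f x.
Proof.
move=> cA Ax0 uf.
have [|h0 h00 fb] := @near_compact X A (fun h y => f y < h^-1) cA.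
  move=> x Ax.
  have [r r0 hr] := uf x Ax 1 ltr01.
  exists (Num.min r (`|f x| + 1)^-1); first by rewrite lt_min r0 invr_gt0; have := normr_ge0 (f x); lra.
  move=> h y hp; rewrite !lt_min => /andP[_ hh] Ay /andP[yx _].
  have xp : 0 < `|f x| + 1 by have := normr_ge0 (f x); lra.
  apply: lt_trans (hr y Ay yx) _.
  apply: le_lt_trans (_ : _ <= `|f x| + 1) _.
    by rewrite lerD2r ler_norm.
  by rewrite -[ltLHS]invrK ltf_pV2 ?posrE// invr_gt0.
have hS : has_sup (f @` A).
  split; first by exists (f x0), x0.
  exists (h0 / 2)^-1 => _ [y Ay <-]; apply/ltW/fb => //; lra.
have ub y : A y -> f y <= sup (f @` A).
  by move=> Ay; apply: sup_upper_bound => //; exists y.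
apply: contrapT => no.
have lt x : A x -> f x < sup (f @` A).
  move=> Ax; rewrite lt_neqAle ub// andbT; apply/eqP => E.
  by apply: no; exists x => // y Ay; rewrite E; exact: ub.
have [|h1 h10 fb1] := @near_compact X A (fun h y => f y < sup (f @` A) - h) cA.
  move=> x Ax.
  have dx : 0 < (sup (f @` A) - f x) / 2 by have := lt x Ax; lra.
  have [r r0 hr] := uf x Ax _ dx.
  exists (Num.min r ((sup (f @` A) - f x) / 2)); first by rewrite lt_min r0.
  move=> h y hp; rewrite !lt_min => /andP[_ hh] Ay /andP[yx _].
  by apply: lt_trans (hr y Ay yx) _; lra.
have h2 : 0 < h1 / 2 by lra.
have [_ [y Ay <-]] := sup_adherent h2 hS.
have := fb1 (h1 / 2) y h2 _ Ay; move=> /(_ ltac:(lra)); lra.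
Qed.

Lemma usc_on_pair (X Y : normedModType R) (A : set X) (C : set Y) f g (h : X * Y -> R) :
  usc_on A f -> usc_on C g -> continuous h ->
  usc_on (A `*` C) (fun y => f y.1 + g y.2 - h y).
Proof.
move=> uf ug ch [z w] [/= Az Aw] e e0; have e3 : 0 < e / 3 by lra_on e0.
have [d1 d10 h1] := uf z Az _ e3.
have [d2 d20 h2] := ug w Aw _ e3.
have [d3 d30 h3] := (continuous_distP _).1 ch (z, w) _ e3.
exists (Num.min d3 (Num.min d1 d2)); first by rewrite !lt_min d30 d10.
move=> [y1 y2] [Ay1 Ay2]; rewrite lt_min => /andP[hy3 hy].
have : Num.max `|y1 - z| `|y2 - w| < Num.min d1 d2 by [].
rewrite gt_max !lt_min => /andP[/andP[y1z _] /andP[_ y2w]].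
have := h1 y1 Ay1 y1z; have := h2 y2 Ay2 y2w; have := h3 (y1, y2) hy3.
by rewrite ltr_norml /= => /andP[q _]; move: q; lra_goal.
Qed.

End compactness.

(** * Sub-solutions tested with paraboloids *)

Section finite_choices.
Context {R : realType} {K : nat}.

Lemma fin_common_small (Pr : 'I_K -> R -> Prop) :
  (forall j, exists2 a : R, 0 < a & Pr j a) ->
  (forall j a b, 0 < b -> b <= a -> Pr j a -> Pr j b) ->
  exists2 a : R, 0 < a & forall j, Pr j a.
Proof.
move=> /(_ _)/cid2 h mon.
have m0 : 0 < \big[Num.min/1]_(j < K) projT1 (h j).
  by apply: lt_bigmin => // j _; case: (h j).
exists (\big[Num.min/1]_(j < K) projT1 (h j)) => // j.
apply: (mon j (projT1 (h j))) => //; last by case: (h j).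
exact: bigmin_le_cond.
Qed.

Lemma fin_common_large (Pr : 'I_K -> R -> Prop) :
  (forall j, exists a : R, Pr j a) ->
  (forall j a b, a <= b -> Pr j a -> Pr j b) ->
  exists2 a : R, 0 <= a & forall j, Pr j a.
Proof.
move=> /(_ _)/cid h mon.
exists (\big[Num.max/0]_(j < K) projT1 (h j)); first exact: bigmax_ge_id.
move=> j; apply: (mon j (projT1 (h j))); last by case: (h j).
exact: le_bigmax_cond.
Qed.

Lemma fin_argmax (adm : 'I_K -> Prop) (f : 'I_K -> R) i0 : adm i0 ->
  exists2 j, adm j & forall j', adm j' -> f j' <= f j.
Proof.
move=> /asboolP a0; case: (@Order.TotalTheory.arg_maxP _ _ _ i0 (fun j => `[< adm j >]) f a0).
by move=> j /asboolP aj hj; exists j => // j' /asboolP/hj.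
Qed.

End finite_choices.

Section uniform_continuity.
Context {R : realType} {K : nat} (V : normedModType R) (A L : set V).
Implicit Types (u : 'I_K -> V -> R).

Lemma BUC_bounded u :
  BUC A L u -> exists2 M : R, 0 <= M & forall i z, A z -> `|u i z| <= M.
Proof.
move=> [_ bu]; apply: fin_common_large => [j|j a b ab h z Az].
  by have [] := bu j.
exact: le_trans (h z Az) ab.
Qed.

Lemma BUC_modulus u :
  BUC A L u -> forall e : R, 0 < e -> exists2 r : R, 0 < r & forall i y z, A y -> A z ->
    `|y - z| < r -> `|u i y - u i z| < e.
Proof.
move=> [_ bu] e e0; apply: fin_common_small => [j|j a b b0 ba h y z Ay Az yz].
  by have [_ h] := bu j; exact: h.
by apply: h => //; exact: lt_le_trans ba.
Qed.

Lemma BUCN u :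
  BUC A L u -> BUC A L (fun i z => - u i z).
Proof.
move=> [ag bu]; split=> [i j z Lz|i]; first by rewrite (ag i j).
have [[M hM] h] := bu i; split; first by exists M => z Az; rewrite normrN; exact: hM.
move=> e e0; have [r r0 hr] := h e e0; exists r => // y z Ay Az yz.
by rewrite -opprD normrN; exact: hr.
Qed.

End uniform_continuity.

Section junction_problem.
Context {R : realType} {n K : nat} (T : R).
Notation st := (spacetime R n).
Notation branch := (cylinder T (@halfspace R n)).
Implicit Types (z w P : st) (u : 'I_K -> st -> R).

Lemma xd_continuous : continuous (@xd R n).
Proof.
apply/continuous_distP => z e e0; exists e => // w zw.
by rewrite -xdB; apply: le_lt_trans (xd_le _) zw.
Qed.

Lemma xd_diff_continuous : continuous (fun y : st * st => xd y.1 - xd y.2).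
Proof.
move=> y; apply: cvgB.
  by apply: (@continuous_comp _ _ _ fst (@xd R n)); [exact: cvg_fst|exact: xd_continuous].
by apply: (@continuous_comp _ _ _ snd (@xd R n)); [exact: cvg_snd|exact: xd_continuous].
Qed.

Lemma time_continuous : continuous (fun z : st => z.2).
Proof.
apply/continuous_distP => z e e0; exists e => // w zw.
exact: le_lt_trans (time_le (w - z)) zw.
Qed.

Lemma ip_continuous P : continuous (ip P).
Proof.
apply/continuous_distP => z e e0.
have c0 : 0 < n.+2%:R * (`|P| + 1) by rewrite mulr_gt0// ltr_wpDl.
exists (e / (n.+2%:R * (`|P| + 1))); first by rewrite divr_gt0.
move=> w zw; rewrite -ipBr; apply: le_lt_trans (ip_le _ _) _.
apply: (@le_lt_trans _ _ (n.+2%:R * (`|P| + 1) * `|w - z|)).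
  by rewrite mulrA ler_wpM2r// ler_wpM2l// lerDl.
by rewrite mulrC -ltr_pdivlMr.
Qed.

Lemma sq_continuous z0 : continuous (fun z => sq (z - z0)).
Proof.
apply/continuous_distP => z e e0.
set c := n.+2%:R * (2 * `|z - z0| + 1).
have c0 : 0 < c.
  by rewrite mulr_gt0//; have := normr_ge0 (z - z0); lra.
exists (Num.min 1 (e / c)); first by rewrite lt_min ltr01 divr_gt0.
move=> w; rewrite lt_min => /andP[w1 we].
rewrite (sq_recenter w z0 z).
have -> : sq (z - z0) + ip (2 *: (z - z0)) (w - z) + sq (w - z) - sq (z - z0)
  = ip (2 *: (z - z0) + (w - z)) (w - z) by rewrite ipDl /sq; ring.
apply: le_lt_trans (ip_le _ _) _; rewrite mulrA.
apply: (@le_lt_trans _ _ (c * `|w - z|)).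
  rewrite ler_wpM2r// ler_wpM2l//; apply: le_trans (ler_normD _ _) _.
  by rewrite normrZ ger0_norm// lerD// ltW.
by rewrite mulrC -ltr_pdivlMr.
Qed.

Lemma ip_shift_continuous P z0 : continuous (fun z => ip P (z - z0)).
Proof.
have -> : (fun z : st => ip P (z - z0)) = (fun z => ip P z - ip P z0).
  by apply/funext => y; rewrite ipBr.
by move=> z; apply: cvgB; [exact: ip_continuous|exact: cvg_cst].
Qed.

Lemma quad_continuous P z0 (a k c d : R) :
  continuous (fun z => a + ip P (z - z0) + k * sq (z - z0) + c * xd z + d * xd z ^+ 2).
Proof.
move=> z; apply: cvgD; last first.
  apply: cvgM; first exact: cvg_cst.
  by apply: cvgM; exact: xd_continuous.
apply: cvgD; last by apply: cvgM; [exact: cvg_cst|exact: xd_continuous].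
apply: cvgD; last by apply: cvgM; [exact: cvg_cst|exact: sq_continuous].
by apply: cvgD; [exact: cvg_cst|exact: ip_shift_continuous].
Qed.

Lemma closed_branch : closed (branch : set st).
Proof.
have -> : branch = [set z : st | xd z <= 0] `&` [set z : st | 0 <= z.2] `&`
    [set z : st | z.2 <= T].
  apply/seteqP; split => z.
    by move=> [h /andP[? ?]]; do ! split.
  by move=> [[h1 h2] h3]; split => //; apply/andP.
apply: closedI; first apply: closedI.
- apply: (@closed_comp _ _ (@xd R n) [set x | x <= 0]) => [z _|]; first exact: xd_continuous.
  exact: closed_le.
- apply: (@closed_comp _ _ (fun z : st => z.2) [set x | 0 <= x]) => [z _|]; first exact: time_continuous.
  exact: closed_ge.
- apply: (@closed_comp _ _ (fun z : st => z.2) [set x | x <= T]) => [z _|]; first exact: time_continuous.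
  exact: closed_le.
Qed.

Lemma closed_bounded_compact (A : set st) (M : R) :
  closed A -> (forall z, A z -> `|z| <= M) -> compact A.
Proof.
move=> clA bA.
have c1 : compact [set p : 'rV[R]_n.+1 | `|p| <= M].
  apply: bounded_closed_compact.
    by exists M; rewrite num_real; split=> // x xM p /= h; apply: le_trans h (ltW xM).
  apply: (@closed_comp _ _ (fun p : 'rV[R]_n.+1 => `|p|) [set x | x <= M]).
    by move=> p _; exact: norm_continuous.
  exact: closed_le.
have c2 : compact `[- M, M]%classic by exact: segment_compact.
apply: subclosed_compact clA (compact_setX c1 c2) _ => z Az; split => /=.
  exact: le_trans (space_le z) (bA z Az).
by rewrite in_itv /= -ler_norml; exact: le_trans (time_le z) (bA z Az).
Qed.

Lemma closed_dist_le (z0 : st) (r : R) : closed [set z : st | `|z - z0| <= r].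
Proof.
apply: (@closed_comp _ _ (fun z : st => `|z - z0|) [set x | x <= r]).
  move=> z _; apply: (@continuous_comp _ _ _ (fun z : st => z - z0) (fun z => `|z|)).
    by apply: continuousB; [exact: cvg_id|exact: cvg_cst].
  exact: norm_continuous.
exact: closed_le.
Qed.

Lemma compact_branch_ball z0 (r : R) :
  compact [set z | branch z /\ `|z - z0| <= r].
Proof.
apply: (@closed_bounded_compact _ (r + `|z0|)).
  by apply: closedI; [exact: closed_branch|exact: closed_dist_le].
move=> z [_ h]; rewrite -(subrK z0 z).
by apply: le_trans (ler_normD _ _) _; rewrite lerD2r.
Qed.

(** Upper semicontinuity on the glued space: a neighbourhood of a junction
    point meets every branch. *)
Definition jusc u := forall i z0, branch z0 -> forall e : R, 0 < e ->
  exists2 r : R, 0 < r & forall j z, (j = i \/ xd z0 = 0) -> branch z ->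
    `|z - z0| < r -> u j z < u i z0 + e.

Lemma jusc_agree u i j z : jusc u -> branch z -> xd z = 0 -> u i z = u j z.
Proof.
move=> uu bz z0; apply/eqP; rewrite eq_le; apply/andP.
by split; apply/ler_addgt0Pr => e e0;
  [have [r r0 h] := uu j z bz e e0|have [r r0 h] := uu i z bz e e0];
  apply/ltW/h => //; rewrite ?subrr ?normr0//; right.
Qed.

Lemma jusc_usc_on u j (A : set st) : A `<=` branch -> jusc u -> usc_on A (u j).
Proof.
move=> Ab uu z Az e e0; have [r r0 h] := uu j z (Ab _ Az) e e0.
by exists r => // y Ay yz; apply: h => //; [left|exact: Ab].
Qed.

Lemma usc_on_sub (A : set st) (f g : st -> R) :
  usc_on A f -> continuous g -> usc_on A (fun z => f z - g z).
Proof.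
move=> uf cg z Az e e0.
have e2 : 0 < e / 2 by lra.
have [r r0 h] := uf z Az _ e2.
have [r' r'0 h'] := (continuous_distP g).1 cg z _ e2.
exists (Num.min r r'); first by rewrite lt_min r0.
move=> y Ay; rewrite lt_min => /andP[yr yr'].
have := h y Ay yr; have := h' y yr'.
rewrite ltr_norml => /andP[? _]; lra.
Qed.

Lemma glued_max u (phi : 'I_K -> st -> R) (adm : 'I_K -> Prop) (A : set st) i0 x0 :
  jusc u -> (forall j, continuous (phi j)) ->
  compact A -> A `<=` branch -> adm i0 -> A x0 ->
  exists j z1, [/\ adm j, A z1 & forall j' z, adm j' -> A z ->
     u j' z - phi j' z <= u j z1 - phi j z1].
Proof.
move=> uu cphi cA Ab a0 Ax0.
have /(_ _)/cid2 m j : exists2 z, A z & forall y, A y ->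
    u j y - phi j y <= u j z - phi j z.
  apply: (@usc_on_max _ _ A (fun y => u j y - phi j y) x0 cA Ax0).
  by apply: usc_on_sub => //; exact: jusc_usc_on.
have [j aj hj] := @fin_argmax R K adm
  (fun j => u j (projT1 (m j)) - phi j (projT1 (m j))) i0 a0.
exists j, (projT1 (m j)); split => //; first by case: (m j).
move=> j' z aj' Az; apply: le_trans (hj j' aj').
by case: (m j') => /= z' _; exact.
Qed.

Section operators.
Implicit Types H : 'I_K -> 'rV[R]_n.+1 -> R -> 'rV[R]_n.+1 -> R -> R.

(** The first-order operator on a space-time covector P, whose last entry
    stands for the time derivative. *)
Definition op H (j : 'I_K) P (s : R) z : R := P.2 + H j P.1 s z.1 z.2.

(** Viscosity sub-solutions tested with paraboloids, whose normal derivative may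
    change by r j from branch to branch. In the application eps is the viscosity
    times twice the space dimension, so that eps * k is the viscous term of
    a paraboloid of opening k. *)
Definition psub H (B eps : R) u :=
  forall (k : R) P (r : 'I_K -> R) i z0, 0 <= k -> branch z0 -> 0 < z0.2 ->
  (exists2 rho : R, 0 < rho & forall j z, (j = i \/ xd z0 = 0) -> branch z ->
     `|z - z0| < rho ->
     u j z <= u i z0 + ip P (z - z0) + r j * xd (z - z0) + k * sq (z - z0)) ->
  (xd z0 = 0 /\ \sum_j (xd P + r j) <= B) \/
  exists2 j, (j = i \/ xd z0 = 0) & op H j (P + r j *: ed) (u j z0) z0 <= eps * k.

(** The form in which contact arises by maximizing u minus a paraboloid that is
    centred at some other point z0. *)
Lemma psub_at H B eps u (k : R) P (r : 'I_K -> R) i z0 z1 :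
  psub H B eps u -> 0 <= k -> branch z1 -> 0 < z1.2 ->
  (exists2 rho : R, 0 < rho & forall j z, (j = i \/ xd z1 = 0) -> branch z ->
     `|z - z1| < rho ->
     u j z - (ip P (z - z0) + r j * xd z + k * sq (z - z0)) <=
     u i z1 - (ip P (z1 - z0) + r i * xd z1 + k * sq (z1 - z0))) ->
  (xd z1 = 0 /\ \sum_j (xd P + 2 * k * xd (z1 - z0) + r j) <= B) \/
  exists2 j, (j = i \/ xd z1 = 0) &
    op H j (P + (2 * k) *: (z1 - z0) + r j *: ed) (u j z1) z1 <= eps * k.
Proof.
move=> su k0 bz1 t1 [rho rho0 h].
have := su k (P + (2 * k) *: (z1 - z0)) r i z1 k0 bz1 t1.
rewrite xdD xdZ; apply; exists rho => // j z aj bz zz1.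
have := h j z aj bz zz1; rewrite (sq_recenter z z0 z1) ipDl.
have -> : ip P (z - z0) = ip P (z - z1) + ip P (z1 - z0) by rewrite -ipDr subrKA.
have -> : r j * xd z = r j * xd (z - z1) + r j * xd z1 by rewrite xdB; ring.
have -> : r j * xd z1 = r i * xd z1 by case: aj => [->//|->]; rewrite !mulr0.
by rewrite !ipZl -mulrA; lra.
Qed.

(** u is a super-solution for H exactly when - u is a sub-solution for the
    reflected Hamiltonian. *)
Definition reflect_H H : 'I_K -> 'rV[R]_n.+1 -> R -> 'rV[R]_n.+1 -> R -> R :=
  fun j p s x t => - H j (- p) (- s) x t.

Lemma op_reflect H j P s z : op (reflect_H H) j P s z = - op H j (- P) (- s) z.
Proof. by rewrite /op /reflect_H opprD; congr (_ + _); exact: esym (opprK _). Qed.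

Lemma reflect_HK H : reflect_H (reflect_H H) = H.
Proof.
by apply/funext => j; do 4 apply/funext => ?; rewrite /reflect_H /= !opprK.
Qed.

Lemma reflect_lipschitz H i : lipschitz_ut T H i -> lipschitz_ut T (reflect_H H) i.
Proof.
move=> [C hC]; exists C => p s1 s2 x t1 t2 hx h1 h2.
rewrite /reflect_H -opprD normrN.
have -> : H i (- p) (- s1) x t1 + - H i (- p) (- s2) x t2 =
  H i (- p) (- s1) x t1 - H i (- p) (- s2) x t2 by [].
apply: le_trans (hC _ _ _ _ _ _ hx h1 h2) _.
by rewrite -opprD normrN.
Qed.

Lemma reflect_unif_cont H i :
  unif_cont_bounded T H i -> unif_cont_bounded T (reflect_H H) i.
Proof.
move=> h r e r0 e0; have [a a0 ha] := h r e r0 e0; exists a => //.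
move=> p1 p2 s1 s2 x1 x2 t1 t2 hp1 hp2 hs1 hs2 hx1 hx2 ht1 ht2 dp ds dx dt.
by rewrite /reflect_H -opprD normrN; apply: ha; rewrite ?normrN// -opprD normrN.
Qed.

Lemma op_unif_cont H : (forall i, unif_cont_bounded T H i) ->
  forall r e : R, 0 < r -> 0 < e -> exists2 a : R, 0 < a &
  forall j P1 P2 (s1 s2 : R) z1 z2, `|P1| <= r -> `|P2| <= r -> `|s1| <= r ->
    `|s2| <= r -> branch z1 -> branch z2 ->
    `|P1 - P2| < a -> `|s1 - s2| < a -> `|z1 - z2| < a ->
    `|op H j P1 s1 z1 - op H j P2 s2 z2| < e.
Proof.
move=> uc r e r0 e0; apply: fin_common_small => [j|j a b b0 ba h]; last first.
  by move=> P1 P2 s1 s2 z1 z2 *; apply: h => //; apply: lt_le_trans ba.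
have e2 : 0 < e / 2 by lra.
have [a a0 ha] := uc j r _ r0 e2.
exists (Num.min a (e / 2)); first by rewrite lt_min a0.
move=> P1 P2 s1 s2 z1 z2 hP1 hP2 hs1 hs2 [b1 t1] [b2 t2].
rewrite !lt_min => /andP[dP dP'] /andP[ds _] /andP[dz _].
have l1 P : `|P| <= r -> `|P.1| <= r by apply: le_trans (space_le P).
have -> : op H j P1 s1 z1 - op H j P2 s2 z2 = (P1 - P2).2 +
   (H j P1.1 s1 z1.1 z1.2 - H j P2.1 s2 z2.1 z2.2) by rewrite /op /=; ring.
apply: le_lt_trans (ler_normD _ _) _.
have := le_lt_trans (time_le (P1 - P2)) dP'.
have : `|H j P1.1 s1 z1.1 z1.2 - H j P2.1 s2 z2.1 z2.2| < e / 2.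
  apply: ha; rewrite ?l1//.
  - exact: le_lt_trans (space_le (P1 - P2)) dP.
  - exact: le_lt_trans (space_le (z1 - z2)) dz.
  - exact: le_lt_trans (time_le (z1 - z2)) dz.
by move=> ? ?; lra.
Qed.

Lemma op_cont H : (forall i, unif_cont_bounded T H i) ->
  forall P0 (s0 : R) z0 (e : R), branch z0 -> 0 < e -> exists2 a : R, 0 < a &
  forall j P (s : R) z, branch z -> `|P - P0| < a -> `|s - s0| < a -> `|z - z0| < a ->
    `|op H j P s z - op H j P0 s0 z0| < e.
Proof.
move=> uc P0 s0 z0 e bz e0.
set r := `|P0| + `|s0| + 1.
have r1 : `|P0| <= r by have := normr_ge0 s0; rewrite /r; lra.
have r2 : `|s0| <= r by have := normr_ge0 P0; rewrite /r; lra.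
have r0 : 0 < r by have := normr_ge0 s0; have := normr_ge0 P0; rewrite /r; lra.
have [a a0 ha] := op_unif_cont uc r0 e0.
exists (Num.min a 1); first by rewrite lt_min a0 ltr01.
move=> j P s z bz'; rewrite !lt_min => /andP[dP dP1] /andP[ds ds1] /andP[dz _].
apply: ha => //.
  have := ler_normD (P - P0) P0; rewrite subrK; have := normr_ge0 s0; rewrite /r; lra.
have := ler_normD (s - s0) s0; rewrite subrK; have := normr_ge0 P0; rewrite /r; lra.
Qed.

Lemma op_le_closed H : (forall i, unif_cont_bounded T H i) ->
  forall j P0 (s0 : R) z0 (c : R), branch z0 ->
  (forall a : R, 0 < a -> exists P (s : R) z, [/\ branch z, `|P - P0| < a, `|s - s0| < a,
     `|z - z0| < a & op H j P s z <= c]) -> op H j P0 s0 z0 <= c.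
Proof.
move=> uc j P0 s0 z0 c bz h; apply/ler_addgt0Pr => e e0.
have [a a0 ha] := op_cont uc P0 s0 bz e0.
have [P [s [z [bz' dP ds dz le]]]] := h a a0.
have := ha j P s z bz' dP ds dz; rewrite ltr_norml => /andP[? _]; lra.
Qed.

End operators.
End junction_problem.

(** * Critical slopes at the junction *)

Section junction_slopes.
Context {R : realType} {n K : nat} (T : R).
Notation st := (spacetime R n).
Notation branch := (cylinder T (@halfspace R n)).
Implicit Types (z w P : st) (u : 'I_K -> st -> R).
Implicit Types H : 'I_K -> 'rV[R]_n.+1 -> R -> 'rV[R]_n.+1 -> R -> R.

Lemma time_shift_ed P (r : R) : (P + r *: ed).2 = P.2.
Proof. by rewrite /= scaler0 addr0. Qed.

Lemma xd_shift_ed P (r : R) : xd (P + r *: ed) = xd P + r.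
Proof. by rewrite xdD xdZ xd_ed mulr1. Qed.

Lemma op_coercive H : (forall i, coercive T H i) -> forall c M : R,
  exists2 b : R, 0 <= b & forall j P s z, branch z -> `|s| <= c ->
    `|P.2| <= c -> b <= `|P.1| -> M <= op H j P s z.
Proof.
move=> hco c M; apply: fin_common_large => [j|j a b ab h]; last first.
  by move=> P s z bz hs hP hb; apply: h => //; apply: le_trans hb.
have c0 : 0 < `|c| + 1 by have := normr_ge0 c; lra.
have [b hb] := hco j _ (M + c) c0.
exists b => P s z [hx ht] hs hP hbP.
have := hb P.1 s z.1 z.2 hbP _ hx ht; rewrite /op.
have -> : `|s| <= `|c| + 1 by have := ler_norm c; lra.
by move=> /(_ isT); move: hP; rewrite ler_norml => /andP[? ?]; lra.
Qed.

(** The residue of u once the paraboloid touching it at zu is taken off. *)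
Definition res u j zu P (k : R) z : R :=
  u j z - u j zu - ip P (z - zu) - k * sq (z - zu).

Lemma res_usc u j zu P k (A : set st) : A `<=` branch -> jusc T u ->
  usc_on A (res u j zu P k).
Proof.
move=> Ab uu.
have h := @usc_on_sub R n A (u j) _ (jusc_usc_on j Ab uu)
  (@quad_continuous R n P zu (u j zu) k 0 0).
have E z : u j z - (u j zu + ip P (z - zu) + k * sq (z - zu) + 0 * xd z + 0 * xd z ^+ 2)
   = res u j zu P k z by rewrite /res; ring.
move=> x Ax e e0; have [r r0 hr] := h x Ax e e0.
by exists r => // y Ay yx; rewrite -!E; exact: hr.
Qed.

Lemma res0 u j zu P k : res u j zu P k zu = 0.
Proof. by rewrite /res !subrr ip0r sq0 mulr0 !subr0. Qed.

Lemma res_sub u j zu P k z z1 : res u j zu P k z - res u j zu P k z1 =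
  u j z - u j z1 - ip (P + (2 * k) *: (z1 - zu)) (z - z1) - k * sq (z - z1).
Proof.
rewrite /res (sq_recenter z zu z1) ipDl !ipZl.
have -> : ip P (z - zu) = ip P (z - z1) + ip P (z1 - zu) by rewrite -ipDr subrKA.
ring.
Qed.

(** By compactness and upper semicontinuity, a strict bound on the junction away
    from zu extends to a strip next to it. *)
Lemma res_strict u j zu P k (rho0 rho : R) : jusc T u -> 0 < rho ->
  (forall z, branch z -> `|z - zu| <= rho0 -> xd z = 0 ->
     res u j zu P k z <= - sq (z - zu)) ->
  exists2 h : R, 0 < h & forall z, branch z -> rho <= `|z - zu| ->
    `|z - zu| <= rho0 -> - h < xd z -> res u j zu P k z < - h.
Proof.
move=> uu rho_gt0 hL.
have cA := @compact_branch_ball R n T zu rho0.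
have [|h h0 hh] := @near_compact R st _ (fun h z => rho <= `|z - zu| -> - h < xd z ->
   res u j zu P k z < - h) cA.
  move=> x [bx xr].
  have [xzu|xzu] := ltP `|x - zu| rho.
    exists (rho - `|x - zu|) => [|h y _ _ _ yx hy]; first lra.
    have := ler_normD (y - x) (x - zu); rewrite subrKA; lra.
  have : xd x <= 0 by case: bx.
  rewrite le_eqVlt => /orP[/eqP x0|x0]; last first.
    exists (- xd x / 2) => [|h y _ hx _ yx _ hy]; first lra.
    have := le_lt_trans (xd_le _) yx; rewrite xdB ltr_norml => /andP[_ ?]; lra.
  have r2 : 0 < rho ^+ 2 / 2 by rewrite divr_gt0// exprn_gt0.
  have Ab : [set z | branch z /\ `|z - zu| <= rho0] `<=` branch by move=> z [].
  have [r r0 hr] := res_usc j zu P k Ab uu (conj bx xr) r2.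
  exists (Num.min r (rho ^+ 2 / 2)); first by rewrite lt_min r0.
  move=> h y hp; rewrite !lt_min => /andP[_ hh] Ay /andP[yx _] _ _.
  have := hr y Ay yx; have := hL x bx xr x0.
  have : rho ^+ 2 <= sq (x - zu).
    by apply: le_trans (norm_sq _); rewrite ler_sqr ?nnegrE// ltW.
  by lra.
exists (h / 2) => [|z bz zr zr0 zh]; first lra.
by apply: hh => //; lra.
Qed.

(** If values near zu exceed every slope above r, while on levels xd = y close to
    the junction they obey every slope below r, then functions of slope close to
    r touch u from above at points of the branch that tend to zu. *)
Lemma critical_slope H B u j zu P k (rho0 r : R) :
  (forall i, unif_cont_bounded T H i) -> jusc T u -> psub T H B 0 u ->
  branch zu -> xd zu = 0 -> 0 < zu.2 -> 0 < rho0 -> 0 <= k ->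
  (forall z, branch z -> `|z - zu| <= rho0 -> xd z = 0 ->
     res u j zu P k z <= - sq (z - zu)) ->
  (forall d h : R, 0 < d -> 0 < h -> exists z, [/\ branch z, `|z - zu| < h &
     (r + d) * xd z < res u j zu P k z]) ->
  (forall d : R, 0 < d -> exists2 rho1 : R, 0 < rho1 & forall h : R, 0 < h ->
     exists y : R, [/\ - h < y, y < 0 & forall z, branch z -> `|z - zu| <= rho1 ->
       xd z = y -> res u j zu P k z <= (r - d) * y]) ->
  op H j (P + r *: ed) (u j zu) zu <= 0.
Proof.
move=> uc uu su bzu xzu tzu rho00 k0 hL hi hii.
apply: (op_le_closed uc) => // a a0.
have [d dE] : exists d, d = a / 12 by exists (a / 12).
have d0 : 0 < d by rewrite dE; lra.
have [rho1 rho10 hrho1] := hii d d0.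
have [ru ru0 hru] := uu j zu bzu a a0.
have [C CE] : exists C, C = n.+2%:R * `|P| + `|r + d| + 2 * k + 2 by eexists.
have C1 : 0 <= n.+2%:R * `|P| by rewrite mulr_ge0.
have C2 := normr_ge0 (r + d).
have C0 : 0 < C by rewrite CE; lra.
have [rho rhoE] : exists rho, rho =
  Num.min (Num.min rho0 rho1) (Num.min (Num.min zu.2 ru) (a / (2 * C))) by eexists.
have rho_gt0 : 0 < rho.
  by rewrite rhoE !lt_min rho00 rho10 tzu ru0 divr_gt0// mulr_gt0.
have : rho <= rho by [].
rewrite {2}rhoE !le_min => /andP[/andP[rr0 rr1] /andP[/andP[rt rru] rC]].
clear rhoE.
have Crho : C * rho <= a / 2.
  have := ler_wpM2l (ltW C0) rC.
  by rewrite (_ : C * (a / (2 * C)) = a / 2)//; field; rewrite gt_eqF.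
have k1rho : (2 * k + 2) * rho <= a / 2.
  have kC : 2 * k + 2 <= C by rewrite CE -[leLHS]add0r -!addrA lerD// lerDr.
  by apply: le_trans Crho; apply: ler_wpM2r => //; exact: ltW.
have [h h0 hh] := res_strict uu rho_gt0 hL.
have rd1 : 0 < `|r + d| + 1 by lra.
have [h' h'E] : exists h', h' = Num.min h (h / (`|r + d| + 1)) by eexists.
have h'0 : 0 < h' by rewrite h'E lt_min h0 divr_gt0.
have [y [yh y0 hy]] := hrho1 h' h'0.
have yh1 : - h < y by apply: le_lt_trans yh; rewrite lerN2 h'E ge_min lexx.
have yh2 : `|r + d| * - y <= h.
  have : - y <= h / (`|r + d| + 1) by apply/ltW/(lt_le_trans (_ : _ < h')); [lra|rewrite h'E ge_min lexx orbT].
  rewrite ler_pdivlMr// mulrDr mulr1 mulrC; lra.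
clear h'E.
have [k2 k2E] : exists k2, k2 = 2 * d / - y by exists (2 * d / - y).
have k20 : 0 < k2 by rewrite k2E divr_gt0//; lra_on d0 y0.
(* The slope r + d is beaten by nearby values, so psi has a positive maximum on
   the slab y <= xd. The choice of k2 makes the quadratic term outweigh the gap
   2 * d * (- y) between the slopes on the face xd = y, while it changes the
   slope by at most 4 * d: the maximum is interior, with a slope close to r. *)
pose psi z := res u j zu P k z - ((r + d) * xd z + k2 * xd z ^+ 2).
pose A := [set z | branch z /\ `|z - zu| <= rho] `&` [set z : st | y <= xd z].
have cA : compact A.
  apply: compact_closedI; first exact: compact_branch_ball.
  apply: (@closed_comp _ _ (@xd R n) [set x | y <= x]) => [z _|]; first exact: xd_continuous.
  exact: closed_ge.
have d2 : 0 < d / 2 by lra.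
have h''0 : 0 < Num.min rho (- y / 4) by rewrite lt_min rho_gt0; lra.
have [zs [bzs zsh zsr]] := hi _ _ d2 h''0.
have xneg z : branch z -> xd z <= 0 by case.
have xdu z : `|xd z| <= `|z - zu| by rewrite -[xd z]subr0 -xzu -xdB xd_le.
have zs_rho : `|zs - zu| < rho by apply: lt_le_trans zsh _; rewrite ge_min lexx.
have zs_y : `|xd zs| < - y / 4.
  by apply: le_lt_trans (xdu _) _; apply: lt_le_trans zsh _; rewrite ge_min lexx orbT.
have xzs : xd zs < 0.
  rewrite lt_neqAle xneg// andbT; apply/eqP => E.
  have := hL zs bzs (le_trans (ltW zs_rho) rr0) E.
  by move: zsr; rewrite E mulr0; have := sq_ge0 (zs - zu); lra_goal.
have Azs : A zs.
  split; first by split=> //; exact: ltW.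
  suff : y <= xd zs by [].
  by move: zs_y; rewrite ltr_norml => /andP[? ?]; lra.
have psizs : 0 < psi zs.
  rewrite /psi; suff : k2 * xd zs ^+ 2 <= - (d / 2) * xd zs by lra.
  rewrite expr2 mulrA; apply: (ler_wnM2r (ltW xzs)).
  have : k2 * - xd zs <= k2 * (- y / 4).
    by rewrite ler_wpM2l ?ltW//; move: zs_y; rewrite ltr0_norm.
  have -> : k2 * (- y / 4) = d / 2 by rewrite k2E; field; lra_on y0.
  by rewrite mulrN lerNl.
have upsi : usc_on A psi.
  have -> : psi = fun z => u j z - (u j zu + ip P (z - zu) + k * sq (z - zu) +
      (r + d) * xd z + k2 * xd z ^+ 2) by apply/funext => z; rewrite /psi /res; ring.
  apply: usc_on_sub; last exact: quad_continuous.
  by apply: (@jusc_usc_on R n K T) => // z [[]].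
have [z1 [[bz1 z1rho] yz1] z1max] := usc_on_max cA Azs upsi.
have psi1 : 0 < psi z1 := lt_le_trans psizs (z1max _ Azs).
have x1neg := xneg _ bz1.
have x1lt : xd z1 < 0.
  rewrite lt_neqAle x1neg andbT; apply/eqP => E.
  have := hL z1 bz1 (le_trans z1rho rr0) E.
  by move: psi1; rewrite /psi E !mulr0 expr0n/= mulr0 addr0 subr0; have := sq_ge0 (z1 - zu); lra_goal.
have yx1 : y < xd z1.
  rewrite lt_neqAle yz1 andbT; apply/eqP => E.
  have := hy z1 bz1 (le_trans z1rho rr1) (esym E).
  have : k2 * y ^+ 2 = - (2 * d * y) by rewrite k2E; field; lra_on y0.
  move: psi1; rewrite /psi -E; lra_goal.
have rdx : - ((r + d) * xd z1) <= `|r + d| * - y.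
  apply: le_trans (ler_norm _) _; rewrite normrN normrM ler_wpM2l//.
  by rewrite ltr0_norm//; lra_on yx1.
have z1lt : `|z1 - zu| < rho.
  rewrite lt_neqAle z1rho andbT; apply/eqP => E.
  have := hh z1 bz1; rewrite E lexx => /(_ isT rr0); move=> /(_ (lt_trans yh1 yx1)).
  have : 0 <= k2 * xd z1 ^+ 2 by rewrite mulr_ge0 ?sqr_ge0// ltW.
  move: psi1 rdx yh2; rewrite /psi; lra_goal.
have t1 : 0 < z1.2.
  have := le_lt_trans (time_le (z1 - zu)) z1lt; rewrite /= ltr_norml => /andP[h1 _]; lra_on h1 rt.
exists (P + (2 * k) *: (z1 - zu) + (r + d + 2 * k2 * xd z1) *: ed), (u j z1), z1.
have k2x : - (4 * d) <= 2 * k2 * xd z1.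
  have : 2 * k2 * y <= 2 * k2 * xd z1.
    by rewrite ler_wpM2l ?ltW// mulr_gt0.
  have -> : 2 * k2 * y = - (4 * d) by rewrite k2E; field; lra_on y0.
  by [].
have k2x' : 2 * k2 * xd z1 <= 0 by rewrite mulr_ge0_le0// ltW// mulr_gt0.
split => //.
- rewrite -[P + _ + _]addrA opprD addrACA subrr add0r -addrA -scalerBl.
  apply: le_lt_trans (ler_normD _ _) _; rewrite normrZ (normrZ _ ed) norm_ed mulr1.
  have e1 : `|2 * k| * `|z1 - zu| <= (2 * k + 2) * rho.
    by rewrite ger0_norm ?mulr_ge0//; apply: ler_pM => //; rewrite ?mulr_ge0 ?lerDl.
  have e2 : `|r + d + 2 * k2 * xd z1 - r| <= 3 * d.
    by rewrite ler_norml; apply/andP; split; lra_on k2x k2x' dE d0.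
  lra_on e1 e2 dE a0 k1rho.
- have lo : - a < u j z1 - u j zu.
    have e1 := ip_le P (z1 - zu); have e2 : 0 <= k * sq (z1 - zu) by rewrite mulr_ge0// sq_ge0.
    have e3 : n.+2%:R * (`|P| * `|z1 - zu|) <= n.+2%:R * `|P| * rho.
      by rewrite mulrA ler_wpM2l.
    have e4 : `|(r + d) * xd z1| <= `|r + d| * rho.
      by rewrite normrM ler_wpM2l//; apply: le_trans (xdu _) _.
    have e5 : n.+2%:R * `|P| * rho + `|r + d| * rho <= C * rho.
        by rewrite -mulrDl; apply: ler_wpM2r; [exact: ltW|rewrite CE; lra_on k0].
    have e6 : 0 <= k2 * xd z1 ^+ 2 by rewrite mulr_ge0 ?sqr_ge0// ltW.
    move: e1 e4; rewrite !ler_norml => /andP[e1 e1'] /andP[e4 e4'].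
    by move: psi1; rewrite /psi /res; clear - e1 e1' e2 e3 e4 e4' e5 e6 Crho a0; lra.
  have hi1 := hru j z1 (or_introl erefl) bz1 (lt_le_trans z1lt rru).
  by rewrite ltr_norml; apply/andP; split; lra_on lo hi1.
- apply: lt_le_trans z1lt _.
  have : 2 * rho <= (2 * k + 2) * rho by apply: (ler_wpM2r (ltW rho_gt0)); lra_on k0.
  move: k1rho a0; lra_goal.
have := su (k + k2) (P + (2 * k) *: (z1 - zu)) (fun _ => r + d + 2 * k2 * xd z1) j z1.
rewrite mul0r; case => //; first by rewrite addr_ge0// ltW.
- exists (Num.min (rho - `|z1 - zu|) (xd z1 - y)); first by rewrite lt_min; apply/andP; split; lra_on z1lt yx1.
  move=> i z [->|E]; last by move: x1lt; rewrite E ltxx.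
  move=> bz; rewrite lt_min => /andP[zz1 zz1'].
  have Az : A z.
    split.
      by split => //; have := ler_normD (z - z1) (z1 - zu); rewrite subrKA; move: zz1; lra_goal.
    have := le_lt_trans (xd_le _) zz1'; rewrite xdB ltr_norml /= => /andP[h1 _]; lra_on h1.
  have := z1max z Az; have := res_sub u j zu P k z z1.
  have := xd_sq (z - z1); rewrite xdB => e1.
  have e2 : k2 * (xd z - xd z1) ^+ 2 <= k2 * sq (z - z1) by apply: ler_wpM2l => //; exact: ltW.
  have -> : (k + k2) * sq (z - z1) = k * sq (z - z1) + k2 * sq (z - z1) by ring.
  have e3 : k2 * xd z ^+ 2 = k2 * xd z1 ^+ 2 + 2 * k2 * xd z1 * (xd z - xd z1) +
    k2 * (xd z - xd z1) ^+ 2 by ring.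
  rewrite /psi e3; move: e2; lra_goal.
- by case=> E; move: x1lt; rewrite E ltxx.
- by case=> i [->|E] //; move: x1lt; rewrite E ltxx.
Qed.

End junction_slopes.

(** * The set of upper slopes *)

Section slope_selection.
Context {R : realType} {n K : nat} (T : R).
Notation st := (spacetime R n).
Notation branch := (cylinder T (@halfspace R n)).
Implicit Types (z w P : st) (u v : 'I_K -> st -> R).
Implicit Types H : 'I_K -> 'rV[R]_n.+1 -> R -> 'rV[R]_n.+1 -> R -> R.

(** As xd is nonpositive, a larger slope is a stronger bound. *)
Definition upper_slope u j zu P (k r : R) := exists2 h : R, 0 < h &
  forall z, branch z -> `|z - zu| < h -> res u j zu P k z <= r * xd z.

Lemma upper_slope_le u j zu P k r r' : r' <= r ->
  upper_slope u j zu P k r -> upper_slope u j zu P k r'.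
Proof.
move=> rr [h h0 hh]; exists h => // z bz zh; apply: le_trans (hh z bz zh) _.
by apply: ler_wnM2r => //; case: bz.
Qed.

Lemma not_upper_slope u j zu P k (r h : R) : ~ upper_slope u j zu P k r -> 0 < h ->
  exists z, [/\ branch z, `|z - zu| < h & r * xd z < res u j zu P k z].
Proof.
move=> nr h0; apply: contrapT => no; apply: nr; exists h => // z bz zh.
by rewrite leNgt; apply/negP => lt; apply: no; exists z.
Qed.

Lemma continuous_op_slope H j P s z : (forall i, unif_cont_bounded T H i) ->
  branch z -> continuous (fun r : R => op H j (P + r *: ed) s z).
Proof.
move=> uc bz; apply/(continuous_distP (X := R)) => r e e0.
have [a a0 ha] := op_cont uc (P + r *: ed) s bz e0.
exists a => // r' rr'; apply: ha; rewrite ?subrr ?normr0//.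
by rewrite opprD addrACA subrr add0r -scalerBl normrZ norm_ed mulr1.
Qed.

Lemma exists_sup (A : R -> Prop) (a0 M : R) : A a0 -> (forall r, A r -> r <= M) ->
  exists2 a : R, (forall r, A r -> r <= a) &
    forall d, 0 < d -> exists2 r : R, A r & a - d < r.
Proof.
move=> Aa0 AM; have hS : has_sup [set r | A r].
  by split; [exists a0|exists M => r; exact: AM].
exists (sup [set r | A r]) => [r Ar|d d0]; first exact: sup_upper_bound.
by have [r Ar hr] := sup_adherent d0 hS; exists r.
Qed.

(** Coercivity rules out values that drop faster than every slope. *)
Lemma upper_slope_exists H B u j zu P k (rho0 M : R) :
  (forall i, coercive T H i) -> jusc T u -> psub T H B 0 u ->
  (forall i z, branch z -> `|u i z| <= M) ->
  branch zu -> xd zu = 0 -> 0 < zu.2 -> 0 < rho0 -> 0 <= k ->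
  (forall z, branch z -> `|z - zu| <= rho0 -> xd z = 0 ->
     res u j zu P k z <= - sq (z - zu)) ->
  exists r0, forall r, r <= r0 -> upper_slope u j zu P k r.
Proof.
move=> co uu su uM bzu xzu tzu rho00 k0 hL.
have [rho rhoE] : exists rho, rho = Num.min rho0 zu.2 by eexists.
have rho_gt0 : 0 < rho by rewrite rhoE lt_min rho00.
have rr0 : rho <= rho0 by rewrite rhoE ge_min lexx.
have rt : rho <= zu.2 by rewrite rhoE ge_min lexx orbT.
have [h h0 hh] := res_strict uu rho_gt0 hL.
have M0 : 0 <= M := le_trans (normr_ge0 _) (uM j zu bzu).
have [c cE] : exists c, c = M + `|P| + 2 * k * rho by eexists.
have P0 := normr_ge0 P.
have krho : 0 <= 2 * k * rho by rewrite !mulr_ge0// ltW.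
have c0 : 0 <= c by rewrite cE !addr_ge0.
have [b b0 hb] := op_coercive co c 1.
have [m mE] : exists m, m = 2 * M + n.+2%:R * (`|P| * rho) by eexists.
have m0 : 0 <= m by rewrite mE addr_ge0// mulr_ge0// mulr_ge0// ltW.
(* The term 2 * m / h lifts r * xd above the residue on the face xd = - (h / 2);
   b makes the gradient too large for the equation at an interior maximum. *)
exists (- (b + c + 2 * m / h + 1)) => r hr.
have mh0 : 0 <= 2 * m / h by rewrite divr_ge0 ?mulr_ge0// ltW.
have rneg : r < 0 by move: hr mh0 b0 c0; lra_goal.
exists (Num.min rho (h / 2)) => [|z bz]; first by rewrite lt_min rho_gt0; lra_on h0.
rewrite lt_min => /andP[zrho zh]; rewrite leNgt; apply/negP => zbad.
pose A := [set z | branch z /\ `|z - zu| <= rho] `&` [set z : st | - (h / 2) <= xd z].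
have cA : compact A.
  apply: compact_closedI; first exact: compact_branch_ball.
  apply: (@closed_comp _ _ (@xd R n) [set x | - (h / 2) <= x]) => [w _|]; first exact: xd_continuous.
  exact: closed_ge.
have xdu w : `|xd w| <= `|w - zu| by rewrite -[xd w]subr0 -xzu -xdB xd_le.
have Az : A z.
  split; first by split=> //; exact: ltW.
  suff : - (h / 2) <= xd z by [].
  have := le_lt_trans (xdu z) zh; rewrite ltr_norml => /andP[h1 _]; lra_on h1.
have upsi : usc_on A (fun w => u j w - (u j zu + ip P (w - zu) + k * sq (w - zu) + r * xd w + 0 * xd w ^+ 2)).
  apply: usc_on_sub; last exact: quad_continuous.
  by apply: (@jusc_usc_on R n K T) => // w [[]].
have [z1 [[bz1 z1rho] yz1] z1max] := usc_on_max cA Az upsi.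
have E w : u j w - (u j zu + ip P (w - zu) + k * sq (w - zu) + r * xd w + 0 * xd w ^+ 2)
  = res u j zu P k w - r * xd w by rewrite /res; ring.
have psi1 : 0 < res u j zu P k z1 - r * xd z1.
  by rewrite -E; apply: lt_le_trans (z1max _ Az); rewrite E subr_gt0.
have x1neg : xd z1 <= 0 by case: bz1.
have rx0 : 0 <= r * xd z1 by rewrite mulr_le0// ltW.
have x1lt : xd z1 < 0.
  rewrite lt_neqAle x1neg andbT; apply/eqP => E1.
  have := hL z1 bz1 (le_trans z1rho rr0) E1.
  by move: psi1; rewrite E1 !mulr0 subr0; have := sq_ge0 (z1 - zu); lra_goal.
have yx1 : - (h / 2) < xd z1.
  rewrite lt_neqAle yz1 andbT; apply/eqP => E1.
  have : res u j zu P k z1 <= m.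
    have := uM j z1 bz1; have := uM j zu bzu; rewrite !ler_norml => /andP[a1 _] /andP[_ a2].
    have := ip_le P (z1 - zu); rewrite ler_norml => /andP[a3 _].
    have a4 : n.+2%:R * (`|P| * `|z1 - zu|) <= n.+2%:R * (`|P| * rho).
      by rewrite ler_wpM2l// ler_wpM2l.
    have a5 : 0 <= k * sq (z1 - zu) by rewrite mulr_ge0// sq_ge0.
    rewrite /res mE; lra_on a1 a2 a3 a4 a5.
  have : m <= r * xd z1.
    rewrite -E1 mulrN -mulNr.
    have : (2 * m / h) * (h / 2) <= - r * (h / 2).
      by apply: ler_wpM2r; [lra_on h0|move: hr b0 c0; lra_goal].
    suff -> : (2 * m / h) * (h / 2) = m by [].
    by field; rewrite gt_eqF.
  by move: psi1; lra_goal.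
have z1lt : `|z1 - zu| < rho.
  rewrite lt_neqAle z1rho andbT; apply/eqP => E1.
  have h1 : - h < xd z1 by lra_on yx1 h0.
  have := hh z1 bz1; rewrite E1 lexx => /(_ isT rr0 h1).
  by move: psi1 rx0 h0; lra_goal.
have t1 : 0 < z1.2.
  have := le_lt_trans (time_le (z1 - zu)) z1lt; rewrite /= ltr_norml => /andP[h1 _]; lra_on h1 rt.
have hP : `|P + (2 * k) *: (z1 - zu)| <= `|P| + 2 * k * rho.
  apply: le_trans (ler_normD _ _) _; rewrite lerD2l normrZ ger0_norm ?mulr_ge0//.
  by rewrite ler_wpM2l ?mulr_ge0.
have := @psub_at R n K T H B 0 u k P (fun _ => r) j zu z1 su k0 bz1 t1.
case.
- exists (Num.min (rho - `|z1 - zu|) (xd z1 + h / 2)); first by rewrite lt_min; apply/andP; split; lra_on z1lt yx1.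
  move=> i w [->|E1]; last by move: x1lt; rewrite E1 ltxx.
  move=> bw; rewrite lt_min => /andP[wz1 wz1'].
  have Aw : A w.
    split.
      by split => //; have := ler_normD (w - z1) (z1 - zu); rewrite subrKA; move: wz1; lra_goal.
    have := le_lt_trans (xd_le _) wz1'; rewrite xdB ltr_norml /= => /andP[h1 _]; lra_on h1.
  have := z1max w Aw; lra_goal.
- by case=> E1; move: x1lt; rewrite E1 ltxx.
- case=> i [->|E1]; last by move: x1lt; rewrite E1 ltxx.
  rewrite mul0r; apply/negP; rewrite -ltNge; apply: lt_le_trans ltr01 _; apply: hb => //.
  + by apply: le_trans (uM _ _ bz1) _; rewrite cE; lra_on P0 krho.
  + by rewrite time_shift_ed; apply: le_trans (time_le _) _; apply: le_trans hP _; rewrite cE; lra_on M0.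
  + apply: le_trans (entry_le _ ord_max); rewrite -/(xd _) xd_shift_ed.
    rewrite -normrN; apply: le_trans (ler_norm _).
    have := le_trans (xd_le _) hP; rewrite ler_norml => /andP[_ h1].
    by move: h1 hr mh0 M0; rewrite cE; lra_goal.
Qed.
End slope_selection.

(** * Comparison on the junction *)

Section junction_test.
Context {R : realType} {n K : nat} (T : R).
Notation st := (spacetime R n).
Notation branch := (cylinder T (@halfspace R n)).
Implicit Types (z w P : st) (u v : 'I_K -> st -> R).
Implicit Types H : 'I_K -> 'rV[R]_n.+1 -> R -> 'rV[R]_n.+1 -> R -> R.

Lemma junction_test H B u zu P k (r : 'I_K -> R) (i0 : 'I_K) :
  jusc T u -> psub T H B 0 u -> branch zu -> xd zu = 0 -> 0 < zu.2 -> 0 <= k ->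
  (forall j, upper_slope T u j zu P k (r j)) ->
  \sum_j (xd P + r j) <= B \/
  exists j, op H j (P + r j *: ed) (u j zu) zu <= 0.
Proof.
move=> uu su bzu xzu tzu k0 hr.
have [a a0 ha] : exists2 a : R, 0 < a & forall j z, branch z -> `|z - zu| < a ->
    res u j zu P k z <= r j * xd z.
  apply: fin_common_small => [j|j a b b0 ba h z bz zb]; first exact: hr.
  by apply: h => //; exact: lt_le_trans ba.
case: (su k P r i0 zu k0 bzu tzu) => [|[]|[j _]]; [|by left|by rewrite mul0r; right; exists j].
exists a => // j z _ bz za; have := ha j z bz za.
rewrite /res xdB xzu subr0 (jusc_agree i0 j uu bzu xzu); lra_goal.
Qed.

Lemma sum_one_slope (a q r : R) (i : 'I_K) :
  \sum_j (a + (q + if j == i then r - q else 0)) = K%:R * (a + q) + (r - q).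
Proof.
under eq_bigr do rewrite addrA.
rewrite big_split /= sumr_const card_ord mulr_natl; congr (_ + _).
by rewrite -big_mkcond big_pred1_eq.
Qed.

(** Coercivity and the Kirchhoff condition rule out a branch along which the
    sub-solution jumps down at the junction: a steep test function on that
    branch would violate every alternative of the junction condition. *)
Lemma upper_slope_bounded H B u i zu P k (rho0 M : R) :
  (forall i, coercive T H i) -> jusc T u -> psub T H B 0 u ->
  (forall i z, branch z -> `|u i z| <= M) ->
  branch zu -> xd zu = 0 -> 0 < zu.2 -> 0 < rho0 -> 0 <= k ->
  (forall j z, branch z -> `|z - zu| <= rho0 -> xd z = 0 ->
     res u j zu P k z <= - sq (z - zu)) ->
  exists m, forall r, upper_slope T u i zu P k r -> r <= m.
Proof.
move=> co uu su uM bzu xzu tzu rho00 k0 hL.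
have [q q0 hq] : exists2 q : R, 0 <= q & forall j r, r <= - q -> upper_slope T u j zu P k r.
  apply: fin_common_large => [j|j a b ab h r hr].
    have [r0 h0] := upper_slope_exists co uu su uM bzu xzu tzu rho00 k0 (hL j).
    by exists (- r0) => r hr; apply: h0; rewrite opprK in hr.
  by apply: h; apply: le_trans hr _; rewrite lerN2.
have M0 : 0 <= M := le_trans (normr_ge0 _) (uM i zu bzu).
have [b b0 hb] := op_coercive co (M + `|P|) 1.
have P0 := normr_ge0 P.
have xP : `|xd P| <= `|P| := xd_le P.
have [s sE] : exists s, s = - (q + b + `|P|) by eexists.
have K0 : 0 <= K%:R * (- (`|P|) + s) + (- s - K%:R * (- (`|P|) + s)) + q + b.
  by rewrite sE; lra_on q0 b0 P0.
exists (b + `|P| + `|B| + - (K%:R * (- (`|P|) + s))) => r hr; rewrite leNgt; apply/negP => lt.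
have K1 : K%:R * (- (`|P|) + s) <= 0.
  by rewrite mulr_ge0_le0// sE; lra_on q0 b0 P0.
have B0 := normr_ge0 B; have BB := ler_norm B.
have rs : forall j, upper_slope T u j zu P k (s + if j == i then r - s else 0).
  move=> j; case: eqP => [->|_]; first by rewrite (_ : s + (r - s) = r) //; ring.
  by rewrite addr0; apply: hq; rewrite sE; lra_on b0 P0.
case: (junction_test i uu su bzu xzu tzu k0 rs) => [|[j]].
- rewrite sum_one_slope leNgt => /negP; apply.
  have : K%:R * (- `|P| + s) <= K%:R * (xd P + s).
    by rewrite ler_wpM2l// lerD2r lerNl; apply: le_trans (ler_norm _) _; rewrite normrN.
  by move: lt BB b0 P0 q0; rewrite sE; lra_goal.
- apply/negP; rewrite -ltNge; apply: lt_le_trans ltr01 _; apply: hb => //.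
  + by apply: le_trans (uM _ _ bzu) _; rewrite lerDl.
  + by rewrite time_shift_ed; apply: le_trans (time_le _) _; rewrite lerDr.
  apply: le_trans (entry_le _ ord_max); rewrite -/(xd _) xd_shift_ed.
  move: xP; rewrite ler_norml => /andP[xP1 xP2].
  case: eqP => _.
    apply: le_trans (ler_norm _).
    by move: lt K1 B0 xP1; lra_goal.
  rewrite -normrN; apply: le_trans (ler_norm _).
  by rewrite sE; lra_on xP2 q0.
Qed.

(** The supremum of the upper slopes is critical: slopes above it are exceeded by
    nearby values, and those below it bound them. *)
Lemma maximal_slope H B u j zu P (k rho0 a0 m : R) :
  (forall i, unif_cont_bounded T H i) -> jusc T u -> psub T H B 0 u ->
  branch zu -> xd zu = 0 -> 0 < zu.2 -> 0 < rho0 -> 0 <= k ->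
  (forall z, branch z -> `|z - zu| <= rho0 -> xd z = 0 ->
     res u j zu P k z <= - sq (z - zu)) ->
  upper_slope T u j zu P k a0 -> (forall r, upper_slope T u j zu P k r -> r <= m) ->
  exists a, [/\ a0 <= a, forall r, r < a -> upper_slope T u j zu P k r,
    forall d, 0 < d -> ~ upper_slope T u j zu P k (a + d) &
    op H j (P + a *: ed) (u j zu) zu <= 0].
Proof.
move=> uc uu su bzu xzu tzu rho00 k0 hL up0 upm.
have [a a1 a2] := exists_sup up0 upm.
have below r : r < a -> upper_slope T u j zu P k r.
  rewrite -subr_gt0 => /a2[r' ur' rr']; apply: upper_slope_le ur'.
  by move: rr'; lra_goal.
have above d : 0 < d -> ~ upper_slope T u j zu P k (a + d).
  by move=> d0 /a1; move: d0; lra_goal.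
exists a; split => //; first exact: a1.
apply: (critical_slope (rho0 := rho0) uc uu su bzu xzu tzu rho00 k0 hL).
  by move=> d h d0 h0; exact: (not_upper_slope (above d d0) h0).
move=> d d0; have [|h1 h10 hh1] := below (a - d); first by move: d0; lra_goal.
exists (h1 / 2) => [|h h0]; first by rewrite divr_gt0.
exists (- (h / 2)); split; [lra|lra|].
by move=> z bz zh <-; apply: hh1 => //; move: zh h10; lra_goal.
Qed.

(** A slope that separates neither u nor v from above is critical for u: the
    values of v that exceed it bound those of u at the same last coordinate. *)
Lemma unseparated_slope H B u v j zu zv P Q (k rho0 r : R) :
  (forall i, unif_cont_bounded T H i) -> jusc T u -> psub T H B 0 u ->
  branch zu -> xd zu = 0 -> 0 < zu.2 -> xd zv = 0 -> 0 < rho0 -> 0 <= k ->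
  (forall z w, branch z -> branch w -> `|z - zu| <= rho0 -> `|w - zv| <= rho0 ->
     xd z = xd w ->
     res u j zu P k z + res v j zv Q k w <= - sq (z - zu) - sq (w - zv)) ->
  (forall z, branch z -> `|z - zu| <= rho0 -> xd z = 0 ->
     res u j zu P k z <= - sq (z - zu)) ->
  (forall w, branch w -> `|w - zv| <= rho0 -> xd w = 0 ->
     res v j zv Q k w <= - sq (w - zv)) ->
  (forall d, 0 < d -> ~ upper_slope T u j zu P k (r + d)) ->
  (forall d, 0 < d -> ~ upper_slope T v j zv Q k (- r + d)) ->
  op H j (P + r *: ed) (u j zu) zu <= 0.
Proof.
move=> uc uu su bzu xzu tzu xzv rho00 k0 joint hu hv nu nv.
apply: (critical_slope (rho0 := rho0) uc uu su bzu xzu tzu rho00 k0 hu).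
  by move=> d h d0 h0; exact: (not_upper_slope (nu d d0) h0).
move=> d d0; exists rho0 => // h h0.
have hr0 : 0 < Num.min h rho0 by rewrite lt_min h0.
have [w [bw]] := not_upper_slope (nv d d0) hr0.
rewrite lt_min => /andP[wh wr] wlt; exists (xd w).
have xw : `|xd w| < h by apply: le_lt_trans wh; rewrite -[xd w]subr0 -xzv -xdB xd_le.
split.
- by move: xw; rewrite ltr_norml => /andP[].
- have : xd w <= 0 by case: bw.
  rewrite le_eqVlt => /orP[/eqP xw0|//].
  have := hv w bw (ltW wr) xw0; move: wlt; rewrite xw0 mulr0.
  by have := sq_ge0 (w - zv); lra_goal.
- move=> z bz zr xzw; have := joint z w bz bw zr (ltW wr) xzw.
  by have := sq_ge0 (w - zv); have := sq_ge0 (z - zu); move: wlt; lra_goal.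
Qed.

End junction_test.

Section slope_selection.
Context {R : realType} {n K : nat} (T : R).
Notation st := (spacetime R n).
Notation branch := (cylinder T (@halfspace R n)).
Context (H : 'I_K -> 'rV[R]_n.+1 -> R -> 'rV[R]_n.+1 -> R -> R).
Context (B M k rho0 : R) (u v : 'I_K -> st -> R) (zu zv P Q : st).
Implicit Types (z w : st).
Context (uc : forall i, unif_cont_bounded T H i) (co : forall i, coercive T H i).
Context (uu : jusc T u) (vv : jusc T v).
Context (su : psub T H B 0 u) (sv : psub T (reflect_H H) (- B) 0 v).
Context (uM : forall i z, branch z -> `|u i z| <= M).
Context (bzu : branch zu) (bzv : branch zv) (xzu : xd zu = 0) (xzv : xd zv = 0).
Context (tzu : 0 < zu.2) (tzv : 0 < zv.2) (rho00 : 0 < rho0) (k0 : 0 <= k).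
(* The situation at a maximum point on the junction of the doubled function:
   joint compares u and v where the last coordinates agree, and gap says that
   the two equations exclude each other at every slope. *)
Context (joint : forall j z w, branch z -> branch w -> `|z - zu| <= rho0 ->
  `|w - zv| <= rho0 -> xd z = xd w ->
  res u j zu P k z + res v j zv Q k w <= - sq (z - zu) - sq (w - zv)).

Let Fu j r := op H j (P + r *: ed) (u j zu) zu.
Let Gv j r := op H j (- Q + r *: ed) (- v j zv) zv.
Context (gap : forall j r, Fu j r <= 0 \/ Gv j r <= 0 -> Gv j r < Fu j r).

Lemma Gv_reflect j r : op (reflect_H H) j (Q + (- r) *: ed) (v j zv) zv = - Gv j r.
Proof. by rewrite op_reflect /Gv scaleNr opprB addrC. Qed.

Lemma joint_u j z : branch z -> `|z - zu| <= rho0 -> xd z = 0 ->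
  res u j zu P k z <= - sq (z - zu).
Proof.
move=> bz zr xz; have := @joint j z zv bz bzv zr.
by rewrite res0 subrr normr0 sq0 xz xzv addr0 subr0; apply=> //; exact: ltW.
Qed.

Lemma joint_v j w : branch w -> `|w - zv| <= rho0 -> xd w = 0 ->
  res v j zv Q k w <= - sq (w - zv).
Proof.
move=> bw wr xw; have := @joint j zu w bzu bw.
rewrite res0 subrr normr0 sq0 xw xzu add0r oppr0 sub0r; apply=> //; exact: ltW.
Qed.

(** Otherwise r would be critical for u and for v at once, and the gap between
    the two equations forbids that. *)
Lemma slope_dichotomy j r :
  (exists2 d : R, 0 < d & upper_slope T u j zu P k (r + d)) \/
  (exists2 d : R, 0 < d & upper_slope T v j zv Q k (- r + d)).
Proof.
apply: contrapT => /not_orP[nu nv].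
have nu' d : 0 < d -> ~ upper_slope T u j zu P k (r + d) by move=> d0 h; apply: nu; exists d.
have nv' d : 0 < d -> ~ upper_slope T v j zv Q k (- r + d) by move=> d0 h; apply: nv; exists d.
have ucr i : unif_cont_bounded T (reflect_H H) i by exact: reflect_unif_cont.
have F0 : Fu j r <= 0 :=
  unseparated_slope uc uu su bzu xzu tzu xzv rho00 k0 (@joint j) (@joint_u j) (@joint_v j) nu' nv'.
have G0 : 0 <= Gv j r.
  rewrite -oppr_le0 -Gv_reflect.
  apply: (unseparated_slope ucr vv sv bzv xzv tzv xzu rho00 k0 _ (@joint_v j) (@joint_u j) nv').
    move=> z w bz bw zr wr xzw; have := joint j bw bz wr zr (esym xzw); lra.
  by move=> d d0; rewrite opprK; exact: nu'.
by have := gap (or_introl F0); move: F0 G0; lra.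
Qed.

(** By the gap, Fu + Gv is nonpositive at the critical slope of u and
    nonnegative at that of v. It vanishes in between, and there the gap forces
    Gv < 0 < Fu: neither equation holds, while the slope is admissible for both
    functions. *)
Lemma slope_between j : exists s d, [/\ 0 < d, upper_slope T u j zu P k (s + d),
  upper_slope T v j zv Q k (- s), 0 < Fu j (s + d) & Gv j s < 0].
Proof.
have ucr i : unif_cont_bounded T (reflect_H H) i by exact: reflect_unif_cont.
have [r0 hr0] := upper_slope_exists co uu su uM bzu xzu tzu rho00 k0 (@joint_u j).
have [m hm] := upper_slope_bounded j co uu su uM bzu xzu tzu rho00 k0 joint_u.
have [al [_ al3 al4 Fal]] := maximal_slope uc uu su bzu xzu tzu rho00 k0 (@joint_u j) (hr0 _ (lexx r0)) hm.
have {}Fal : Fu j al <= 0 := Fal.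
have [d0 d00 vd0] : exists2 d : R, 0 < d & upper_slope T v j zv Q k (- al + d).
  by case: (slope_dichotomy j al) => // -[d dd /(al4 _ dd)].
have [ga [ga1 ga2 ga3]] : exists ga, [/\ ga < al, 0 <= Gv j ga &
    forall s, ga < s -> upper_slope T v j zv Q k (- s)].
  have [all|/existsNP[q nq]] := pselect (forall q, upper_slope T v j zv Q k q).
    have [b b0 hb] := op_coercive co (`|v j zv| + `|Q|) 0.
    (* If v has no critical slope, coercivity still gives Gv >= 0 far out. *)
    exists (- (`|al| + 1 + b + `|Q|)); split => //.
      by have := ler_norm (- al); rewrite normrN; have := normr_ge0 Q; lra.
    apply: hb => //; first by rewrite normrN lerDl.
      by rewrite time_shift_ed /= normrN; apply: le_trans (time_le _) _; rewrite lerDr.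
    apply: le_trans (entry_le _ ord_max); rewrite -/(xd _) xd_shift_ed xdN -[leRHS]normrN.
    apply: le_trans (ler_norm _).
    have hQ : - xd Q <= `|Q| by apply: le_trans (xd_le Q); rewrite -normrN ler_norm.
    by have := normr_ge0 al; lra.
  have hq r : upper_slope T v j zv Q k r -> r <= q.
    by move=> hr; rewrite leNgt; apply/negP => qr; apply: nq; apply: upper_slope_le hr; exact: ltW.
  have [be [be1 be3 _ Gbe]] := maximal_slope ucr vv sv bzv xzv tzv rho00 k0 (@joint_v j) vd0 hq.
  exists (- be); split; first by rewrite ltrNl (lt_le_trans _ be1)// ltrDl.
  - by rewrite -oppr_le0 -Gv_reflect opprK.
  - by move=> s hs; apply: be3; rewrite ltrNl.
have cF : continuous (Fu j) by exact: continuous_op_slope.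
have cG : continuous (Gv j) by exact: continuous_op_slope.
have hal : Fu j al + Gv j al <= 0.
  by have := gap (or_introl Fal); lra.
have hga : 0 <= Fu j ga + Gv j ga.
  have [h|h] := leP 0 (Fu j ga); first exact: addr_ge0.
  by have := gap (or_introl (ltW h)); lra.
have [s s_in hs] : exists2 s, s \in `[ga, al] & Fu j s + Gv j s = 0.
  apply: (@IVT _ (fun s => Fu j s + Gv j s) _ _ 0 (ltW ga1)).
    by apply: continuous_subspaceT => x; apply: cvgD; [exact: cF|exact: cG].
  by rewrite ge_min le_max hal hga orbT.
have [Fs Gs] : 0 < Fu j s /\ Gv j s < 0.
  have [h|h] := leP (Fu j s) 0.
    by have := gap (or_introl h); move: hs h; lra.
  by split => //; lra.
move: s_in; rewrite in_itv /= => /andP[gas sal].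
have gas' : ga < s.
  by rewrite lt_neqAle gas andbT; apply/eqP => E; move: ga2 Gs; rewrite E; lra.
have sal' : s < al.
  by rewrite lt_neqAle sal andbT; apply/eqP => E; move: Fal Fs; rewrite E; lra.
have [d1 d10 hd1] := (continuous_distP (X := R) (Fu j)).1 cF s _ Fs.
have [d dE] : exists d, d = Num.min (d1 / 2) ((al - s) / 2) by eexists.
have dp : 0 < d by rewrite dE lt_min; apply/andP; split; [lra|lra].
have dd1 : d <= d1 / 2 by rewrite dE ge_min lexx.
have dd2 : d <= (al - s) / 2 by rewrite dE ge_min lexx orbT.
exists s, d; split => //.
- by apply: al3; lra.
- exact: ga3.
- have := hd1 (s + d); rewrite addrC addKr gtr0_norm// => /(_ ltac:(lra)).
  by rewrite ltr_norml addrC => /andP[h _]; move: h; rewrite addrC; lra.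
Qed.

(** The junction case of the comparison: the slopes chosen on the branches
    violate either the condition of the sub-solution or that of the
    super-solution, according to the sign of the Kirchhoff sum. *)
Lemma junction_contradiction (i0 : 'I_K) : xd Q = - xd P -> False.
Proof.
move=> xPQ.
have /(_ _)/cid s1 j := slope_between j.
pose s j := projT1 (s1 j).
have /(_ _)/cid d1 j := projT2 (s1 j).
pose d j := projT1 (d1 j).
have hs j : [/\ 0 < d j, upper_slope T u j zu P k (s j + d j),
  upper_slope T v j zv Q k (- s j), 0 < Fu j (s j + d j) & Gv j (s j) < 0].
  exact: projT2 (d1 j).
have [le|lt] := leP B (\sum_j (xd P + s j)).
- case: (@junction_test R n K T H B u zu P k (fun j => s j + d j) i0) => //.
  + by move=> j; case: (hs j).
  + under eq_bigr do rewrite addrA.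
    rewrite big_split /= => h.
    have : 0 < \sum_j d j.
      rewrite (bigD1 i0)//=; apply: ltr_pwDl; first by case: (hs i0).
      by apply: sumr_ge0 => j _; apply: ltW; case: (hs j).
    by move: h le; lra.
  + by case=> j; case: (hs j) => _ _ _ h _; move: h; rewrite /Fu; lra.
- case: (@junction_test R n K T (reflect_H H) (- B) v zv Q k (fun j => - s j) i0) => //.
  + by move=> j; case: (hs j).
  + under eq_bigr do rewrite xPQ -opprD.
    by rewrite sumrN => h; move: h lt; lra.
  + by case=> j; rewrite Gv_reflect; case: (hs j) => _ _ _ _ h; move: h; lra.
Qed.

End slope_selection.

(** * Comparison off the junction *)

Section interior_contradiction.
Context {R : realType} {n K : nat} (T : R).
Notation st := (spacetime R n).
Notation branch := (cylinder T (@halfspace R n)).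
Implicit Types (z w P Q : st) (u v : 'I_K -> st -> R).
Implicit Types H : 'I_K -> 'rV[R]_n.+1 -> R -> 'rV[R]_n.+1 -> R -> R.

Lemma interior_test H B u i z1 P (k N y : R) :
  psub T H B 0 u -> branch z1 -> xd z1 < 0 -> 0 < z1.2 -> 0 <= k -> 0 <= N ->
  (exists2 h : R, 0 < h & forall z, branch z -> `|z - z1| < h ->
    u i z - u i z1 <= ip P (z - z1) + k * sq (z - z1) +
      N * ((xd z - y) ^+ 2 - (xd z1 - y) ^+ 2)) ->
  op H i (P + (2 * N * (xd z1 - y)) *: ed) (u i z1) z1 <= 0.
Proof.
move=> su bz1 x1 t1 k0 N0 [h h0 hh].
case: (su (k + N) P (fun _ => 2 * N * (xd z1 - y)) i z1 (addr_ge0 k0 N0) bz1 t1) => [|[E _]|[j [->|E]]].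
- exists h => // j z [->|E]; last by move: x1; rewrite E ltxx.
  move=> bz zh; have := hh z bz zh.
  have e1 : N * xd (z - z1) ^+ 2 <= N * sq (z - z1) by rewrite ler_wpM2l// xd_sq.
  have e2 : N * ((xd z - y) ^+ 2 - (xd z1 - y) ^+ 2) =
    2 * N * (xd z1 - y) * xd (z - z1) + N * xd (z - z1) ^+ 2 by rewrite xdB; ring.
  have -> : (k + N) * sq (z - z1) = k * sq (z - z1) + N * sq (z - z1) by ring.
  by rewrite e2; move: e1; lra_goal.
- by move: x1; rewrite E ltxx.
- by rewrite mul0r.
- by move: x1; rewrite E ltxx.
Qed.

Lemma res_le_bound u j zu P (k M rho : R) z : 0 <= k ->
  (forall i z, branch z -> `|u i z| <= M) -> branch zu -> branch z -> `|z - zu| <= rho ->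
  res u j zu P k z <= 2 * M + n.+2%:R * (`|P| * rho).
Proof.
move=> k0 uM bzu bz zr.
have := uM j z bz; have := uM j zu bzu; rewrite !ler_norml => /andP[a1 _] /andP[_ a2].
have := ip_le P (z - zu); rewrite ler_norml => /andP[a3 _].
have a4 : n.+2%:R * (`|P| * `|z - zu|) <= n.+2%:R * (`|P| * rho).
  by rewrite ler_wpM2l// ler_wpM2l.
have a5 : 0 <= k * sq (z - zu) by rewrite mulr_ge0// sq_ge0.
rewrite /res; lra_on a1 a2 a3 a4 a5.
Qed.

(** Since the joint bound is strict off the contact points, a large enough
    penalty on xd z - xd w excludes a fixed surrounding of them. *)
Lemma penalty_exists u v i zu zv P Q (k rho0 rho M : R) :
  jusc T u -> jusc T v ->
  (forall i z, branch z -> `|u i z| <= M) -> (forall i z, branch z -> `|v i z| <= M) ->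
  branch zu -> branch zv -> 0 < rho0 -> 0 < rho -> 0 <= k ->
  (forall z w, branch z -> branch w -> `|z - zu| <= rho0 -> `|w - zv| <= rho0 ->
     xd z = xd w ->
     res u i zu P k z + res v i zv Q k w <= - sq (z - zu) - sq (w - zv)) ->
  exists N : R, 0 <= N /\ forall z w, branch z -> branch w ->
    `|z - zu| <= rho0 -> `|w - zv| <= rho0 -> rho <= `|z - zu| \/ rho <= `|w - zv| ->
    res u i zu P k z + res v i zv Q k w - N * (xd z - xd w) ^+ 2 < 0.
Proof.
move=> uu vv uM vM bzu bzv rho00 rho_gt0 k0 joint.
have P0 := normr_ge0 P; have Q0 := normr_ge0 Q.
have M0 : 0 <= M := le_trans (normr_ge0 _) (uM i zu bzu).
pose A := [set z | branch z /\ `|z - zu| <= rho0] `*` [set w | branch w /\ `|w - zv| <= rho0].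
have cA : compact A by apply: compact_setX; exact: compact_branch_ball.
have [|h h0 hh] := @near_compact R (st * st)%type A (fun h y =>
    rho <= `|y.1 - zu| \/ rho <= `|y.2 - zv| -> `|xd y.1 - xd y.2| < h ->
    res u i zu P k y.1 + res v i zv Q k y.2 < 0) cA.
  move=> [z w] [/= [bz zr] [bw wr]].
  have [far|near] := pselect (rho <= `|z - zu| \/ rho <= `|w - zv|); last first.
    have [/negP n1 /negP n2] : ~ (rho <= `|z - zu|) /\ ~ (rho <= `|w - zv|).
      by split => h; apply: near; [left|right].
    rewrite -ltNge in n1; rewrite -ltNge in n2.
    exists (Num.min (rho - `|z - zu|) (rho - `|w - zv|)).
      by rewrite lt_min; apply/andP; split; [lra_on n1|lra_on n2].
    move=> h [y1 y2] hp hr _ hy.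
    have : Num.max `|y1 - z| `|y2 - w| < Num.min (rho - `|z - zu|) (rho - `|w - zv|) by [].
    rewrite gt_max !lt_min => /andP[/andP[y1z _] /andP[_ y2w]].
    case=> far _; exfalso.
      have := ler_normD (y1 - z) (z - zu); rewrite subrKA.
      by move: far y1z; lra_goal.
    have := ler_normD (y2 - w) (w - zv); rewrite subrKA.
    by move: far y2w; lra_goal.
  have [E|/eqP nE] := eqVneq (xd z) (xd w).
    have pos : 0 < sq (z - zu) + sq (w - zv).
      have e1 := sq_ge0 (z - zu); have e2 := sq_ge0 (w - zv).
      have sp x : rho <= `|x| -> 0 < sq x.
        by move=> hx; apply: lt_le_trans (norm_sq x); rewrite exprn_gt0//; exact: lt_le_trans hx.
      by case: far => /sp h; [apply: ltr_pwDl|apply: ltr_pwDr].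
    have [e ee] : exists e, e = (sq (z - zu) + sq (w - zv)) / 2 by eexists.
    have e0 : 0 < e / 2 by rewrite ee; move: pos; lra_goal.
    have Ab x r0 : [set z | branch z /\ `|z - x| <= r0] `<=` branch by move=> ? [].
    have [s1 s10 h1] := res_usc i zu P k (Ab zu rho0) uu (conj bz zr) e0.
    have [s2 s20 h2] := res_usc i zv Q k (Ab zv rho0) vv (conj bw wr) e0.
    exists (Num.min s1 s2); first by rewrite lt_min s10.
    move=> h [y1 y2] _ _ [Ay1 Ay2] hy.
    have : Num.max `|y1 - z| `|y2 - w| < Num.min s1 s2 by [].
    rewrite gt_max !lt_min => /andP[/andP[y1z _] /andP[_ y2w]] _ _ /=.
    have := h1 y1 Ay1 y1z; have := h2 y2 Ay2 y2w.
    have := joint z w bz bw zr wr E; move: pos; rewrite ee; lra_goal.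
  have d0 : 0 < `|xd z - xd w| by rewrite normr_gt0 subr_eq0; apply/eqP.
  exists (`|xd z - xd w| / 4); first by lra_on d0.
  move=> h [y1 y2] _ hd _ hy _ /= hy'.
  have : Num.max `|y1 - z| `|y2 - w| < `|xd z - xd w| / 4 by [].
  rewrite gt_max => /andP[y1z y2w]; exfalso.
  have e1 := le_lt_trans (xd_le (y1 - z)) y1z; have e2 := le_lt_trans (xd_le (y2 - w)) y2w.
  have := ler_normD (- xd (y1 - z) + xd (y2 - w)) (xd y1 - xd y2).
  have := ler_normD (- xd (y1 - z)) (xd (y2 - w)); rewrite normrN.
  rewrite (_ : - xd (y1 - z) + xd (y2 - w) + (xd y1 - xd y2) = xd z - xd w); last by rewrite !xdB; ring.
  by move: e1 e2 hd hy' d0; lra_goal.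
have [m mE] : exists m, m = 4 * M + n.+2%:R * ((`|P| + `|Q|) * rho0) + 1 by eexists.
have m0 : 0 < m.
  have : 0 <= n.+2%:R * ((`|P| + `|Q|) * rho0) by rewrite mulr_ge0// mulr_ge0// ?ltW// addr_ge0.
  by rewrite mE; move: M0; lra_goal.
have h20 : 0 < h / 2 by lra_on h0.
exists (m / (h / 2) ^+ 2); split => [|z w bz bw zr wr far].
  by rewrite divr_ge0 ?sqr_ge0// ltW.
have [cl|fa] := ltP `|xd z - xd w| (h / 2).
  have := hh (h / 2) (z, w) h20 ltac:(lra_on h0) (conj (conj bz zr) (conj bw wr)) far cl.
  have : 0 <= m / (h / 2) ^+ 2 * (xd z - xd w) ^+ 2.
    by rewrite mulr_ge0 ?sqr_ge0// divr_ge0 ?sqr_ge0// ltW.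
  by rewrite /=; lra_goal.
have : m <= m / (h / 2) ^+ 2 * (xd z - xd w) ^+ 2.
  apply: (@le_trans _ _ (m / (h / 2) ^+ 2 * (h / 2) ^+ 2)).
    by rewrite divfK// gt_eqF// exprn_gt0.
  apply: ler_wpM2l; first by rewrite divr_ge0 ?sqr_ge0// ltW.
  by rewrite -[leRHS]real_normK ?num_real// ler_sqr ?nnegrE// ltW.
have := res_le_bound i P k0 uM bzu bz zr; have := res_le_bound i Q k0 vM bzv bw wr.
rewrite mE (_ : n.+2%:R * ((`|P| + `|Q|) * rho0) =
  n.+2%:R * (`|P| * rho0) + n.+2%:R * (`|Q| * rho0)); last by ring.
by lra_goal.
Qed.

(** Away from the junction, where xd z = xd w holds only for the limit of the
    maximum points, the last variable is doubled as well: with the penalty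
    N * (xd z - xd w) ^+ 2 both equations hold at one common slope. *)
Lemma interior_contradiction H B u v i zu zv P Q (k rho0 M c : R) :
  (forall i, unif_cont_bounded T H i) -> (forall i, coercive T H i) ->
  jusc T u -> jusc T v -> psub T H B 0 u -> psub T (reflect_H H) (- B) 0 v ->
  (forall i z, branch z -> `|u i z| <= M) -> (forall i z, branch z -> `|v i z| <= M) ->
  branch zu -> branch zv -> xd zu < 0 -> xd zv = xd zu -> 0 < zu.2 -> 0 < zv.2 ->
  0 < rho0 -> 0 <= k -> 0 < c ->
  (forall z w, branch z -> branch w -> `|z - zu| <= rho0 -> `|w - zv| <= rho0 ->
     xd z = xd w ->
     res u i zu P k z + res v i zv Q k w <= - sq (z - zu) - sq (w - zv)) ->
  (forall r, op H i (P + r *: ed) (u i zu) zu <= c ->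
     op H i (- Q + r *: ed) (- v i zv) zv + 2 * c <
     op H i (P + r *: ed) (u i zu) zu) ->
  False.
Proof.
move=> uc co uu vv su sv uM vM bzu bzv xzu xzv tzu tzv rho00 k0 c0 joint gap.
have P0 := normr_ge0 P; have Q0 := normr_ge0 Q.
have M0 : 0 <= M := le_trans (normr_ge0 _) (uM i zu bzu).
have [b b0 hb] := op_coercive co (M + `|P| + 1) 1.
have [L LE] : exists L, L = M + `|P| + `|Q| + (b + `|P| + 1) + 1 by eexists.
have L0 : 0 < L by rewrite LE; lra_on M0 P0 Q0 b0.
have [a a0 ha] := op_unif_cont uc L0 c0.
have a20 : 0 < Num.min a 1 / 2 by rewrite divr_gt0// lt_min a0 ltr01.
have [ru ru0 hru] := uu i zu bzu _ a20.
have [rv rv0 hrv] := vv i zv bzv _ a20.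
have [C CE] : exists C, C = n.+2%:R * (`|P| + `|Q|) + 2 * k + 1 by eexists.
have CPQ : 0 <= n.+2%:R * (`|P| + `|Q|) by rewrite mulr_ge0// addr_ge0.
have C0 : 0 < C by rewrite CE; lra_on CPQ k0.
have [rho [rho_gt0 r1 [r2 r3] [r4 r5] [r6 r7]]] : exists rho : R,
    [/\ 0 < rho, rho <= rho0, rho <= zu.2 /\ rho <= zv.2, rho <= ru /\ rho <= rv
      & rho <= - xd zu /\ C * rho <= Num.min a 1 / 2].
  exists (Num.min rho0 (Num.min (Num.min zu.2 zv.2) (Num.min (Num.min ru rv)
    (Num.min (- xd zu) (Num.min a 1 / 2 / C))))).
  rewrite !lt_min rho00 tzu tzv ru0 rv0 oppr_gt0 xzu divr_gt0//.
  rewrite !ge_min !lexx !orbT; split => //; split => //.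
  rewrite -ler_pdivlMl// mulrC; by rewrite !ge_min lexx !orbT.
have amin : Num.min a 1 <= a /\ Num.min a 1 <= 1 by rewrite !ge_min !lexx orbT.
have [am [amE [am1 am2]]] : exists am, am = Num.min a 1 /\ am <= a /\ am <= 1 by exists (Num.min a 1).
rewrite -amE in a20 hru hrv r7.
clear amin amE.
have krho : 2 * k * rho <= am / 2.
  by apply: le_trans r7; apply: ler_wpM2r; [exact: ltW|rewrite CE; lra_on CPQ].
have PQrho : n.+2%:R * (`|P| + `|Q|) * rho <= am / 2.
  by apply: le_trans r7; apply: ler_wpM2r; [exact: ltW|rewrite CE; lra_on k0].
have rhoa : rho <= am / 2.
  by apply: le_trans r7; rewrite -[leLHS]mul1r; apply: ler_wpM2r; [exact: ltW|rewrite CE; lra_on k0 CPQ].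
pose A := [set z | branch z /\ `|z - zu| <= rho0] `*` [set w | branch w /\ `|w - zv| <= rho0].
have cA : compact A by apply: compact_setX; exact: compact_branch_ball.
have [N [N0 hN]] := penalty_exists uu vv uM vM bzu bzv rho00 rho_gt0 k0 joint.
pose th (y : st * st) := res u i zu P k y.1 + res v i zv Q k y.2 - N * (xd y.1 - xd y.2) ^+ 2.
have uth : usc_on A th.
  have Ab x r0 : [set z | branch z /\ `|z - x| <= r0] `<=` branch by move=> ? [].
  apply: usc_on_pair; [exact: res_usc|exact: res_usc|].
  by move=> y; apply: cvgM; [exact: cvg_cst|apply: cvgM; exact: xd_diff_continuous].
have Azz : A (zu, zv) by split=> /=; split => //; rewrite subrr normr0 ltW.
have [[z1 w1] [/= [bz1 z1r] [bw1 w1r]] zmax] := usc_on_max cA Azz uth.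
have th0 : 0 <= th (z1, w1).
  by have := zmax _ Azz; rewrite /th /= !res0 xzv subrr expr0n /= mulr0 subr0 addr0.
have [z1lt w1lt] : `|z1 - zu| < rho /\ `|w1 - zv| < rho.
  by split; rewrite ltNge; apply/negP => far; move: th0; apply/negP; rewrite -ltNge;
    apply: hN => //; [left|right].
have x1 : xd z1 < 0.
  have := le_lt_trans (xd_le _) z1lt; rewrite xdB ltr_norml => /andP[_ q]; lra_on q r6.
have y1 : xd w1 < 0.
  have := le_lt_trans (xd_le _) w1lt; rewrite xdB xzv ltr_norml => /andP[_ q]; lra_on q r6.
have t1 : 0 < z1.2.
  have := le_lt_trans (time_le (z1 - zu)) z1lt; rewrite /= ltr_norml => /andP[q _]; lra_on q r2.
have s1 : 0 < w1.2.
  have := le_lt_trans (time_le (w1 - zv)) w1lt; rewrite /= ltr_norml => /andP[q _]; lra_on q r3.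
have opu : op H i (P + (2 * k) *: (z1 - zu) + (2 * N * (xd z1 - xd w1)) *: ed) (u i z1) z1 <= 0.
  apply: (@interior_test H B u i z1 _ k) => //.
  exists (rho - `|z1 - zu|) => [|z bz zz]; first by lra_on z1lt.
  have Az : A (z, w1).
    split => //=; split => //; have := ler_normD (z - z1) (z1 - zu); rewrite subrKA.
    by move: zz r1; lra_goal.
  by have := zmax _ Az; have := res_sub u i zu P k z z1; rewrite /th /=; lra_goal.
have opv : op (reflect_H H) i (Q + (2 * k) *: (w1 - zv) + (2 * N * (xd w1 - xd z1)) *: ed) (v i w1) w1 <= 0.
  apply: (@interior_test (reflect_H H) (- B) v i w1 _ k) => //.
  exists (rho - `|w1 - zv|) => [|w bw ww]; first by lra_on w1lt.
  have Aw : A (z1, w).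
    split => //=; split => //; have := ler_normD (w - w1) (w1 - zv); rewrite subrKA.
    by move: ww r1; lra_goal.
  by have := zmax _ Aw; have := res_sub v i zv Q k w w1; rewrite /th /=; lra_goal.
have [r rE] : exists r, r = 2 * N * (xd z1 - xd w1) by eexists.
have kn (x y : st) : `|x - y| < rho -> `|(2 * k) *: (x - y) : st| <= am / 2.
  move=> xy; apply: le_trans krho; rewrite normrZ ger0_norm ?mulr_ge0//.
  by apply: ler_wpM2l; [rewrite mulr_ge0|exact: ltW].
rewrite -rE in opu.
have rb : `|r| <= b + `|P| + 1.
  rewrite leNgt; apply/negP => lt; move: opu; apply/negP; rewrite -ltNge.
  apply: lt_le_trans ltr01 _; apply: hb => //.
  - by apply: le_trans (uM _ _ bz1) _; lra_on P0.
  - rewrite time_shift_ed; apply: le_trans (time_le _) _; apply: le_trans (ler_normD _ _) _.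
    by have := kn _ _ z1lt; move: M0 am2; lra_goal.
  apply: le_trans (entry_le _ ord_max); rewrite -/(xd _) xd_shift_ed.
  have := ler_normD (xd (P + (2 * k) *: (z1 - zu)) + r) (- xd (P + (2 * k) *: (z1 - zu))).
  rewrite (_ : _ + r + - _ = r); last by ring.
  have := xd_le (P + (2 * k) *: (z1 - zu)); rewrite normrN.
  have := ler_normD P ((2 * k) *: (z1 - zu)); have := kn _ _ z1lt.
  by move: lt am2; lra_goal.
have ipb (x y : st) : `|y| < rho -> `|ip x y| <= n.+2%:R * `|x| * rho.
  by move=> yr; apply: le_trans (ip_le _ _) _; rewrite mulrA; apply: ler_wpM2l; [rewrite mulr_ge0|exact: ltW].
have PQ1 : n.+2%:R * `|P| * rho + n.+2%:R * `|Q| * rho <= am / 2.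
  apply: le_trans PQrho; rewrite le_eqVlt; apply/orP; left; apply/eqP; ring.
have u1 := hru i z1 (or_introl erefl) bz1 (lt_le_trans z1lt r4).
have v1 := hrv i w1 (or_introl erefl) bw1 (lt_le_trans w1lt r5).
have [ul vl] : - am < u i z1 - u i zu /\ - am < v i w1 - v i zv.
  have := ipb P _ z1lt; have := ipb Q _ w1lt; rewrite !ler_norml => /andP[q1 q2] /andP[q3 q4].
  have q5 : 0 <= k * sq (z1 - zu) by rewrite mulr_ge0// sq_ge0.
  have q6 : 0 <= k * sq (w1 - zv) by rewrite mulr_ge0// sq_ge0.
  have q7 : 0 <= N * (xd z1 - xd w1) ^+ 2 by rewrite mulr_ge0// sqr_ge0.
  by move: th0; rewrite /th /res /= => th0; split;
    lra_on th0 q1 q2 q3 q4 q5 q6 q7 u1 v1 PQ1.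
have nP (x : st) (r' : R) : `|x| <= `|P| + `|Q| + 1 -> `|r'| <= b + `|P| + 1 -> `|x + r' *: ed| <= L.
  move=> xb r'b; apply: le_trans (ler_normD _ _) _; rewrite normrZ norm_ed mulr1 LE.
  by lra_on xb r'b M0.
have sL (x : R) : `|x| <= M -> `|x| <= L.
  by move=> xM; apply: le_trans xM _; rewrite LE; lra_on b0 P0 Q0.
have cu : `|op H i (P + (2 * k) *: (z1 - zu) + r *: ed) (u i z1) z1 -
    op H i (P + r *: ed) (u i zu) zu| < c.
  apply: ha => //.
  - apply: nP => //; apply: le_trans (ler_normD _ _) _; have := kn _ _ z1lt.
    by move: am2 Q0; lra_goal.
  - by apply: nP => //; lra_on Q0.
  - exact/sL/uM.
  - exact/sL/uM.
  - rewrite [P + _ + _]addrAC [_ + (2 * k) *: _]addrC addrK.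
    by apply: le_lt_trans (kn _ _ z1lt) _; lra_on am1 a0 a20.
  - by rewrite ltr_norml; apply/andP; split; [lra_on ul am1|lra_on u1 am1 a20].
  - by apply: lt_le_trans z1lt _; lra_on rhoa am1 a20.
have cv : `|op (reflect_H H) i (Q + (2 * k) *: (w1 - zv) + (- r) *: ed) (v i w1) w1 -
    op (reflect_H H) i (Q + (- r) *: ed) (v i zv) zv| < c.
  rewrite !op_reflect -opprD normrN; apply: ha => //; rewrite ?normrN.
  - apply: nP; last by rewrite normrN.
    apply: le_trans (ler_normD _ _) _; have := kn _ _ w1lt.
    by move: am2 P0; lra_goal.
  - by apply: nP; [lra_on P0|rewrite normrN].
  - exact/sL/vM.
  - exact/sL/vM.
  - rewrite -opprD normrN [Q + _ + _]addrAC [_ + (2 * k) *: _]addrC addrK.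
    by apply: le_lt_trans (kn _ _ w1lt) _; lra_on am1 a0 a20.
  - rewrite -opprD normrN ltr_norml; apply/andP; split; [lra_on vl am1|lra_on v1 am1 a20].
  - by apply: lt_le_trans w1lt _; lra_on rhoa am1 a20.
have rE' : 2 * N * (xd w1 - xd z1) = - r by rewrite rE; ring.
rewrite rE' scaleNr in opv.
have E : op (reflect_H H) i (Q - r *: ed) (v i zv) zv = - op H i (- Q + r *: ed) (- v i zv) zv.
  by rewrite op_reflect opprB addrC.
move: cv; rewrite scaleNr E opprK.
move: cu; rewrite !ltr_norml => /andP[cu _] /andP[cv _].
have := gap r; move=> /(_ ltac:(lra_on cu opu)).
by move: cu cv opu opv; lra_goal.
Qed.

End interior_contradiction.

(** * The weight of the doubled variables *)

Section exponential_weight.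
Context {R : realType}.

Lemma expR_sub1 (x : R) : `|expR x - 1| <= `|x| * expR `|x|.
Proof.
have h1 := expR_ge1Dx x; have h2 := expR_ge1Dx (- x).
have ep := expR_gt0 x.
have h3 : expR x - 1 <= x * expR x.
  have := ler_wpM2l (ltW ep) h2; rewrite -expRD subrr expR0 mulrDr mulr1 mulrN (mulrC (expR x)).
  by move: ep; lra_goal.
have [x0|x0] := leP 0 x.
  by rewrite (ger0_norm x0) ger0_norm//; move: h1 x0; lra_goal.
have e1 : 1 <= expR `|x| by rewrite -expR0 ler_expR.
have e2 : expR x <= 1 by rewrite -expR0 ler_expR ltW.
rewrite ler0_norm ?subr_le0//; apply: (@le_trans _ _ `|x|).
  by rewrite ltr0_norm//; move: h1; lra_goal.
by rewrite ler_peMr.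
Qed.

Lemma expR_tangent (x : R) : expR x <= 1 + x + x ^+ 2 * expR `|x|.
Proof.
have h2 := expR_ge1Dx (- x); have ep := expR_gt0 x.
have h3 : expR x - 1 <= x * expR x.
  have := ler_wpM2l (ltW ep) h2; rewrite -expRD subrr expR0 mulrDr mulr1 mulrN (mulrC (expR x)).
  by move: ep; lra_goal.
have h4 : x * (expR x - 1) <= `|x| * (`|x| * expR `|x|).
  by apply: le_trans (ler_norm _) _; rewrite normrM ler_wpM2l// expR_sub1.
have -> : x ^+ 2 * expR `|x| = `|x| * (`|x| * expR `|x|).
  by rewrite -real_normK ?num_real//; ring.
by move: h3 h4; lra_goal.
Qed.

End exponential_weight.

Section doubling_weight.
Context {R : realType} {n : nat}.
Notation st := (spacetime R n).
Implicit Types z w d : st.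

Definition et : st := (0, 1).

Lemma ip_et z : ip et z = z.2.
Proof.
by rewrite /ip /= mul1r big1 ?add0r// => k _; rewrite mxE mul0r.
Qed.

Lemma xd_et : xd et = 0. Proof. by rewrite /xd mxE. Qed.

(** The penalty on space and time differences, with separate weights: the time
    weight has to be fixed before the space weight, since it alone controls
    the gradients. *)
Definition dist2 (N1 N2 : R) d := N1 * sq d + (N2 - N1) * d.2 ^+ 2.

Definition dist2_grad (N1 N2 : R) d := (2 * N1) *: d + (2 * (N2 - N1) * d.2) *: et.

Definition weight (lam kap e N1 N2 : R) z w :=
  kap * expR (lam * z.2) * (e + dist2 N1 N2 (z - w)).

Lemma dist2D N1 N2 d0 d : dist2 N1 N2 (d0 + d) =
  dist2 N1 N2 d0 + ip (dist2_grad N1 N2 d0) d + dist2 N1 N2 d.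
Proof.
rewrite /dist2 sqD /dist2_grad ipDl !ipZl ip_et.
rewrite (_ : (d0 + d).2 = d0.2 + d.2) //; ring.
Qed.

Lemma dist2_le N1 N2 d : 0 <= N1 -> 0 <= N2 -> dist2 N1 N2 d <= (N1 + N2) * sq d.
Proof.
move=> h1 h2; rewrite /dist2.
have e1 : N2 * d.2 ^+ 2 <= N2 * sq d by rewrite ler_wpM2l// time_sq.
have e2 : 0 <= N1 * d.2 ^+ 2 by rewrite mulr_ge0// sqr_ge0.
by move: e1 e2; lra_goal.
Qed.

Lemma dist2_time N1 N2 d : 0 <= N1 -> N2 * d.2 ^+ 2 <= dist2 N1 N2 d.
Proof.
move=> h1; have e1 : N1 * d.2 ^+ 2 <= N1 * sq d by rewrite ler_wpM2l// time_sq.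
by rewrite /dist2; move: e1; lra_goal.
Qed.

Lemma dist2_space N1 N2 d k : 0 <= N1 -> 0 <= N2 ->
  N1 * d.1 ord0 k ^+ 2 <= dist2 N1 N2 d.
Proof.
move=> h1 h2.
have e1 : d.1 ord0 k ^+ 2 + d.2 ^+ 2 <= sq d.
  rewrite /sq /ip (bigD1 k)//= !expr2 -addrA lerD2l lerDr.
  by apply: sumr_ge0 => i _; rewrite -expr2 sqr_ge0.
have e2 := ler_wpM2l h1 e1.
have e3 : 0 <= N2 * d.2 ^+ 2 by rewrite mulr_ge0// sqr_ge0.
by rewrite /dist2; move: e2 e3; lra_goal.
Qed.

Lemma dist2_ge0 N1 N2 d : 0 <= N1 -> 0 <= N2 -> 0 <= dist2 N1 N2 d.
Proof.
by move=> h1 h2; apply: le_trans (dist2_time N2 d h1); rewrite mulr_ge0// sqr_ge0.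
Qed.

Definition weight_grad (lam kap N1 N2 : R) z w :=
  (kap * expR (lam * z.2)) *: dist2_grad N1 N2 (z - w).

(** The weight is semiconcave: it lies below its tangent plus a paraboloid. The
    exponential contributes the time derivative lam * weight, which is what
    makes the two equations incompatible. *)
Lemma weight_tangent lam kap e N1 N2 zu zv :
  0 <= lam -> 0 <= kap -> 0 <= e -> 0 <= N1 -> 0 <= N2 ->
  exists2 k : R, 0 <= k & forall z w, `|z - zu| <= 1 ->
    weight lam kap e N1 N2 z w <= weight lam kap e N1 N2 zu zv
      + ip (weight_grad lam kap N1 N2 zu zv + (lam * weight lam kap e N1 N2 zu zv) *: et) (z - zu)
      - ip (weight_grad lam kap N1 N2 zu zv) (w - zv)
      + k * sq (z - zu) + k * sq (w - zv).
Proof.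
move=> l0 kap0 e0 h1 h2.
have [Q0 Q0E] : exists Q0, Q0 = e + dist2 N1 N2 (zu - zv) by eexists.
have Q00 : 0 <= Q0 by rewrite Q0E addr_ge0// dist2_ge0.
have [E0 E0E] : exists E0, E0 = kap * expR (lam * zu.2) by eexists.
have E00 : 0 <= E0 by rewrite E0E mulr_ge0// expR_ge0.
have [g gE] : exists g, g = dist2_grad N1 N2 (zu - zv) by eexists.
have [c cE] : exists c, c = expR lam by eexists.
have c0 : 0 <= c by rewrite cE expR_ge0.
have [k' k'E] : exists k', k' = Q0 * lam ^+ 2 * c + (lam * c) ^+ 2 * sq g + 2 + 2 * c * (N1 + N2) by eexists.
have g0 := sq_ge0 g.
have N0 : 0 <= N1 + N2 := addr_ge0 h1 h2.
have a1 : 0 <= Q0 * lam ^+ 2 * c by rewrite !mulr_ge0// sqr_ge0.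
have a2 : 0 <= (lam * c) ^+ 2 * sq g by rewrite mulr_ge0// sqr_ge0.
have a3 : 0 <= 2 * c * (N1 + N2) by rewrite !mulr_ge0.
exists (E0 * k') => [|z w z1]; first by rewrite mulr_ge0// k'E; lra_on a1 a2 a3.
rewrite /weight /weight_grad -E0E -gE -Q0E.
have [ze zeE] : exists ze, ze = z - zu by eexists.
have [om omE] : exists om, om = w - zv by eexists.
rewrite -zeE -omE; rewrite -zeE in z1.
have -> : z - w = (zu - zv) + (ze - om).
  by rewrite zeE omE opprB addrACA [zu + _]addrC subrK addKr.
have -> : expR (lam * z.2) = expR (lam * zu.2) * expR (lam * ze.2).
  by rewrite -expRD -mulrDr zeE /= addrC subrK.
have -> : e + dist2 N1 N2 (zu - zv + (ze - om)) = Q0 + ip g (ze - om) + dist2 N1 N2 (ze - om).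
  by rewrite (dist2D _ _ (zu - zv)) Q0E gE; ring.
have [x xE] : exists x, x = lam * ze.2 by eexists.
rewrite -xE mulrA -E0E.
have t1 : `|ze.2| <= 1 := le_trans (time_le ze) z1.
have xl : `|x| <= lam by rewrite xE normrM (ger0_norm l0) ler_piMr.
have ex : expR `|x| <= c by rewrite cE ler_expR.
have x2 : x ^+ 2 <= lam ^+ 2 * sq ze by rewrite xE exprMn ler_wpM2l ?sqr_ge0// time_sq.
have b1 : expR x <= 1 + x + lam ^+ 2 * sq ze * c.
  apply: le_trans (expR_tangent x) _; rewrite lerD2l; by apply: ler_pM => //; rewrite ?sqr_ge0 ?expR_ge0.
have b2 : (expR x - 1) ^+ 2 <= (lam * c) ^+ 2 * sq ze.
  apply: (@le_trans _ _ ((`|x| * c) ^+ 2)).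
    rewrite -real_normK ?num_real//; rewrite ler_sqr ?nnegrE ?mulr_ge0//.
    by apply: le_trans (expR_sub1 x) _; rewrite ler_wpM2l.
  rewrite exprMn real_normK ?num_real//.
  have -> : (lam * c) ^+ 2 * sq ze = lam ^+ 2 * sq ze * c ^+ 2 by ring.
  by apply: ler_wpM2r; rewrite ?sqr_ge0.
have b3 : expR x <= c by apply: le_trans ex; rewrite ler_expR ler_norm.
have b4 := sqB_le ze om.
have b5 : 2 * ((expR x - 1) * ip g (ze - om)) <= (expR x - 1) ^+ 2 * sq g + sq (ze - om).
  by have := ip_young ((expR x - 1) *: g) (ze - om); rewrite ipZl sqZ.
have sz := sq_ge0 ze; have so := sq_ge0 om; have sd := sq_ge0 (ze - om).
have b6 : expR x * dist2 N1 N2 (ze - om) <= c * ((N1 + N2) * sq (ze - om)).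
  by apply: ler_pM; rewrite ?expR_ge0 ?dist2_ge0//; exact: dist2_le.
have b7 : expR x * Q0 <= Q0 + Q0 * x + Q0 * lam ^+ 2 * c * sq ze.
  have := ler_wpM2l Q00 b1; rewrite mulrC.
  by rewrite (_ : Q0 * (1 + x + _) = Q0 + Q0 * x + Q0 * lam ^+ 2 * c * sq ze) //; ring.
have b8 : (expR x - 1) ^+ 2 * sq g <= (lam * c) ^+ 2 * sq g * sq ze.
  have -> : (lam * c) ^+ 2 * sq g * sq ze = (lam * c) ^+ 2 * sq ze * sq g by ring.
  by apply: ler_wpM2r.
have b9 : c * ((N1 + N2) * sq (ze - om)) <= c * ((N1 + N2) * (2 * sq ze + 2 * sq om)).
  by do 2 apply: ler_wpM2l => //.
have main : expR x * (Q0 + ip g (ze - om) + dist2 N1 N2 (ze - om)) <=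
   Q0 + Q0 * x + ip g ze - ip g om + k' * sq ze + k' * sq om.
  have z1' : 0 <= Q0 * lam ^+ 2 * c * sq om by rewrite mulr_ge0.
  have z2' : 0 <= (lam * c) ^+ 2 * sq g * sq om by rewrite mulr_ge0.
  have z3' : 0 <= (lam * c) ^+ 2 * sq g * sq ze by rewrite mulr_ge0.
  rewrite mulrDr mulrDr; move: b5 b6 b7 b8 b9; rewrite ipBr k'E.
  move: b4 z1' z2' z3' sz so; lra_goal.
have := ler_wpM2l E00 main.
rewrite ipDl !ipZl ip_et -mulrA.
rewrite (_ : E0 * (Q0 + Q0 * x + ip g ze - ip g om + k' * sq ze + k' * sq om) =
  E0 * Q0 + (E0 * ip g ze + lam * (E0 * Q0 * ze.2)) - E0 * ip g om + E0 * k' * sq ze + E0 * k' * sq om) //.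
  by move=> h; move: h; lra_goal.
rewrite xE; ring.
Qed.

End doubling_weight.

(** * The maximum of the doubled function *)

Section doubled_maximum.
Context {R : realType} {n K : nat} (T : R).
Notation st := (spacetime R n).
Notation branch := (cylinder T (@halfspace R n)).
Implicit Types (z w P Q : st) (u v : 'I_K -> st -> R).

Lemma weight_continuous lam kap e N1 N2 :
  continuous (fun y : st * st => weight lam kap e N1 N2 y.1 y.2).
Proof.
have cd : continuous (fun y : st * st => y.1 - y.2).
  by move=> y; apply: cvgB; [exact: cvg_fst|exact: cvg_snd].
have ct : continuous (fun y : st * st => (y.1 - y.2).2).
  move=> y; apply: (@continuous_comp _ _ _ (fun y : st * st => y.1 - y.2) (fun z : st => z.2)).
    exact: cd.
  exact: time_continuous.
have csq : continuous (fun y : st * st => sq (y.1 - y.2)).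
  move=> y; apply: (@continuous_comp _ _ _ (fun y : st * st => y.1 - y.2) (@sq R n)).
    exact: cd.
  have := @sq_continuous R n 0 (y.1 - y.2).
  by under [X in continuous_at _ X]eq_fun do rewrite subr0.
have c1 : continuous (fun y : st * st => y.1.2).
  move=> y; apply: (@continuous_comp _ _ _ fst (fun z : st => z.2)).
    exact: cvg_fst.
  exact: time_continuous.
move=> y; apply: cvgM.
  apply: cvgM; first exact: cvg_cst.
  apply: (@continuous_comp _ _ _ (fun y : st * st => lam * y.1.2) (@expR R)).
    by apply: cvgM; [exact: cvg_cst|exact: c1].
  exact: continuous_expR.
apply: cvgD; first exact: cvg_cst.
apply: cvgD; first by apply: cvgM; [exact: cvg_cst|exact: csq].
by apply: cvgM; [exact: cvg_cst|apply: cvgM; exact: ct].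
Qed.

(** A small quadratic confinement lets the doubled function reach its maximum
    although the branches are unbounded. *)
Lemma doubled_max u v (W : st * st -> R) (M b0 : R) :
  jusc T u -> jusc T v ->
  (forall i z, branch z -> `|u i z| <= M) -> (forall i z, branch z -> `|v i z| <= M) ->
  continuous W -> (forall y, 0 <= W y) -> 0 < b0 ->
  (exists j z w, [/\ branch z, branch w, xd z = xd w & W (z, w) < u j z + v j w]) ->
  exists b j zu zv, [/\ 0 < b <= b0, branch zu, branch zv, xd zu = xd zv &
    W (zu, zv) + b * (sq zu + sq zv) < u j zu + v j zv /\
    forall j' z w, branch z -> branch w -> xd z = xd w ->
      u j' z + v j' w - W (z, w) - b * (sq z + sq w) <=
      u j zu + v j zv - W (zu, zv) - b * (sq zu + sq zv)].
Proof.
move=> uu vv uM vM cW W0 b00 [j0 [z0 [w0 [bz0 bw0 xzw lt0]]]].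
have [m mE] : exists m, m = u j0 z0 + v j0 w0 - W (z0, w0) by eexists.
have m0 : 0 < m by rewrite mE subr_gt0.
have [s sE] : exists s, s = sq z0 + sq w0 by eexists.
have s0 : 0 <= s by rewrite sE addr_ge0 ?sq_ge0.
have M0 : 0 <= M := le_trans (normr_ge0 _) (uM j0 z0 bz0).
have [b bE] : exists b, b = Num.min b0 (m / (s + 1)) by eexists.
have s1 : 0 < s + 1 by lra_on s0.
have bpos : 0 < b by rewrite bE lt_min b00 divr_gt0.
have bs : b * s < m.
  have : b * (s + 1) <= m by rewrite -ler_pdivlMr// bE ge_min lexx orbT.
  by rewrite mulrDr mulr1; lra_on bpos.
have [r rE] : exists r, r = (2 * M + 1) / b + 1 by eexists.
have r1 : 1 <= r by rewrite rE lerDr divr_ge0//; [lra_on M0|exact: ltW].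
have br2 : 2 * M < b * r ^+ 2.
  have : b * r <= b * r ^+ 2 by rewrite ler_pM2l// expr2 ler_peMr//; lra_on r1.
  have -> : b * r = 2 * M + 1 + b by rewrite rE; field; rewrite gt_eqF.
  by lra_on bpos.
pose Phi j (y : st * st) := u j y.1 + v j y.2 - (W y + b * (sq (y.1 - 0) + sq (y.2 - 0))).
have PhiE j z w : Phi j (z, w) = u j z + v j w - W (z, w) - b * (sq z + sq w).
  by rewrite /Phi /= !subr0; ring.
pose C := [set z | branch z /\ `|z - 0| <= r].
pose A := (C `*` C) `&` [set y : st * st | xd y.1 - xd y.2 = 0].
have cA : compact A.
  apply: compact_closedI; first by apply: compact_setX; exact: compact_branch_ball.
  by apply: (@closed_comp _ _ (fun y : st * st => xd y.1 - xd y.2) [set x | x = 0]) => [y _|];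
    [exact: xd_diff_continuous|exact: closed_eq].
have far j z w : branch z -> branch w -> r < `|z| \/ r < `|w| -> Phi j (z, w) < 0.
  move=> bz bw hf; rewrite PhiE.
  have h1 := uM j z bz; have h2 := vM j w bw.
  have h3 := W0 (z, w).
  have h4 : b * r ^+ 2 <= b * (sq z + sq w).
    rewrite ler_pM2l//; have q1 := sq_ge0 z; have q2 := sq_ge0 w.
    have q (x : st) : r < `|x| -> r ^+ 2 <= sq x.
      move=> rx; apply: le_trans (norm_sq x); rewrite ler_sqr ?nnegrE//; first exact: ltW.
      by lra_on r1.
    by case: hf => hf; have := q _ hf; [lra_on q2|lra_on q1].
  move: h1 h2; rewrite !ler_norml => /andP[_ h1] /andP[_ h2].
  by move: h1 h2 h3 h4 br2; lra_goal.
have Phi0 : 0 < Phi j0 (z0, w0) by rewrite PhiE -sE; move: bs; rewrite mE; lra_goal.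
have A0 : A (z0, w0).
  split; last by rewrite /= xzw subrr.
  by split; split => //=; rewrite subr0 leNgt; apply/negP => h;
    move: Phi0; apply/negP; rewrite -leNgt; apply/ltW/far => //; [left|right].
have ub : forall j, exists2 y, A y & forall y', A y' -> Phi j y' <= Phi j y.
  move=> j; apply: (usc_on_max cA A0).
  move=> y [[Ay1 Ay2] _] e e0.
  have Cb : C `<=` branch by move=> ? [].
  have cg : continuous (fun y : st * st => W y + b * (sq (y.1 - 0) + sq (y.2 - 0))).
    move=> x; apply: cvgD; first exact: cW.
    apply: cvgM; first exact: cvg_cst.
    apply: cvgD.
      by apply: (@continuous_comp _ _ _ fst (fun z : st => sq (z - 0))); [exact: cvg_fst|exact: sq_continuous].
    by apply: (@continuous_comp _ _ _ snd (fun z : st => sq (z - 0))); [exact: cvg_snd|exact: sq_continuous].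
  have [d d0 hd] := usc_on_pair (jusc_usc_on j Cb uu) (jusc_usc_on j Cb vv) cg (conj Ay1 Ay2) e0.
  by exists d => // y' [Ay' _]; exact: hd.
have /(_ _)/cid2 f := ub.
have [j _ hj] := @fin_argmax R K (fun _ => True) (fun j => Phi j (projT1 (f j))) j0 I.
have Aj : A (projT1 (f j)) by case: (f j).
move: hj Aj; move: (projT1 (f j)) => [zu zv] /= hj [[[bzu _] [bzv _]] /= xx].
have best j' z w : branch z -> branch w -> xd z = xd w -> Phi j' (z, w) <= Phi j (zu, zv).
  move=> bz bw xzw'.
  have P0 : 0 <= Phi j (zu, zv).
    apply/ltW/(lt_le_trans Phi0); apply: le_trans (hj j0 I).
    by case: (f j0) => y _ /=; apply.
  have [zr|zr] := leP `|z| r; last by apply: le_trans P0; apply/ltW/far => //; left.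
  have [wr|wr] := leP `|w| r; last by apply: le_trans P0; apply/ltW/far => //; right.
  apply: le_trans (hj j' I); case: (f j') => y _ /=; apply.
  by split; [split; split => //=; rewrite subr0|rewrite /= xzw' subrr].
exists b, j, zu, zv; split => //.
- by rewrite bpos bE ge_min lexx.
- by move/eqP: xx; rewrite subr_eq0 => /eqP.
split; first by have := lt_le_trans Phi0 (best _ _ _ bz0 bw0 xzw); rewrite PhiE; lra_goal.
by move=> j' z w bz bw xzw'; rewrite -!PhiE; exact: best.
Qed.

Lemma scaled_sq_small (M s c : R) : 0 <= M -> 0 < s ->
  (2 * M + 1) / s ^+ 2 * c ^+ 2 <= 2 * M -> `|c| < s.
Proof.
move=> M0 s0 h; rewrite ltNge; apply/negP => sc.
have : s ^+ 2 <= c ^+ 2.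
  by rewrite -[leRHS]real_normK ?num_real// ler_sqr ?nnegrE// ltW.
have q : 0 <= (2 * M + 1) / s ^+ 2 by rewrite divr_ge0 ?sqr_ge0//; lra_on M0.
move=> /(ler_wpM2l q); rewrite divfK ?gt_eqF ?exprn_gt0//.
by move: h; lra_goal.
Qed.

End doubled_maximum.

(** * Comparison of sub- and super-solutions *)

Section doubling_estimate.
Context {R : realType} {n K : nat} (T : R).
Notation st := (spacetime R n).
Notation branch := (cylinder T (@halfspace R n)).
Implicit Types (z w P Q : st) (u v : 'I_K -> st -> R).
Implicit Types H : 'I_K -> 'rV[R]_n.+1 -> R -> 'rV[R]_n.+1 -> R -> R.

Lemma lipschitz_common H : (forall i, lipschitz_ut T H i) ->
  exists2 C : R, 0 <= C & forall j p s1 s2 x t1 t2, halfspace x -> 0 <= t1 <= T ->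
    0 <= t2 <= T -> `|H j p s1 x t1 - H j p s2 x t2| <= C * (`|s1 - s2| + `|t1 - t2|).
Proof.
move=> lip; apply: fin_common_large => [j|j a b ab h]; first exact: lip.
move=> p s1 s2 x t1 t2 hx h1 h2; apply: le_trans (h _ _ _ _ _ _ hx h1 h2) _.
by apply: ler_wpM2r => //; exact: addr_ge0.
Qed.

(** The gain lam * W of the exponential weight beats the Lipschitz loss
    of the Hamiltonian, so that both equations cannot hold at the same slope;
    the gradients X and Y of the two test functions nearly agree. *)
Lemma doubled_gap H (C a L e W lam s1 s2 : R) j X Y zu zv :
  (forall p s1 s2 x t1 t2, halfspace x -> 0 <= t1 <= T -> 0 <= t2 <= T ->
     `|H j p s1 x t1 - H j p s2 x t2| <= C * (`|s1 - s2| + `|t1 - t2|)) ->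
  (forall P1 P2 (s1 s2 : R) z1 z2, `|P1| <= L -> `|P2| <= L -> `|s1| <= L ->
    `|s2| <= L -> branch z1 -> branch z2 ->
    `|P1 - P2| < a -> `|s1 - s2| < a -> `|z1 - z2| < a ->
    `|op H j P1 s1 z1 - op H j P2 s2 z2| < e / 2) ->
  0 <= C -> 0 < a -> branch zu -> branch zv -> `|X| <= L -> `|Y| <= L -> `|s2| <= L ->
  `|X - Y| < a -> `|zu.1 - zv.1| < a -> C * `|zu.2 - zv.2| <= e / 2 ->
  `|s1 - s2| <= 2 * W -> e <= W -> lam = 2 * C + 2 ->
  op H j Y s2 zv + e <= lam * W + op H j X s1 zu.
Proof.
move=> lip uc C0 a0 [xu tu] [xv tv] hX hY hs2 XY xx tt ss eW lamE.
have bm : branch ((zu.1, zv.2) : st) by [].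
have e1 : `|op H j X s1 zu - op H j X s2 (zu.1, zv.2)| <= C * (`|s1 - s2| + `|zu.2 - zv.2|).
  rewrite /op /= (_ : _ + _ - (_ + _) = H j X.1 s1 zu.1 zu.2 - H j X.1 s2 zu.1 zv.2); last by ring.
  exact: lip.
have e2 : `|op H j X s2 (zu.1, zv.2) - op H j Y s2 zv| < e / 2.
  apply: uc => //; first by rewrite subrr normr0.
  by rewrite st_normE /= subrr normr0 gt_max xx.
have e3 : C * `|s1 - s2| <= 2 * C * W.
  by have := ler_wpM2l C0 ss; lra_goal.
move: e1 e2; rewrite ler_norml ltr_norml mulrDr lamE => /andP[e1 _] /andP[e2 _].
by move: e1 e2 e3 tt eW; lra_goal.
Qed.

(** Quantitative comparison: a sub-solution u and a super-solution - v that
    are ordered initially stay ordered, and the order is stable under small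
    displacements along the junction and in time. *)
Theorem doubling_estimate H B u v (M : R) :
  (forall i, unif_cont_bounded T H i) -> (forall i, coercive T H i) ->
  (forall i, lipschitz_ut T H i) -> 0 < T ->
  jusc T u -> jusc T v -> psub T H B 0 u -> psub T (reflect_H H) (- B) 0 v ->
  (forall i z, branch z -> `|u i z| <= M) -> (forall i z, branch z -> `|v i z| <= M) ->
  (forall e, 0 < e -> exists2 tau : R, 0 < tau & forall j z w, branch z -> branch w ->
     z.2 <= tau -> w.2 <= tau -> `|z.1 - w.1| <= tau -> u j z + v j w <= e) ->
  forall e : R, 0 < e -> exists2 N : R, 0 <= N & forall j z w, branch z -> branch w ->
    xd z = xd w -> u j z + v j w <= e + N * sq (z - w).
Proof.
move=> uc co lip T0 uu vv su sv uM vM init e e0.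
have [C C0 hC] := lipschitz_common lip.
have [lam lamE] : exists lam, lam = 2 * C + 2 by eexists.
have lam0 : 0 <= lam by rewrite lamE; lra_on C0.
have [eT eTE] : exists eT, eT = expR (lam * T) by eexists.
have eT1 : 1 <= eT by rewrite eTE -expR0 ler_expR mulr_ge0// ltW.
have [e1 e1E] : exists e1, e1 = e / eT by eexists.
have eTp : 0 < eT by lra_on eT1.
have e10 : 0 < e1 by rewrite e1E divr_gt0.
apply: contrapT => noN.
have noN' N : 0 <= N -> exists j z w, [/\ branch z, branch w, xd z = xd w &
    e + N * sq (z - w) < u j z + v j w].
  move=> N0; apply: contrapT => no; apply: noN; exists N => // j z w bz bw xzw.
  by rewrite leNgt; apply/negP => lt; apply: no; exists j, z, w.
have [j0 [z0 [w0 [bz0 _ _ _]]]] := noN' 0 (lexx 0).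
have M0 : 0 <= M := le_trans (normr_ge0 _) (uM j0 z0 bz0).
have e20 : 0 < e1 / 2 by lra_on e10.
have [tau tau0 htau] := init _ e20.
have [s [s0 stau sC]] : exists s : R, [/\ 0 < s, s <= tau & C * s <= e1 / 2].
  have c1 : 0 < C + 1 by lra_on C0.
  exists (Num.min tau (e1 / 2 / (C + 1))).
  rewrite lt_min tau0 divr_gt0// ge_min lexx; split => //.
  apply: (@le_trans _ _ ((C + 1) * Num.min tau (e1 / 2 / (C + 1)))).
    by rewrite ler_wpM2r// ?lerDl// le_min ltW//= divr_ge0// ltW.
  by rewrite mulrC -ler_pdivlMr// ge_min lexx orbT.
(* The time weight comes first: it bounds the time derivatives of the test
   functions by ab, hence by coercivity their gradients by L. Only then can the
   space weight N1 be chosen, according to the modulus of continuity of H on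
   the ball of radius L. *)
have [N2 N2E] : exists N2, N2 = (2 * M + 1) / s ^+ 2 by eexists.
have N20 : 0 <= N2 by rewrite N2E divr_ge0 ?sqr_ge0//; lra_on M0.
have [A0 A0E] : exists A0, A0 = 2 * M / e1 + 1 by eexists.
have A00 : 0 <= A0 by rewrite A0E; apply: addr_ge0 => //; apply: divr_ge0; [exact: mulr_ge0|exact: ltW].
have [ab abE] : exists ab, ab = 2 * (A0 * eT) * N2 * s by eexists.
have ab0 : 0 <= ab by rewrite abE !mulr_ge0// ltW.
have [cc ccE] : exists cc, cc = ab + lam * (2 * M) + 1 + M by eexists.
have lM0 : 0 <= lam * (2 * M) by rewrite !mulr_ge0.
have [Pb Pb0 hPb] := op_coercive co cc e1.
have [L LE] : exists L, L = Pb + cc + 2 by eexists.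
have L0 : 0 < L by rewrite LE ccE; lra_on Pb0 ab0 lM0 M0.
have [a a0 ha] := op_unif_cont uc L0 e20.
have [s1 [s10 s1tau s1a]] : exists s1 : R, [/\ 0 < s1, s1 <= tau & s1 < a].
  exists (Num.min tau (a / 2)); rewrite lt_min tau0 ge_min lexx; split => //; first by lra_on a0.
  by rewrite gt_min; apply/orP; right; lra_on a0.
have [N1 N1E] : exists N1, N1 = (2 * M + 1) / s1 ^+ 2 by eexists.
have N10 : 0 <= N1 by rewrite N1E divr_ge0 ?sqr_ge0//; lra_on M0.
pose W kap z w := weight lam kap e1 N1 N2 z w.
have expb z : branch z -> 1 <= expR (lam * z.2) <= eT.
  move=> [_ /andP[t1 t2]]; rewrite -expR0 eTE !ler_expR mulr_ge0//=.
  exact: ler_wpM2l.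
have d20 (d : st) : 0 <= dist2 N1 N2 d by exact: dist2_ge0.
have Wlow kap z w : 0 <= kap -> branch z -> kap * (e1 + dist2 N1 N2 (z - w)) <= W kap z w.
  move=> k0 bz; rewrite /W /weight; apply: ler_wpM2r; first by rewrite addr_ge0// ltW.
  by rewrite ler_peMr//; case/andP: (expb z bz).
pose S kap := exists j z w, [/\ branch z, branch w, xd z = xd w & W kap z w < u j z + v j w].
have S1 : S 1.
  have [j [z [w [bz bw xzw lt]]]] := noN' (eT * (N1 + N2)) ltac:(by rewrite mulr_ge0 ?addr_ge0// ltW).
  exists j, z, w; split => //; apply: le_lt_trans lt.
  rewrite /W /weight mul1r; have /andP[q1 q2] := expb z bz.
  apply: (@le_trans _ _ (eT * (e1 + dist2 N1 N2 (z - w)))).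
    by apply: ler_wpM2r => //; rewrite addr_ge0// ltW.
  rewrite mulrDr -mulrA lerD//; first by rewrite e1E mulrC divfK// gt_eqF.
  by apply: ler_wpM2l; [exact: ltW|exact: dist2_le].
have uvM j z w : branch z -> branch w -> u j z + v j w <= 2 * M.
  move=> bz bw; have := uM j z bz; have := vM j w bw.
  by rewrite !ler_norml => /andP[_ q1] /andP[_ q2]; lra_on q1 q2.
have Sb kap : S kap -> kap <= A0.
  move=> [j [z [w [bz bw xzw lt]]]]; rewrite leNgt; apply/negP => kA.
  have k0 : 0 <= kap by lra_on A00 kA.
  have q1 := Wlow kap z w k0 bz; have q2 := uvM j z w bz bw.
  have q3 : 0 <= kap * dist2 N1 N2 (z - w) by rewrite mulr_ge0.
  have q4 : A0 * e1 <= kap * e1 by rewrite ler_pM2r// ltW.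
  have q5 : A0 * e1 = 2 * M + e1 by rewrite A0E mulrDl mul1r divfK// gt_eqF.
  by move: q1 q2 q3 q4 q5 lt e10; rewrite mulrDr; lra_goal.
(* The factor kap of the weight is within a factor two of the least one that
   makes the estimate true, so that u + v <= 2 * W everywhere; this controls
   the dependence of H on u at the maximum point. *)
have [kap [kap1 Skap nS]] : exists kap : R, [/\ 1 <= kap, S kap & ~ S (2 * kap)].
  have [sg sg1 sg2] := exists_sup S1 Sb.
  have sg_ge1 : 1 <= sg := sg1 _ S1.
  have sg0 : 0 < sg / 2 by lra_on sg_ge1.
  have [r Sr rs] := sg2 _ sg0.
  have [r1|r1] := leP 1 r.
    by exists r; split => // /sg1; lra_on rs.
  by exists 1; split => // /sg1; lra_on rs r1.
have kap0 : 0 <= kap by lra_on kap1.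
have kapA := Sb _ Skap.
have W2 j z w : branch z -> branch w -> xd z = xd w -> u j z + v j w <= 2 * W kap z w.
  move=> bz bw xzw; rewrite leNgt; apply/negP => lt; apply: nS; exists j, z, w; split => //.
  by apply: le_lt_trans lt; rewrite /W /weight !mulrA.
have [tol [tol0 tol1 tola]] : exists tol : R, [/\ 0 < tol, tol <= 1 & 2 * tol < a].
  exists (Num.min 1 (a / 4)); rewrite lt_min ltr01 ge_min lexx; split => //; first by lra_on a0.
  have : Num.min 1 (a / 4) <= a / 4 by rewrite ge_min lexx orbT.
  by lra.
have b00 : 0 < tol ^+ 2 / (8 * M + 1) by rewrite divr_gt0 ?exprn_gt0//; lra_on M0.
have W_ge0 (y : st * st) : 0 <= W kap y.1 y.2.
  apply: mulr_ge0; first by apply: mulr_ge0 => //; exact: expR_ge0.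
  by apply: addr_ge0 => //; exact: ltW.
have [b [j [zu [zv [/andP[bp bb0] bzu bzv xzuv [pos best]]]]]] :=
  doubled_max uu vv uM vM (@weight_continuous R n lam kap e1 N1 N2) W_ge0 b00 Skap.
rewrite /= -/(W kap zu zv) in pos.
have bsq : b * (sq zu + sq zv) <= 2 * M.
  have := uvM j zu zv bzu bzv; have := W_ge0 (zu, zv); move: pos => /=; lra_goal.
have b8 : b * (8 * M + 1) <= tol ^+ 2.
  by rewrite -ler_pdivlMr//; lra_on M0.
have small x : 0 <= b * sq x -> b * sq x <= 2 * M -> `|(2 * b) *: x : st| <= tol.
  move=> x0 xM; apply: sq_bound; first exact: ltW.
  have -> : sq ((2 * b) *: x) = 4 * b * (b * sq x) by rewrite sqZ; ring.
  apply: (@le_trans _ _ (4 * b * (2 * M))).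
    by apply: ler_wpM2l => //; rewrite mulr_ge0// ltW.
  by move: b8 bp; lra_goal.
have bu0 : 0 <= b * sq zu by rewrite mulr_ge0 ?sq_ge0// ltW.
have bv0 : 0 <= b * sq zv by rewrite mulr_ge0 ?sq_ge0// ltW.
have smu : `|(2 * b) *: zu : st| <= tol.
  by apply: small => //; move: bsq bv0; rewrite mulrDr; lra_goal.
have smv : `|(2 * b) *: zv : st| <= tol.
  by apply: small => //; move: bsq bu0; rewrite mulrDr; lra_goal.
have [W0 W0E] : exists W0, W0 = W kap zu zv by eexists.
have W0low : e1 + dist2 N1 N2 (zu - zv) <= W0.
  rewrite W0E; apply: le_trans (Wlow kap zu zv kap0 bzu).
  by rewrite ler_peMl// addr_ge0// ltW.
have bsq0 : 0 <= b * (sq zu + sq zv) by rewrite mulrDr addr_ge0.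
have posW : W0 < u j zu + v j zv by rewrite W0E; lra_on pos bsq0.
have uv2M := uvM j zu zv bzu bzv.
have d2M : dist2 N1 N2 (zu - zv) <= 2 * M by lra_on W0low posW uv2M e10.
have tclose : `|zu.2 - zv.2| < s.
  apply: (scaled_sq_small M0 s0); rewrite -N2E.
  exact: le_trans (dist2_time N2 (zu - zv) N10) d2M.
have xclose : `|zu.1 - zv.1| <= s1.
  apply: rV_norm_le => [|k]; first exact: ltW.
  apply/ltW/(scaled_sq_small M0 s10); rewrite -N1E.
  exact: le_trans (dist2_space (zu - zv) k N10 N20) d2M.
have [tu tv] : 0 < zu.2 /\ 0 < zv.2.
  have [_ /andP[zu0 _]] := bzu; have [_ /andP[zv0 _]] := bzv.
  have key : zu.2 <= tau -> zv.2 <= tau -> False.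
    move=> q1 q2; have := htau j zu zv bzu bzv q1 q2 (le_trans xclose s1tau).
    by move: posW W0low (d20 (zu - zv)) e10; lra_goal.
  move: tclose; rewrite ltr_norml => /andP[q1 q2].
  split; rewrite lt_neqAle ?zu0 ?zv0 andbT; apply/eqP => E; apply: key; rewrite -?E;
    move: q1 q2 stau s0; rewrite -?E; lra_goal.
have [k k0 hk] := @weight_tangent R n lam kap e1 N1 N2 zu zv lam0 kap0 (ltW e10) N10 N20.
rewrite -/(W kap zu zv) -W0E in hk.
have [G GE] : exists G, G = weight_grad lam kap N1 N2 zu zv by eexists.
rewrite -GE in hk.
have G2 : `|G.2| <= ab.
  have -> : G.2 = 2 * (kap * expR (lam * zu.2)) * N2 * (zu.2 - zv.2).
    rewrite GE /weight_grad /dist2_grad /=; rewrite /GRing.scale /=; ring.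
  rewrite normrM abE; apply: ler_pM => //; last exact: ltW.
  rewrite ger0_norm; last by rewrite !mulr_ge0// expR_ge0.
  apply: ler_wpM2r => //; apply: ler_wpM2l => //; apply: ler_pM; rewrite ?expR_ge0//.
  by case/andP: (expb zu bzu).
have xG : xd G = 0.
  by rewrite GE /weight_grad /dist2_grad !(xdZ, xdD, xdN) xzuv subrr xd_et; ring.
pose P := G + (lam * W0) *: et + (2 * b) *: zu.
pose Q := - G + (2 * b) *: zv.
pose k' := k + b + 1.
have k'0 : 0 <= k' by rewrite /k' !addr_ge0// ltW.
have joint j' z w : (j' = j \/ xd zu = 0) -> branch z -> branch w ->
   `|z - zu| <= 1 -> `|w - zv| <= 1 -> xd z = xd w ->
   res u j' zu P k' z + res v j' zv Q k' w <= - sq (z - zu) - sq (w - zv).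
  move=> aj bz bw z1 w1 xzw; have := best j' z w bz bw xzw; have := hk z w z1.
  have -> : u j zu = u j' zu by case: aj => [->//|x0]; exact: (jusc_agree _ _ uu bzu x0).
  have -> : v j zv = v j' zv by case: aj => [->//|x0]; apply: (jusc_agree _ _ vv bzv); rewrite -xzuv.
  rewrite /= -/(W kap z w) -/(W kap zu zv) -W0E.
  have -> : sq z = sq zu + 2 * ip zu (z - zu) + sq (z - zu) by rewrite -sqD addrC subrK.
  have -> : sq w = sq zv + 2 * ip zv (w - zv) + sq (w - zv) by rewrite -sqD addrC subrK.
  rewrite /res /P /Q /k' !ipDl !ipZl ipNl ip_et; lra_goal.
have P2 : `|P.2| <= cc.
  have -> : P.2 = G.2 + lam * W0 + ((2 * b) *: zu : st).2.
    by rewrite /P /= /GRing.scale /= mulr1.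
  apply: le_trans (ler_normD _ _) _; apply: le_trans (lerD (ler_normD _ _) (lexx _)) _.
  have q1 := le_trans (time_le ((2 * b) *: zu : st)) smu.
  have W00 : 0 <= W0 by rewrite W0E; exact: (W_ge0 (zu, zv)).
  have q2 : lam * W0 <= lam * (2 * M) by rewrite ler_wpM2l//; lra_on posW uv2M.
  by rewrite (ger0_norm (mulr_ge0 lam0 W00)) ccE; move: q1 q2 G2 tol1 M0; lra_goal.
have Q2 : `|Q.2| <= cc.
  have -> : Q.2 = - G.2 + ((2 * b) *: zv : st).2 by [].
  apply: le_trans (ler_normD _ _) _; rewrite normrN.
  have q1 := le_trans (time_le ((2 * b) *: zv : st)) smv.
  by rewrite ccE; move: q1 G2 tol1 M0 lM0; lra_goal.
have Mc : M <= cc by rewrite ccE; lra_on ab0 lM0.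
have gap j' r : (j' = j \/ xd zu = 0) ->
    op H j' (P + r *: ed) (u j' zu) zu <= e1 / 4 \/
    op H j' (- Q + r *: ed) (- v j' zv) zv <= e1 / 4 ->
    op H j' (- Q + r *: ed) (- v j' zv) zv + 2 * (e1 / 4) < op H j' (P + r *: ed) (u j' zu) zu.
  move=> aj small_one.
  pose X := G + (2 * b) *: zu + r *: ed; pose Y := - Q + r *: ed.
  have PX : P + r *: ed = X + (lam * W0) *: et by rewrite /X /P -!addrA; congr (_ + _); rewrite [LHS]addrC -addrA.
  have opPX : op H j' (P + r *: ed) (u j' zu) zu = lam * W0 + op H j' X (u j' zu) zu.
    rewrite PX /op /=; have -> : X.1 + (lam * W0) *: 0 = X.1 by rewrite scaler0 addr0.
    by rewrite /GRing.scale /= mulr1; ring.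
  have XY : `|X - Y| <= 2 * tol.
    have -> : X - Y = (2 * b) *: zu + (2 * b) *: zv.
      by rewrite /X /Y opprD opprK addrACA subrr addr0 /Q addrACA subrr add0r.
    by apply: le_trans (ler_normD _ _) _; move: smu smv; lra_goal.
  have X2 : `|X.2| <= cc.
    rewrite time_shift_ed; apply: le_trans (ler_normD _ _) _.
    have q1 := le_trans (time_le ((2 * b) *: zu : st)) smu.
    by rewrite ccE; move: q1 G2 tol1 M0 lM0; lra_goal.
  have Y2 : `|Y.2| <= cc by rewrite time_shift_ed /= normrN.
  have XPb : `|X.1| <= Pb \/ `|Y.1| <= Pb.
    case: small_one => h; [left|right]; rewrite leNgt; apply/negP => lt;
      move: h; apply/negP; rewrite -ltNge; (apply: lt_le_trans (_ : e1 / 4 < e1) _; first by lra_on e10);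
      apply: hPb => //.
    - exact: le_trans (uM _ _ bzu) Mc.
    - by rewrite time_shift_ed.
    - by rewrite PX /= scaler0 addr0 ltW.
    - by rewrite normrN; exact: le_trans (vM _ _ bzv) Mc.
    - exact: ltW.
  have nrm (x : st) : `|x| <= Num.max `|x.1| `|x.2| by [].
  have XY1 : `|X.1 - Y.1| <= 2 * tol := le_trans (space_le (X - Y)) XY.
  have XL1 : `|X.1| <= Pb + 2.
    case: XPb => h; first by lra_on h.
    have := ler_normD Y.1 (X.1 - Y.1); rewrite addrC subrK.
    by move: h XY1 tol1; lra_goal.
  have YL1 : `|Y.1| <= Pb + 2.
    case: XPb => h; last by lra_on h.
    have := ler_normD X.1 (Y.1 - X.1); rewrite addrC subrK -[`|Y.1 - X.1|]distrC.
    by move: h XY1 tol1; lra_goal.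
  have XL : `|X| <= L.
    rewrite st_normE ge_max LE; apply/andP; split; first by move: XL1 Mc M0; lra_goal.
    by move: X2 Pb0; lra_goal.
  have YL : `|Y| <= L.
    rewrite st_normE ge_max LE; apply/andP; split; first by move: YL1 Mc M0; lra_goal.
    by move: Y2 Pb0; lra_goal.
  have vL : `|- v j' zv| <= L.
    by rewrite normrN; apply: le_trans (vM _ _ bzv) _; rewrite LE; move: Mc Pb0; lra_goal.
  have eW : e1 <= W0 by move: W0low (d20 (zu - zv)); lra_goal.
  have ss : `|u j' zu - - v j' zv| <= 2 * W0.
    rewrite opprK W0E; have <- : u j zu = u j' zu by case: aj => [->//|x0]; exact: (jusc_agree _ _ uu bzu x0).
    have <- : v j zv = v j' zv by case: aj => [->//|x0]; apply: (jusc_agree _ _ vv bzv); rewrite -xzuv.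
    rewrite ger0_norm; first exact: W2.
    by move: posW eW e10; lra_goal.
  have tt : C * `|zu.2 - zv.2| <= e1 / 2.
    by apply: le_trans sC; apply: ler_wpM2l => //; exact: ltW.
  have := doubled_gap (hC j') (ha j') C0 a0 bzu bzv XL YL vL (le_lt_trans XY tola)
    (le_lt_trans xclose s1a) tt ss eW lamE.
  by rewrite opPX -/Y; move: e10; lra_goal.
have : xd zu <= 0 by case: bzu.
rewrite le_eqVlt => /orP[/eqP x0|xneg].
  apply: (@junction_contradiction R n K T H B M k' 1 u v zu zv P Q uc co uu vv su sv
    uM bzu bzv x0 _ tu tv ltr01 k'0 _ _ j).
  - by rewrite -xzuv.
  - by move=> j' z w; apply: joint; right.
  - move=> j' r h; have := gap j' r (or_intror x0).
    have e4 : 0 <= e1 / 4 by lra_on e10.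
    have : op H j' (P + r *: ed) (u j' zu) zu <= e1 / 4 \/
      op H j' (- Q + r *: ed) (- v j' zv) zv <= e1 / 4.
      by case: h => h; [left|right]; exact: le_trans h e4.
    by move=> q /(_ q); move: e10; lra_goal.
  - by rewrite /P /Q !xdD !xdZ xdN xG xd_et -xzuv x0 !mulr0 oppr0 !addr0 oppr0.
apply: (@interior_contradiction R n K T H B u v j zu zv P Q k' 1 M (e1 / 4) uc co uu vv su sv
    uM vM bzu bzv xneg (esym xzuv) tu tv ltr01 k'0).
- by lra_on e10.
- by move=> z w; apply: joint; left.
- by move=> r h; apply: gap; [left|left].
Qed.

End doubling_estimate.

Lemma small_pos {R : realType} (s : seq R) : all (fun x => 0 < x) s ->
  exists2 r : R, 0 < r & all (fun x => r <= x) s.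
Proof.
elim: s => [|x s ih] /=; first by exists 1.
move=> /andP[x0 /ih[r r0 hr]]; exists (Num.min x r); first by rewrite lt_min x0.
rewrite ge_min lexx /=; apply: sub_all hr => y; apply: le_trans.
by rewrite ge_min lexx orbT.
Qed.

(** * Half-relaxed limits *)

Section relaxed_limit.
Context {R : realType} {n K : nat} (T : R).
Notation st := (spacetime R n).
Notation branch := (cylinder T (@halfspace R n)).
Implicit Types (z w P Q : st) (u v : 'I_K -> st -> R) (U : R -> 'I_K -> st -> R).
Implicit Types H : 'I_K -> 'rV[R]_n.+1 -> R -> 'rV[R]_n.+1 -> R -> R.

(** The error d * |z - z0| admits every C^1 test function through its gradient at
    the point of contact. *)
Definition ssub H (B : R) u :=
  forall P (r : 'I_K -> R) i z0, branch z0 -> 0 < z0.2 ->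
  (forall d : R, 0 < d -> exists2 rho : R, 0 < rho & forall j z,
     (j = i \/ xd z0 = 0) -> branch z -> `|z - z0| < rho ->
     u j z <= u i z0 + ip P (z - z0) + r j * xd (z - z0) + d * `|z - z0|) ->
  (xd z0 = 0 /\ \sum_j (xd P + r j) <= B) \/
  exists2 j, (j = i \/ xd z0 = 0) & op H j (P + r j *: ed) (u j z0) z0 <= 0.

Lemma ssub_psub H B u : ssub H B u -> psub T H B 0 u.
Proof.
move=> su k P r i z0 k0 bz0 t0 [rho rho0 h]; rewrite mul0r; apply: su => // d d0.
have c0 : 0 < k * n.+2%:R + 1 by rewrite ltr_wpDl// mulr_ge0.
exists (Num.min rho (d / (k * n.+2%:R + 1))); first by rewrite lt_min rho0 divr_gt0.
move=> j z aj bz; rewrite lt_min => /andP[zr zd]; apply: le_trans (h j z aj bz zr) _.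
rewrite lerD2l; have zn := normr_ge0 (z - z0).
have e1 : k * sq (z - z0) <= k * (n.+2%:R * `|z - z0| ^+ 2) by rewrite ler_wpM2l// sq_le.
have e2 : (k * n.+2%:R + 1) * `|z - z0| <= d by rewrite mulrC -ler_pdivlMr// ltW.
have e3 := ler_wpM2r zn e2.
apply: le_trans e1 _; move: e3 zn; rewrite expr2 => e3 zn.
by have := mulr_ge0 zn zn; move: e3; lra_goal.
Qed.

Definition eventually_le U i z (y : R) := exists2 rho : R, 0 < rho &
  forall eps j w, 0 < eps -> eps < rho -> (j = i \/ xd z = 0) -> branch w ->
    `|w - z| < rho -> U eps j w <= y.

(** The upper half-relaxed limit of a family on the glued space. *)
Definition rlim U i z : R := inf [set y | eventually_le U i z y].

Section bounded_family.
Context (U : R -> 'I_K -> st -> R) (M eps0 : R).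
Context (eps00 : 0 < eps0).
Context (UM : forall eps i z, 0 < eps -> eps < eps0 -> branch z -> `|U eps i z| <= M).

Lemma eventually_le_bound i z : eventually_le U i z M.
Proof.
exists eps0 => // eps j w e1 e2 _ bw _.
exact: le_trans (ler_norm _) (UM _ e1 e2 bw).
Qed.

Lemma eventually_ge i z y : branch z -> eventually_le U i z y -> - M <= y.
Proof.
move=> bz [rho rho0 h].
have m0 : 0 < Num.min rho eps0 / 2 by rewrite divr_gt0// lt_min rho0.
have [m1 m2] : Num.min rho eps0 / 2 < rho /\ Num.min rho eps0 / 2 < eps0.
  have q1 : Num.min rho eps0 <= rho by rewrite ge_min lexx.
  have q2 : Num.min rho eps0 <= eps0 by rewrite ge_min lexx orbT.
  by move: m0; move: (Num.min _ _) q1 q2 => m q1 q2 m0; split; lra.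
apply: le_trans (h _ i z m0 m1 (or_introl erefl) bz _); last by rewrite subrr normr0.
by have := UM i m0 m2 bz; rewrite ler_norml => /andP[].
Qed.

Lemma rlim_has_inf i z : branch z -> has_inf [set y | eventually_le U i z y].
Proof.
move=> bz; split; first by exists M; exact: eventually_le_bound.
by exists (- M) => y; exact: eventually_ge.
Qed.

Lemma rlim_upper i z e : branch z -> 0 < e -> eventually_le U i z (rlim U i z + e).
Proof.
move=> bz e0; have [y [rho rho0 h] ye] := inf_adherent e0 (rlim_has_inf i bz).
by exists rho => // eps j w e1 e2 aj bw wz; apply: le_trans (h _ _ _ e1 e2 aj bw wz) (ltW ye).
Qed.

Lemma rlim_freq i z e rho : branch z -> 0 < e -> 0 < rho ->
  exists eps j w, [/\ 0 < eps < rho, j = i \/ xd z = 0, branch w, `|w - z| < rho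
    & rlim U i z - e < U eps j w].
Proof.
move=> bz e0 rho0; apply: contrapT => no.
have : eventually_le U i z (rlim U i z - e).
  exists rho => // eps j w e1 e2 aj bw wz; rewrite leNgt; apply/negP => lt; apply: no.
  by exists eps, j, w; split => //; rewrite e1.
move=> /(ge_inf (proj2 (rlim_has_inf i bz))); rewrite -/(rlim U i z).
by move: e0; move: (rlim U i z) => x; lra.
Qed.

Lemma rlim_bound i z : branch z -> `|rlim U i z| <= M.
Proof.
move=> bz; rewrite ler_norml; apply/andP; split.
  apply: lb_le_inf; first by exists M; exact: eventually_le_bound.
  by move=> y; exact: eventually_ge.
by apply: ge_inf; [exact: (proj2 (rlim_has_inf i bz))|exact: eventually_le_bound].
Qed.

Lemma rlim_usc : jusc T (rlim U).
Proof.
move=> i z0 bz0 e e0; have e2 : 0 < e / 2 by lra.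
have [rho rho0 h] := rlim_upper i bz0 e2.
have [s [s0 s1 s2]] : exists s : R, [/\ 0 < s, s <= rho / 2 & xd z0 != 0 -> s <= `|xd z0|].
  have [E|E] := eqVneq (xd z0) 0; first by exists (rho / 2); split => //; lra.
  exists (Num.min (rho / 2) `|xd z0|); rewrite lt_min normr_gt0 E ge_min lexx.
  by split => //; [lra|rewrite ge_min lexx orbT].
exists s => // j z aj bz zz0; apply: (@le_lt_trans _ _ (rlim U i z0 + e / 2)); last by rewrite ltrD2l; lra.
apply: ge_inf; first exact: (proj2 (rlim_has_inf j bz)).
exists (rho / 2) => [|eps j' w p1 p2 aj' bw wz]; first lra.
apply: h => //; first by lra.
  case: aj' => [->//|xz]; right; apply/eqP; apply: contrapT => /negP/s2 s3.
  have := lt_le_trans (le_lt_trans (xd_le _) zz0) s3.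
  by rewrite xdB xz sub0r normrN ltxx.
by have := ler_normD (w - z) (z - z0); rewrite subrKA; lra.
Qed.

(** On the ball of radius rho the functions U eps are compared with a paraboloid
    of opening k = 2 * d / rho. On the sphere its gain k * rho ^+ 2 exceeds the
    error d * rho of the superdifferential, so the contact points stay inside;
    there the gradient is off by at most 4 * d, and the viscous term vanishes
    as eps goes to 0 with rho fixed. *)
Lemma rlim_stability H B c0 : (forall i, unif_cont_bounded T H i) -> 0 <= c0 ->
  (forall eps, 0 < eps -> jusc T (U eps)) ->
  (forall eps, 0 < eps -> psub T H B (c0 * eps) (U eps)) -> ssub H B (rlim U).
Proof.
move=> uc c00 Uu Us P r i z0 bz0 t0 touch.
pose adm (j : 'I_K) := j = i \/ xd z0 = 0.
have agree j : adm j -> rlim U j z0 = rlim U i z0.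
  by case=> [->//|x0]; exact: (jusc_agree _ _ rlim_usc bz0 x0).
apply: contrapT => /not_orP[nS nop].
have [a a0 ha] : exists2 a : R, 0 < a & forall j, adm j -> forall P' (s : R) z, branch z ->
    `|P' - (P + r j *: ed)| < a -> `|s - rlim U i z0| < a -> `|z - z0| < a ->
    a < op H j P' s z.
  apply: fin_common_small => [j|j a b b0 ba h aj P' s z bz h1 h2 h3]; last first.
    by apply: (le_lt_trans ba); apply: h => //; exact: lt_le_trans ba.
  have [aj|naj] := pselect (adm j); last by exists 1 => // /naj.
  have pos : 0 < op H j (P + r j *: ed) (rlim U j z0) z0.
    by rewrite ltNge; apply/negP => le; apply: nop; exists j.
  have pos2 : 0 < op H j (P + r j *: ed) (rlim U j z0) z0 / 2 by lra.
  have [b b0 hb] := op_cont uc (P + r j *: ed) (rlim U j z0) bz0 pos2.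
  exists (Num.min b (op H j (P + r j *: ed) (rlim U j z0) z0 / 2)); first by rewrite lt_min b0.
  move=> _ P' s z bz; rewrite -(agree j aj) !lt_min => /andP[h1 _] /andP[h2 _] /andP[h3 _].
  rewrite gt_min; apply/orP; right.
  by have := hb j P' s z bz h1 h2 h3; rewrite ltr_norml => /andP[q _]; lra.
have [c [c0' hc]] : exists c : R, 0 <= c /\ forall j z, `|ip P (z - z0) + r j * xd (z - z0)| <= c * `|z - z0|.
  have [c c0' hc] : exists2 c : R, 0 <= c & forall j, `|r j| <= c.
    by apply: fin_common_large => [j|j x y xy h]; [by exists `|r j| |exact: le_trans xy].
  exists (n.+2%:R * `|P| + c); split => [|j z]; first by rewrite addr_ge0// mulr_ge0.
  apply: le_trans (ler_normD _ _) _; rewrite mulrDl; apply: lerD.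
    by rewrite -mulrA ip_le.
  by rewrite normrM; apply: ler_pM => //; exact: xd_le.
have [d dE] : exists d, d = a / 8 by eexists.
have d0 : 0 < d by rewrite dE; lra.
have [rt rt0 hrt] := touch d d0.
have a4 : 0 < a / 4 by lra.
have [re re0 hre] := rlim_upper i bz0 a4.
have [rho [rho0 [r1 r2] [r3 r4] [r5 r6]]] : exists rho : R, [/\ 0 < rho,
    rho < rt /\ rho < re, rho <= a / 2 /\ rho <= z0.2, c * rho <= a / 4 &
    xd z0 != 0 -> rho <= `|xd z0|].
  have c1 : 0 < c + 1 by lra.
  have [s [s0 s1]] : exists s : R, 0 < s /\ (xd z0 != 0 -> s <= `|xd z0|).
    by have [E|E] := eqVneq (xd z0) 0; [exists 1|exists `|xd z0|; rewrite normr_gt0].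
  have [|rho rho0] := @small_pos R [:: rt / 2; re / 2; a / 2; z0.2; a / 4 / (c + 1); s].
    by rewrite /= t0 s0 !divr_gt0.
  move=> /= /and5P[q1 q2 q3 q4 /and3P[q5 q6 _]].
  exists rho; split => //; [split; lra| |by move=> /s1; exact: le_trans].
  apply: (@le_trans _ _ ((c + 1) * (a / 4 / (c + 1)))); last by rewrite mulrC divfK// gt_eqF.
  by apply: ler_pM => //; [exact: ltW|rewrite lerDl].
pose k := 2 * d / rho.
have k0 : 0 < k by rewrite divr_gt0// mulr_gt0.
have krho : k * rho = 2 * d by rewrite /k divfK// gt_eqF.
clearbody k.
pose phi j z := 0 + ip (P + r j *: ed) (z - z0) + k * sq (z - z0) + 0 * xd z + 0 * xd z ^+ 2.
have phiE j z : phi j z = ip P (z - z0) + r j * xd (z - z0) + k * sq (z - z0).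
  by rewrite /phi ipDl ipZl ip_ed; ring.
have cphi j : continuous (phi j) by exact: quad_continuous.
have cA := @compact_branch_ball R n T z0 rho.
set A := [set z | _] in cA.
have Ab : A `<=` branch by move=> z [].
have dr0 : 0 < d * rho by rewrite mulr_gt0.
have dr8 : 0 < d * rho / 8 by lra.
have [|h0 h00 hh] := @near_compact R st A (fun h z => `|z - z0| = rho ->
    forall eps j, 0 < eps -> eps < h -> adm j ->
    U eps j z - phi j z <= rlim U i z0 - d * rho / 2) cA.
  move=> x [bx xr]; have [E|nE] := eqVneq `|x - z0| rho; last first.
    have lt : `|x - z0| < rho by rewrite lt_neqAle nE.
    exists (rho - `|x - z0|) => [|h y _ _ _ yx E]; first lra.
    by have := ler_normD (y - x) (x - z0); rewrite subrKA E; move: yx; lra_goal.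
  have [q q0 hq] : exists2 q : R, 0 < q & forall j, adm j -> forall eps y, 0 < eps -> eps < q ->
      branch y -> `|y - x| < q -> U eps j y - phi j y <= rlim U i z0 - d * rho / 2.
    apply: fin_common_small => [j|j q q' q'0 q'q h aj eps y e1 e2 bY yx]; last first.
      by apply: h => //; exact: lt_le_trans q'q.
    have [aj|naj] := pselect (adm j); last by exists 1 => // /naj.
    have [q1 q10 hq1] := rlim_upper j bx dr8.
    have [q2 q20 hq2] := (continuous_distP _).1 (cphi j) x _ dr8.
    exists (Num.min q1 q2); first by rewrite lt_min q10.
    move=> _ eps y e1; rewrite !lt_min => /andP[e2 _] bY /andP[yx1 yx2].
    have h1 := hq1 eps j y e1 e2 (or_introl erefl) bY yx1.
    have := hq2 y yx2; rewrite ltr_norml => /andP[h2 _].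
    have := hrt j x aj bx; rewrite E => /(_ r1) h3.
    have h4 : k * rho ^+ 2 <= k * sq (x - z0) by rewrite ler_pM2l// -E norm_sq.
    move: h1 h2 h3 h4 dr0; rewrite !phiE expr2 mulrA krho; lra_goal.
  exists q => // h y hp hq' [bY _] yx yE eps j e1 e2 aj.
  by apply: hq => //; exact: lt_trans hq'.
have [ew [q0 q1 q2 q3]] : exists ew : R, [/\ 0 < ew, ew <= d * rho / 8, ew <= a / 4 & True].
  by exists (Num.min (d * rho / 8) (a / 4)); rewrite lt_min dr8 a4 !ge_min !lexx orbT.
have ck0 : 0 < c0 * k + 1 by rewrite ltr_wpDl// mulr_ge0// ltW.
have [|s s0] := @small_pos R [:: rho / 2; re; h0; a / (c0 * k + 1); eps0;
   d * rho / 8 / (c + k * n.+2%:R * rho + 1); a / 8 / (c + k * n.+2%:R * rho + 1)].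
  have c1 : 0 < c + k * n.+2%:R * rho + 1 by rewrite ltr_wpDl// addr_ge0// !mulr_ge0// ltW.
  by rewrite /= re0 h00 eps00 !divr_gt0.
move=> /= /and5P[s1 s2 s3 s4 /and4P[s5 s6 s7 _]].
have [eps [jw [w [/andP[e1 e2] ajw bw wz hw]]]] := rlim_freq i bz0 q0 s0.
have wrho : `|w - z0| <= rho by lra_on wz s1 rho0.
have [phiw phiw'] : phi jw w <= d * rho / 8 /\ phi jw w <= a / 8.
  have c1 : 0 < c + k * n.+2%:R * rho + 1 by rewrite ltr_wpDl// addr_ge0// !mulr_ge0// ltW.
  have g1 := hc jw w; have g2 := sq_le (w - z0); have wn := normr_ge0 (w - z0).
  have g3 : `|w - z0| ^+ 2 <= rho * `|w - z0| by rewrite expr2 ler_wpM2r.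
  have g4 : k * sq (w - z0) <= k * (n.+2%:R * (rho * `|w - z0|)).
    rewrite ler_pM2l//; apply: le_trans g2 _; exact: ler_wpM2l.
  have g5 : (c + k * n.+2%:R * rho + 1) * `|w - z0| <= d * rho / 8.
    by rewrite mulrC -ler_pdivlMr//; apply: le_trans s6; exact: ltW.
  have g6 : (c + k * n.+2%:R * rho + 1) * `|w - z0| <= a / 8.
    by rewrite mulrC -ler_pdivlMr//; apply: le_trans s7; exact: ltW.
  move: g1; rewrite ler_norml phiE => /andP[_ g1].
  by split; [move: g1 g4 g5 wn|move: g1 g4 g6 wn]; lra_goal.
have [j1 [z1 [aj1 [bz1 z1r] hmax]]] := @glued_max R n K T (U eps) phi adm A i w
  (Uu _ e1) cphi cA Ab (or_introl erefl) (conj bw wrho).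
have val1 := hmax jw w ajw (conj bw wrho).
have z1lt : `|z1 - z0| < rho.
  rewrite lt_neqAle z1r andbT; apply/eqP => E.
  have eh0 : eps < h0 := lt_le_trans e2 s3.
  have h4 : 0 < (eps + h0) / 2 by clear - eps00 UM e1 h00; lra.
  have h5 : (eps + h0) / 2 < h0 by clear - eps00 UM eh0; lra.
  have h6 : eps < (eps + h0) / 2 by clear - eps00 UM eh0; lra.
  have := hh _ z1 h4 h5 (conj bz1 z1r) E eps j1 e1 h6 aj1.
  by move: val1 phiw hw q1 dr0; clear - eps00 UM; lra.
have L1 : xd z1 = 0 -> xd z0 = 0.
  move=> xz1; apply/eqP; apply: contrapT => /negP/r6 q.
  have := lt_le_trans (le_lt_trans (xd_le _) z1lt) q.
  by rewrite xdB xz1 sub0r normrN ltxx.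
have adm1 j : j = j1 \/ xd z1 = 0 -> adm j.
  by case=> [->//|/L1 x0]; right.
have t1 : 0 < z1.2.
  have := le_lt_trans (time_le (z1 - z0)) z1lt; rewrite /= ltr_norml => /andP[q _]; clear - eps00 UM q r4; lra.
have vhi : U eps j1 z1 <= rlim U i z0 + a / 4.
  apply: hre => //; first exact: lt_le_trans e2 s2.
  exact: lt_trans z1lt r2.
have vlo : rlim U i z0 - a / 2 - a / 8 <= U eps j1 z1.
  have := hc j1 z1; rewrite ler_norml => /andP[g1 _].
  have g2 : c * `|z1 - z0| <= c * rho by rewrite ler_wpM2l.
  have g3 : 0 <= k * sq (z1 - z0) by rewrite mulr_ge0 ?sq_ge0// ltW.
  by move: val1 phiw' hw q2 g1 g2 g3 r5; rewrite (phiE j1 z1); lra.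
have a1 : `|U eps j1 z1 - rlim U i z0| < a.
  by rewrite ltr_norml; apply/andP; split; clear - eps00 UM vhi vlo a0; lra.
have P1 : `|(2 * k) *: (z1 - z0) : st| < a.
  rewrite normrZ ger0_norm; last by rewrite mulr_ge0// ltW.
  have : 2 * k * `|z1 - z0| <= 2 * k * rho by rewrite ler_wpM2l// mulr_ge0// ltW.
  by move: krho dE a0; clear - eps00 UM; lra.
have z1a : `|z1 - z0| < a by move: z1lt r3 a0; clear - eps00 UM; lra.
case: (@psub_at R n K T H B (c0 * eps) (U eps) k P r j1 z0 z1 (Us _ e1) (ltW k0) bz1 t1).
- exists (rho - `|z1 - z0|) => [|j z aj bz zz]; first by move: z1lt; clear - eps00 UM; lra.
  have Az : A z.
    by split => //; have := ler_normD (z - z1) (z1 - z0); rewrite subrKA; move: zz; clear - eps00 UM; lra.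
  have := hmax j z (adm1 _ aj) Az; rewrite !phiE !xdB.
  have : r j * xd z0 = r j1 * xd z0 by case: aj => [->//|/L1->]; rewrite !mulr0.
  by clear - eps00 UM; lra.
- move=> [xz1 le]; apply: nS; split; first exact: L1.
  by move: le; under eq_bigr do rewrite xdB xz1 (L1 xz1) subrr mulr0 addr0.
- move=> [j aj]; apply/negP; rewrite -ltNge; apply: (@lt_trans _ _ a).
    have e3 : eps * (c0 * k + 1) < a by rewrite -ltr_pdivlMr//; exact: lt_le_trans e2 s4.
    by move: e3 e1; rewrite mulrDr; lra.
  apply: ha => //; first exact: adm1.
    by rewrite [P + _ + _]addrAC [_ + (2 * k) *: _]addrC addrK.
  case: aj => [->//|xz1].
  by rewrite (jusc_agree j j1 (Uu _ e1) bz1 xz1).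
Qed.

End bounded_family.
End relaxed_limit.

(** * Barriers and a priori bounds *)

Section barriers.
Context {R : realType} {n K : nat} (T : R).
Notation st := (spacetime R n).
Notation branch := (cylinder T (@halfspace R n)).
Implicit Types (z w P Q : st) (u v : 'I_K -> st -> R).
Implicit Types H : 'I_K -> 'rV[R]_n.+1 -> R -> 'rV[R]_n.+1 -> R -> R.

(** A smooth substitute for the squared distance to z0 in branch i0 across
    the junction: on another branch the last coordinates count
    as xd z0 ^+ 2 + xd z ^+ 2. Its derivatives in xd at the junction are
    nonnegative, so that it only helps the Kirchhoff condition. *)
Definition gdist (i0 : 'I_K) z0 j z : R :=
  sq (z - z0) + (if j == i0 then 0 else 2 * xd z0 * xd z).

Lemma gdist_sq i0 z0 j z : branch z0 -> branch z -> sq (z - z0) <= gdist i0 z0 j z.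
Proof.
move=> [h0 _] [h1 _]; rewrite /gdist lerDl; case: eqP => // _.
by rewrite -mulrA mulr_ge0// mulr_le0.
Qed.

Lemma gdist_self i0 z0 : gdist i0 z0 i0 z0 = 0.
Proof. by rewrite /gdist eqxx subrr sq0 addr0. Qed.

Lemma gdist_other i0 z0 j z : j != i0 -> xd z0 ^+ 2 + xd z ^+ 2 <= gdist i0 z0 j z.
Proof.
move=> /negPf ji; rewrite /gdist ji; have := xd_sq (z - z0); rewrite xdB.
have -> : (xd z - xd z0) ^+ 2 = xd z ^+ 2 + xd z0 ^+ 2 - 2 * xd z0 * xd z by ring.
by lra_goal.
Qed.

Lemma gdist_low i0 z0 j z (k m : R) : branch z0 -> branch z -> 0 < k ->
  k / 2 * gdist i0 z0 j z - m ^+ 2 / (2 * k) <=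
  k * gdist i0 z0 j z + m * (xd z - xd z0).
Proof.
move=> bz0 bz k0; have := le_trans (xd_sq (z - z0)) (gdist_sq i0 j bz0 bz); rewrite xdB.
set d := gdist _ _ _ _; set x := xd z - xd z0 => h.
have h1 : 0 <= k / 2 * (x + m / k) ^+ 2 by rewrite mulr_ge0 ?sqr_ge0// divr_ge0 ?ltW.
have h2 : k / 2 * (x + m / k) ^+ 2 = k / 2 * x ^+ 2 + m * x + m ^+ 2 / (2 * k).
  by field; rewrite gt_eqF.
have h3 : k / 2 * x ^+ 2 <= k / 2 * d by rewrite ler_wpM2l// divr_ge0 ?ltW.
by lra_on h1 h2 h3.
Qed.

(** As K * m > B, and the derivatives of gdist in xd add nonnegative terms, the
    Kirchhoff alternative fails for the barrier. The maximum of u minus the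
    barrier therefore carries one of the equations, unless it is at time 0. *)
Lemma barrier_principle H B eps u (M k m kc cm : R) (c c1 : R -> R) i0 z0 :
  jusc T u -> psub T H B eps u -> (forall i z, branch z -> `|u i z| <= M) ->
  branch z0 -> 0 < k -> 0 <= m -> B < K%:R * m -> 0 <= kc ->
  continuous c -> (forall t, 0 <= t <= T -> cm <= c t) ->
  (forall t t1, 0 <= t <= T -> 0 <= t1 <= T ->
     c t <= c t1 + c1 t1 * (t - t1) + kc * (t - t1) ^+ 2) ->
  (exists j z, branch z /\
     c z.2 + k * gdist i0 z0 j z + m * (xd z - xd z0) < u j z) ->
  exists j z, [/\ branch z,
    c z.2 + k * gdist i0 z0 j z + m * (xd z - xd z0) < u j z &
    z.2 = 0 \/ exists p, `|p| <= 2 * k * (1 + gdist i0 z0 j z) + m /\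
      c1 z.2 + 2 * k * (z.2 - z0.2) + H j p (u j z) z.1 z.2 <= eps * (k + kc)].
Proof.
move=> uu su uM bz0 k0 m0 Bm kc0 cc ccm ctan [js [zs [bzs lts]]].
have M0 : 0 <= M := le_trans (normr_ge0 _) (uM i0 z0 bz0).
pose sl j := (m + 2 * k * xd z0) + (if j == i0 then m - (m + 2 * k * xd z0) else 0).
pose phi j z := c z.2 + (- (m * xd z0) + ip 0 (z - z0) + k * sq (z - z0) + sl j * xd z + 0 * xd z ^+ 2).
have phiE j z : phi j z = c z.2 + k * gdist i0 z0 j z + m * (xd z - xd z0).
  by rewrite /phi /sl /gdist ip0l; case: eqP => _; ring.
have cphi j : continuous (phi j).
  move=> z; apply: cvgD; last exact: quad_continuous.
  by apply: (@continuous_comp _ _ _ (fun z : st => z.2) c); [exact: time_continuous|exact: cc].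
have [r rE] : exists r, r = 1 + 2 * (M + `|cm| + m ^+ 2 / (2 * k)) / k by eexists.
have q0 : 0 <= m ^+ 2 / (2 * k) by rewrite divr_ge0 ?sqr_ge0// mulr_ge0// ltW.
have r1 : 1 <= r by rewrite rE lerDl divr_ge0 ?(ltW k0)// mulr_ge0// !addr_ge0.
have far j z : branch z -> r < `|z - z0| -> u j z - phi j z < 0.
  move=> bz zr; rewrite phiE.
  have h1 := gdist_low i0 j m bz0 bz k0; have h2 := gdist_sq i0 j bz0 bz.
  have h3 : r < gdist i0 z0 j z.
    apply: lt_le_trans h2; apply: lt_le_trans (norm_sq _).
    by apply: (lt_le_trans zr); rewrite expr2 ler_peMl//; lra_on zr r1.
  have h4 : k / 2 * r < k / 2 * gdist i0 z0 j z by rewrite ltr_pM2l// divr_gt0.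
  have h5 : k / 2 * r = k / 2 + (M + `|cm| + m ^+ 2 / (2 * k)).
    by rewrite rE; field; rewrite gt_eqF.
  have h6 : cm <= c z.2 by apply: ccm; case: bz.
  have h7 := uM j z bz; have h8 := ler_norm (- cm); rewrite normrN in h8.
  by move: h7; rewrite ler_norml => /andP[_ h7]; lra_on h1 h4 h5 h6 h7 h8 k0.
have lts' : 0 < u js zs - phi js zs by rewrite phiE subr_gt0.
have rs : `|zs - z0| <= r.
  by rewrite leNgt; apply/negP => /(far js _ bzs); lra_on lts'.
have Ab : [set z | branch z /\ `|z - z0| <= r] `<=` branch by move=> z [].
have [j1 [z1 [_ [bz1 z1r] hmax]]] := @glued_max R n K T u phi (fun _ => True) _ js zs
  uu cphi (@compact_branch_ball R n T z0 r) Ab I (conj bzs rs).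
have pos : 0 < u j1 z1 - phi j1 z1 := lt_le_trans lts' (hmax js zs I (conj bzs rs)).
have gmax j z : branch z -> u j z - phi j z <= u j1 z1 - phi j1 z1.
  move=> bz; have [zr|zr] := leP `|z - z0| r; first exact: hmax.
  by apply/ltW/(lt_trans (far j z bz zr)).
have [bx1 bt1] := bz1; have /andP[t10 t1T] := bt1.
have [z10|/eqP nz10] := eqVneq z1.2 0.
  by exists j1, z1; split => //; [rewrite -phiE -subr_gt0|left].
have {}t10 : 0 < z1.2 by rewrite lt_neqAle t10 andbT eq_sym; apply/eqP.
have kk : 0 <= k + kc by rewrite addr_ge0// ltW.
case: (su (k + kc) ((2 * k) *: (z1 - z0) + c1 z1.2 *: et) sl j1 z1 kk bz1 t10).
- exists 1 => // j z aj bz _; have := gmax j z bz; rewrite /phi !ip0l.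
  have [_ bt] := bz; have := ctan z.2 z1.2 bt bt1.
  have e1 : kc * (z.2 - z1.2) ^+ 2 <= kc * sq (z - z1) by apply: ler_wpM2l => //; exact: (time_sq (z - z1)).
  rewrite (sq_recenter z z0 z1) !ipDl !ipZl ip_et.
  have e2 : sl j * xd z - sl j1 * xd z1 = sl j * xd (z - z1).
    by case: aj => [->|x1]; rewrite xdB ?x1; ring.
  have -> : (z - z1).2 = z.2 - z1.2 by [].
  rewrite -e2 mulrDl; move: e1; lra_goal.
- move=> [x1]; rewrite xdD !xdZ xd_et mulr0 addr0 xdB x1 sub0r sum_one_slope => h.
  have : 0 <= 2 * k * - xd z0.
    by rewrite mulr_ge0 ?mulr_ge0 ?(ltW k0)// oppr_ge0; case: bz0.
  by move: h Bm; lra_goal.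
- move=> [j aj hop].
  have gE : gdist i0 z0 j z1 = gdist i0 z0 j1 z1.
    by case: aj => [->//|x1]; rewrite /gdist x1 mulr0; case: eqP; case: eqP.
  have aE : u j z1 = u j1 z1.
    by case: aj => [->//|x1]; exact: (jusc_agree _ _ uu bz1 x1).
  exists j, z1; split => //; first by rewrite aE gE -phiE -subr_gt0.
  right; exists ((2 * k) *: (z1 - z0) + c1 z1.2 *: et + sl j *: ed).1; split; last first.
    move: hop; rewrite /op; apply: le_trans; rewrite lerD2r le_eqVlt; apply/orP; left; apply/eqP.
    by rewrite /= /GRing.scale /=; ring.
  have g0 : 0 <= gdist i0 z0 j z1 := le_trans (sq_ge0 _) (gdist_sq i0 j bz0 bz1).
  have ab (y g : R) : y ^+ 2 <= g -> `|2 * k * y| <= 2 * k * (1 + g).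
    move=> yg; have k2 : 0 <= 2 * k by rewrite mulr_ge0// ltW.
    rewrite normrM (ger0_norm k2); apply: ler_wpM2l => //.
    have := sqr_ge0 (`|y| - 1); rewrite sqrrB1 real_normK ?num_real//.
    by have := normr_ge0 y; move: yg; lra_goal.
  apply: rV_norm_le => [|l]; first by apply: addr_ge0 => //; apply: mulr_ge0; [rewrite mulr_ge0// ltW|exact: addr_ge0].
  have [->|lm] := eqVneq l ord_max.
    rewrite -/(xd _) xd_shift_ed xdD !xdZ xd_et mulr0 addr0.
    rewrite (_ : _ + sl j = 2 * k * (if j == i0 then xd z1 - xd z0 else xd z1) + m); last first.
      by rewrite /sl xdB; case: eqP => _; ring.
    apply: le_trans (ler_normD _ _) _; rewrite (ger0_norm m0) lerD2r; apply: ab.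
    case: ifP => [ji|/negbT ji].
      by rewrite -xdB; apply: le_trans (xd_sq _) _; exact: gdist_sq.
    by apply: le_trans (gdist_other z0 z1 ji); rewrite lerDr sqr_ge0.
  rewrite [X in `|X|](_ : _ = 2 * k * (z1 - z0).1 ord0 l).
    apply: le_trans (ab _ (gdist i0 z0 j z1) _) _; last by rewrite lerDl.
    by apply: le_trans (coord_sq _ _) _; exact: gdist_sq.
  by rewrite /= !mxE (negPf lm) andbF !mulr0 !addr0.
Qed.

End barriers.

Section a_priori_bounds.
Context {R : realType} {n K : nat} (T : R).
Notation st := (spacetime R n).
Notation branch := (cylinder T (@halfspace R n)).
Implicit Types (z w P Q : st) (u v : 'I_K -> st -> R).
Implicit Types H : 'I_K -> 'rV[R]_n.+1 -> R -> 'rV[R]_n.+1 -> R -> R.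

Lemma midpoint_norm (V : normedModType R) (x y : V) r : `|x| <= r -> `|y| <= r ->
  `|2^-1 *: (x + y)| <= r.
Proof.
move=> hx hy; rewrite normrZ ger0_norm ?invr_ge0//.
by have := ler_normD x y; lra_on hx hy.
Qed.

Lemma midpoint_dist (V : normedModType R) (x y : V) (a : R) : `|x - y| < 2 * a ->
  `|x - 2^-1 *: (x + y)| < a /\ `|2^-1 *: (x + y) - y| < a.
Proof.
move=> h; have h2 : `|2^-1 *: (x - y)| < a.
  by rewrite normrZ ger0_norm ?invr_ge0//; lra_on h.
have half : (2^-1 + 2^-1 : R) = 1 by field.
have e1 : x = 2^-1 *: x + 2^-1 *: x by rewrite -scalerDl half scale1r.
have e2 : y = 2^-1 *: y + 2^-1 *: y by rewrite -scalerDl half scale1r.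
split.
  by rewrite {1}e1 scalerDr opprD addrACA subrr add0r -scalerBr.
by rewrite {2}e2 scalerDr opprD addrACA subrr addr0 -scalerBr.
Qed.

(** Uniform continuity is iterated along midpoints; the oscillation is bounded
    only over bounded distances in x, as H might be unbounded there. *)
Lemma hamiltonian_oscillation H (r D : R) : (forall i, unif_cont_bounded T H i) ->
  exists2 C : R, 0 <= C & forall j p1 p2 s1 s2 z1 z2, `|p1| <= r -> `|p2| <= r ->
    `|s1| <= r -> `|s2| <= r -> branch z1 -> branch z2 -> `|z1.1 - z2.1| <= D ->
    `|H j p1 s1 z1.1 z1.2 - H j p2 s2 z2.1 z2.2| <= C.
Proof.
move=> uc; apply: fin_common_large => [j|j x y xy h p1 p2 s1 s2 z1 z2 *]; last first.
  by apply: le_trans xy; exact: h.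
have r0 : 0 < `|r| + 1 by rewrite ltr_wpDl.
have [a a0 ha] := uc j _ _ r0 ltr01.
have key N : forall p1 p2 s1 s2 z1 z2, `|p1| <= `|r| + 1 -> `|p2| <= `|r| + 1 ->
    `|s1| <= `|r| + 1 -> `|s2| <= `|r| + 1 -> branch z1 -> branch z2 ->
    `|p1 - p2| < 2 ^+ N * a -> `|s1 - s2| < 2 ^+ N * a -> `|z1 - z2| < 2 ^+ N * a ->
    `|H j p1 s1 z1.1 z1.2 - H j p2 s2 z2.1 z2.2| <= 2 ^+ N.
  elim: N => [|N ih] p1 p2 s1 s2 z1 z2 hp1 hp2 hs1 hs2 b1 b2.
    rewrite expr0 mul1r => dp ds dz; have [[x1 t1] [x2 t2]] := (b1, b2).
    apply/ltW/ha => //; first exact: le_lt_trans (space_le _) dz.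
    exact: le_lt_trans (time_le _) dz.
  rewrite exprS -mulrA => /midpoint_dist[dp1 dp2] /(@midpoint_dist R^o)[ds1 ds2] /midpoint_dist[dz1 dz2].
  have b3 : branch (2^-1 *: (z1 + z2)).
    have [[x1 /andP[t1 t1']] [x2 /andP[t2 t2']]] := (b1, b2); split.
      rewrite /halfspace /=; have -> : (2^-1 *: (z1.1 + z2.1)) ord0 ord_max = 2^-1 * (xd z1 + xd z2).
        by rewrite !mxE.
      by have q1 : xd z1 <= 0 := x1; have q2 : xd z2 <= 0 := x2; lra_on q1 q2.
    rewrite /= /GRing.scale /=; apply/andP; split; first by rewrite mulr_ge0 ?invr_ge0 ?addr_ge0.
    by lra_on t1' t2'.
  have i1 := ih _ _ _ _ z1 _ hp1 (midpoint_norm hp1 hp2) hs1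
    (@midpoint_norm R^o _ _ _ hs1 hs2) b1 b3 dp1 ds1 dz1.
  have i2 := ih _ _ _ _ _ z2 (midpoint_norm hp1 hp2) hp2
    (@midpoint_norm R^o _ _ _ hs1 hs2) hs2 b3 b2 dp2 ds2 dz2.
  apply: le_trans (ler_distD (H j (2^-1 *: (p1 + p2)) (2^-1 *: (s1 + s2 : R^o)) (2^-1 *: (z1 + z2)).1 (2^-1 *: (z1 + z2)).2) _ _) _.
  by move: i1 i2; lra_goal.
have [N hN] : exists N, 2 * (`|r| + 1) + `|D| + `|T| < 2 ^+ N * a.
  set x := _ + `|T|; have x0 : 0 <= x / a.
    by rewrite divr_ge0 ?(ltW a0)// !addr_ge0// mulr_ge0// ltW.
  exists (Num.bound (x / a)); rewrite -ltr_pdivrMr//.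
  apply: lt_le_trans (archi_boundP x0) _.
  by rewrite -natrX ler_nat ltnW// ltn_expl.
exists (2 ^+ N) => p1 p2 s1 s2 z1 z2 hp1 hp2 hs1 hs2 b1 b2 dz.
have rr : r <= `|r| + 1 by rewrite (le_trans (ler_norm r))// lerDl.
have dd := ler_norm D; have tt := ler_norm T; have nT := normr_ge0 T; have nD := normr_ge0 D.
apply: key => //; rewrite ?(le_trans _ rr)//.
- by apply: le_lt_trans (ler_normB _ _) _; move: hp1 hp2 hN rr nD nT; lra_goal.
- by apply: le_lt_trans (ler_normB _ _) _; move: hs1 hs2 hN rr nD nT; lra_goal.
rewrite st_normE gt_max; apply/andP; split.
  by apply: le_lt_trans dz _; move: hN dd r0 nT; lra_goal.
have [[_ /andP[q1 q2]] [_ /andP[q3 q4]]] := (b1, b2).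
apply: (@le_lt_trans _ _ `|T|); last by move: hN r0 nD; lra_goal.
by rewrite ler_norml; apply/andP; split; rewrite /=; lra_on q1 q2 q3 q4 tt.
Qed.

(** A bounded sub-solution forces an upper bound on the Hamiltonian: near
    every point a barrier of fixed shape is touched, and there the equation
    holds with a bounded gradient. *)
Lemma hamiltonian_upper_bound H B eps u M m : (forall i, unif_cont_bounded T H i) ->
  0 < T -> 0 <= m -> B < K%:R * m -> jusc T u -> psub T H B eps u ->
  (forall i z, branch z -> `|u i z| <= M) ->
  forall r, exists C, forall j p s z, branch z -> `|p| <= r -> `|s| <= r ->
    H j p s z.1 z.2 <= C.
Proof.
move=> uc T0 m0 Bm uu su uM r.
have [M' M'E] : exists M', M' = `|M| by eexists.
have M'0 : 0 <= M' by rewrite M'E.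
have uM' i z : branch z -> `|u i z| <= M'.
  by move=> bz; apply: le_trans (uM i z bz) _; rewrite M'E ler_norm.
have [k kE] : exists k, k = 8 * (M' + 1) + 2 * m + 1 by eexists.
have k0 : 0 < k by rewrite kE; lra_on m0 M'0.
have [g gE] : exists g, g = m ^+ 2 / (2 * k) by eexists.
have g0 : 0 <= g by rewrite gE divr_ge0 ?sqr_ge0// mulr_ge0// ltW.
have gk : g <= k / 8.
  rewrite gE ler_pdivrMr ?mulr_gt0//.
  have mk : m <= k / 2 by rewrite kE; lra_on M'0 m0.
  have : m ^+ 2 <= (k / 2) ^+ 2 by rewrite ler_sqr ?nnegrE// divr_ge0 ?ltW.
  by rewrite !expr2; lra_goal.
have [A AE] : exists A, A = M' + g by eexists.
have [l lE] : exists l, l = (A + M' + 1) / T by eexists.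
have l0 : 0 <= l by rewrite lE divr_ge0 ?(ltW T0)//; lra_on AE M'0 g0.
have lT : l * T = A + M' + 1 by rewrite lE divfK// gt_eqF.
have [r1 r1E] : exists r1, r1 = `|r| + (4 * k + m) + M' by eexists.
have [C C0 hC] := hamiltonian_oscillation r1 4 uc.
exists (`|eps * k| + l + 2 * k * T + C) => i p s z bz hp hs.
pose z0 : st := (z.1 - 3 *: delta_mx ord0 ord_max, T).
have xz0 : xd z0 = xd z - 3 by rewrite /xd /z0 /= !mxE !eqxx mulr1.
have bz0 : branch z0.
  split; last by rewrite /= lexx ltW.
  by rewrite /halfspace /= -/(xd z0); rewrite -[_ <= _]/(xd z0 <= 0) xz0; case: bz => h _; move: h; rewrite /halfspace /= -/(xd z); lra_goal.
have cc : continuous (fun t : R => A - l * t).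
  by move=> t; apply: cvgB; [exact: cvg_cst|apply: cvgM; [exact: cvg_cst|exact: cvg_id]].
have low t : 0 <= t <= T -> - M' - 1 <= A - l * t.
  move=> /andP[t1 t2]; have := ler_wpM2l l0 t2; rewrite lT; lra_goal.
have tan t t1 : 0 <= t <= T -> 0 <= t1 <= T ->
    A - l * t <= A - l * t1 + - l * (t - t1) + 0 * (t - t1) ^+ 2.
  by move=> _ _; lra_goal.
have start : exists j z, branch z /\
    A - l * z.2 + k * gdist i z0 j z + m * (xd z - xd z0) < u j z.
  exists i, z0; split => //; rewrite gdist_self subrr !mulr0 !addr0 /= lT.
  by have := uM' i z0 bz0; rewrite ler_norml => /andP[q _]; move: q; lra_goal.
have [j [z1 [bz1 lt hz1]]] := barrier_principle uu su uM' bz0 k0 m0 Bm (lexx 0) cc low tan start.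
have um := uM' j z1 bz1; move: um; rewrite ler_norml => /andP[um1 um2].
have gl := gdist_low i j m bz0 bz1 k0; rewrite -gE in gl.
have [_ t1] := bz1; have lo1 := low _ t1.
have D1 : gdist i z0 j z1 < 1.
  rewrite ltNge; apply/negP => D1.
  have : k / 2 * 1 <= k / 2 * gdist i z0 j z1 by rewrite ler_wpM2l// divr_ge0// ltW.
  by move: gl lo1 lt um2 gk kE m0 M'0; lra_goal.
have ji : j = i.
  apply/eqP; apply: contrapT => /negP ji.
  have := gdist_other z0 z1 ji; have := sqr_ge0 (xd z1).
  have : 9 <= xd z0 ^+ 2.
    have x3 : xd z0 <= - 3 by rewrite xz0; case: bz => h _; move: h; rewrite /halfspace /= -/(xd z); lra_goal.
    have : 0 <= (- 3 - xd z0) * (3 - xd z0) by apply: mulr_ge0; move: x3; lra_goal.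
    by rewrite expr2; lra_goal.
  by move: D1; lra_goal.
have D0 : 0 <= gdist i z0 j z1 := le_trans (sq_ge0 _) (gdist_sq i j bz0 bz1).
case: hz1 => [tz|[p1 [hp1 hH]]].
  exfalso; have : 0 <= k / 2 * gdist i z0 j z1 by rewrite mulr_ge0// divr_ge0// ltW.
  by move: gl lt um2; rewrite tz AE; lra_goal.
have zz : `|z1 - z0| <= 1.
  apply: sq_bound => //; rewrite expr1n.
  by apply: le_trans (gdist_sq i j bz0 bz1) _; exact: ltW.
have rn := normr_ge0 r; have rl := ler_norm r.
have : `|H i p s z.1 z.2 - H i p1 (u j z1) z1.1 z1.2| <= C.
  apply: hC => //.
  - by rewrite r1E; move: hp rl M'0 m0 k0; lra_goal.
  - apply: le_trans hp1 _; rewrite r1E.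
    have : 2 * k * (1 + gdist i z0 j z1) <= 2 * k * 2 by rewrite ler_pM2l ?mulr_gt0//; move: D1; lra_goal.
    by move: rn M'0; lra_goal.
  - by rewrite r1E; move: hs rl M'0 m0 k0; lra_goal.
  - by apply: le_trans (uM' j z1 bz1) _; rewrite r1E; move: rn m0 k0; lra_goal.
  have -> : z.1 - z1.1 = - ((z1 - z0).1) + 3 *: delta_mx ord0 ord_max.
    by rewrite /z0 /= opprB [X in X - z1.1 + _](_ : _ = z.1 - 3 *: delta_mx ord0 ord_max)// addrAC subrK.
  apply: le_trans (ler_normD _ _) _; rewrite normrN normrZ (ger0_norm (ler0n _ _)).
  have : `|delta_mx ord0 ord_max : 'rV[R]_n.+1| <= 1.
    by have := space_le (@ed R n); rewrite norm_ed.
  by have := le_trans (space_le _) zz; lra_goal.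
rewrite ler_norml => /andP[_ h1].
have h2 : 2 * k * (T - z1.2) <= 2 * k * T.
  rewrite ler_pM2l ?mulr_gt0//; case/andP: t1; lra_goal.
have h3 := ler_norm (eps * k).
by move: hH h1 h2 h3; rewrite -ji addr0 /=; lra_goal.
Qed.

End a_priori_bounds.

Section uniform_estimates.
Context {R : realType} {n K : nat} (T : R).
Notation st := (spacetime R n).
Notation branch := (cylinder T (@halfspace R n)).
Implicit Types (z w P Q : st) (u v : 'I_K -> st -> R).
Implicit Types H : 'I_K -> 'rV[R]_n.+1 -> R -> 'rV[R]_n.+1 -> R -> R.

(** Where u - S * exp (lam * t) is almost largest, the equation bounds S; the
    viscous term of the barrier is negligible for small viscosities. *)
Lemma uniform_upper_bound H (B m A0 : R) : 0 < T -> 0 <= m -> B < K%:R * m ->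
  (forall i, lipschitz_ut T H i) ->
  (forall r, exists C, forall j p s z, branch z -> `|p| <= r -> `|s| <= r ->
     - C <= H j p s z.1 z.2) ->
  exists A, exists2 eps1 : R, 0 < eps1 & forall u eps, 0 <= eps -> eps < eps1 ->
    jusc T u -> psub T H B eps u ->
    (exists M, forall i z, branch z -> `|u i z| <= M) ->
    (forall j z, branch z -> z.2 = 0 -> u j z <= A0) ->
    forall j z, branch z -> u j z <= A.
Proof.
move=> T0 m0 Bm lip lowH.
have [C C0 hC] := lipschitz_common lip.
have [lam lamE] : exists lam, lam = 2 * C + 1 by eexists.
have lam1 : 1 <= lam by rewrite lamE; lra_on C0.
have lam0 : 0 <= lam by lra_on lam1.
have [E EE] : exists E, E = expR (lam * T) by eexists.
have E1 : 1 <= E by rewrite EE -expR0 ler_expR mulr_ge0// ltW.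
have [k kE] : exists k, k = m ^+ 2 + 1 by eexists.
have k1 : 1 <= k by rewrite kE lerDr sqr_ge0.
have k0 : 0 < k by lra_on k1.
have gk : m ^+ 2 / (2 * k) <= 2^-1.
  by rewrite ler_pdivrMr ?mulr_gt0// mulrA mulVf// mul1r kE lerDl.
have [Cl hCl] := lowH (2 * k * 5 + m).
have [bd bdE] : exists bd, bd = 2 * (2 * k * T + Cl + k + 1) by eexists.
have [S0 S0E] : exists S0, S0 = `|bd| + `|A0| + 2 by eexists.
have S02 : 2 <= S0 by rewrite S0E; have := normr_ge0 bd; have := normr_ge0 A0; lra.
have [q qE] : exists q, q = lam ^+ 2 * E * E by eexists.
have q0 : 0 <= q by rewrite qE !mulr_ge0 ?sqr_ge0//; lra_on E1.
have q20 : 0 < 2 * q + 1 by lra_on q0.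
exists (S0 * E), (2 * q + 1)^-1; first by rewrite invr_gt0.
move=> u eps e0 e1 uu su [M uM] ini j0 z0 bz0; rewrite leNgt; apply/negP => lt0.
pose bad s := exists j z, branch z /\ s * expR (lam * z.2) < u j z.
have expb z : branch z -> 1 <= expR (lam * z.2) <= E.
  move=> [_ /andP[t1 t2]]; rewrite -expR0 EE !ler_expR mulr_ge0//=.
  exact: ler_wpM2l.
have bad0 : bad S0.
  exists j0, z0; split => //; apply: le_lt_trans lt0; apply: ler_wpM2l; first by lra_on S02.
  by case/andP: (expb z0 bz0).
have M0 : 0 <= M := le_trans (normr_ge0 _) (uM j0 z0 bz0).
have badM s : bad s -> s <= M.
  move=> [j [z [bz lt]]]; have [s0|s0] := leP s 0; first exact: le_trans M0.
  apply: (@le_trans _ _ (s * expR (lam * z.2))).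
    by apply: ler_peMr; [exact: ltW|case/andP: (expb z bz)].
  exact: le_trans (ltW lt) (le_trans (ler_norm _) (uM j z bz)).
have [sg sg1 sg2] := exists_sup bad0 badM.
have Ei : 0 < E^-1 by rewrite invr_gt0; lra_on E1.
have [s1 bs1 s1s] := sg2 _ Ei.
have [s [bs sS0 ssg]] : exists s, [/\ bad s, S0 <= s & sg <= s + E^-1].
  have [h|h] := leP S0 s1; first by exists s1; split => //; lra_on s1s.
  by exists S0; split => //; lra_on h s1s.
have Ei1 : E^-1 <= 1 by rewrite invf_le1//; lra_on E1.
have uS j z : branch z -> u j z <= (s + E^-1) * expR (lam * z.2).
  move=> bz; rewrite leNgt; apply/negP => lt.
  have lt' : exists2 d : R, 0 < d & (s + E^-1 + d) * expR (lam * z.2) < u j z.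
    have ep := expR_gt0 (lam * z.2).
    exists ((u j z / expR (lam * z.2) - (s + E^-1)) / 2).
      by rewrite divr_gt0// subr_gt0 ltr_pdivlMr.
    rewrite -ltr_pdivlMr//; have : s + E^-1 < u j z / expR (lam * z.2) by rewrite ltr_pdivlMr.
    by move: (u j z / _) => x; lra.
  case: lt' => d d0 lt'; have : s + E^-1 + d <= sg by apply: sg1; exists j, z.
  by lra_on ssg d0.
case: bs => [is_ [zs [bzs lts]]].
have cc : continuous (fun t : R => s * expR (lam * t)).
  move=> t; apply: cvgM; first exact: cvg_cst.
  apply: (@continuous_comp _ _ _ (fun t : R => lam * t) (@expR R)); last exact: continuous_expR.
  by apply: cvgM; [exact: cvg_cst|exact: cvg_id].
have s0 : 0 < s by lra_on sS0 S02.
have low t : 0 <= t <= T -> 0 <= s * expR (lam * t) by move=> _; rewrite mulr_ge0 ?expR_ge0// ltW.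
have kc0 : 0 <= s * q by rewrite mulr_ge0// ltW.
have tan t t1 : 0 <= t <= T -> 0 <= t1 <= T -> s * expR (lam * t) <=
   s * expR (lam * t1) + s * lam * expR (lam * t1) * (t - t1) + s * q * (t - t1) ^+ 2.
  move=> /andP[h1 h2] /andP[h3 h4].
  have -> : lam * t = lam * t1 + lam * (t - t1) by ring.
  rewrite expRD; have e3 := expR_tangent (lam * (t - t1)).
  have e4 : expR (lam * t1) <= E by rewrite EE ler_expR ler_wpM2l.
  have e5 : expR `|lam * (t - t1)| <= E.
    rewrite EE ler_expR normrM (ger0_norm lam0) ler_wpM2l// ler_norml.
    by apply/andP; split; [lra_on h1 h4|lra_on h2 h3].
  have ep := expR_ge0 (lam * t1).
  have e6 : expR (lam * t1) * ((lam * (t - t1)) ^+ 2 * expR `|lam * (t - t1)|) <= q * (t - t1) ^+ 2.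
    have -> : q * (t - t1) ^+ 2 = E * ((lam * (t - t1)) ^+ 2 * E) by rewrite qE exprMn; ring.
    apply: ler_pM => //; first by rewrite mulr_ge0 ?sqr_ge0 ?expR_ge0.
    by apply: ler_wpM2l => //; exact: sqr_ge0.
  have e7 := ler_wpM2l ep e3.
  have e8 : expR (lam * t1) * expR (lam * (t - t1)) <=
     expR (lam * t1) + lam * expR (lam * t1) * (t - t1) + q * (t - t1) ^+ 2.
    by move: e6 e7; lra_goal.
  by have := ler_wpM2l (ltW s0) e8; lra_goal.
have start : exists j z, branch z /\
    s * expR (lam * z.2) + k * gdist is_ zs j z + m * (xd z - xd zs) < u j z.
  by exists is_, zs; rewrite gdist_self subrr !mulr0 !addr0.
have [j [z [bz lt hz]]] := barrier_principle uu su uM bzs k0 m0 Bm kc0 cc low tan start.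
have gl := gdist_low is_ j m bzs bz k0.
have [eb1 eb2] := andP (expb z bz).
have D0 : 0 <= gdist is_ zs j z := le_trans (sq_ge0 _) (gdist_sq is_ j bzs bz).
have uu1 := uS j z bz.
have Ee : E^-1 * expR (lam * z.2) <= 1 by rewrite mulrC ler_pdivrMr ?mul1r//; lra_on E1.
rewrite mulrDl in uu1.
have kD0 : 0 <= k / 2 * gdist is_ zs j z by rewrite mulr_ge0// divr_ge0// ltW.
have se : s <= s * expR (lam * z.2) by rewrite ler_peMr// ltW.
have D4 : gdist is_ zs j z <= 4.
  have h1 : k / 2 * gdist is_ zs j z <= 2 by lra_on lt gl gk uu1 Ee.
  have h2 : gdist is_ zs j z <= k * gdist is_ zs j z by rewrite ler_peMl.
  by lra_on h1 h2.
case: hz => [tz|[p [hp hH]]].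
  have := ini j z bz tz; have := ler_norm A0; have := normr_ge0 bd.
  by move: lt gl gk kD0 se sS0; rewrite S0E; lra_goal.
have hp' : `|p| <= 2 * k * 5 + m.
  apply: le_trans hp _; rewrite lerD2r; apply: ler_wpM2l; first by rewrite mulr_ge0// ltW.
  by lra_on D4.
have h0 : `|0 : R| <= 2 * k * 5 + m by rewrite normr0 addr_ge0// !mulr_ge0// ltW.
have [hx ht] := bz; have [ht0 ht1] := andP ht.
have low0 := hCl j p 0 z bz hp' h0.
have := hC j p (u j z) 0 z.1 z.2 z.2 hx ht ht.
rewrite !subr0 subrr normr0 addr0 ler_norml => /andP[dH _].
have up : 0 < u j z by lra_on lt gl gk kD0 se s0 S02 sS0.
rewrite (gtr0_norm up) in dH.
have u2 : u j z <= 2 * (s * expR (lam * z.2)).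
  by move: uu1 Ee se sS0 S02; lra_goal.
have Cu : C * u j z <= C * (2 * (s * expR (lam * z.2))) by rewrite ler_wpM2l.
have epsk : eps * k <= k.
  rewrite ler_piMl ?(ltW k0)//; apply: le_trans (ltW e1) _.
  by rewrite invf_le1//; lra_on q0.
have epsq : eps * (s * q) <= s / 2.
  have : eps * (2 * q + 1) <= 1 by rewrite -ler_pdivlMr// mul1r ltW.
  move=> h; have := ler_wpM2l (ltW s0) h; have := mulr_ge0 (ltW s0) e0.
  by lra_goal.
have tk : - (2 * k * T) <= 2 * k * (z.2 - zs.2).
  rewrite -mulrN ler_pM2l ?mulr_gt0//; case: bzs => _ /andP[h1 h2].
  by lra_on h2 ht0.
have := ler_norm bd; have := normr_ge0 A0.
have le1 : s * lam * expR (lam * z.2) = 2 * C * (s * expR (lam * z.2)) + s * expR (lam * z.2).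
  by rewrite lamE; ring.
move: hH; rewrite le1 mulrDr.
by move: low0 dH Cu epsk epsq tk se sS0; rewrite S0E bdE; lra_goal.
Qed.

(** The barrier w0 + e / 2 + C1 * t + k * gdist can only be touched at time 0
    when C1 exceeds the lower bound of H on the gradients involved, and this
    choice is good for all small viscosities at once. *)
Lemma initial_upper_bound H (B m M : R) (w0 : 'I_K -> 'rV[R]_n.+1 -> R) : 0 < T -> 0 <= m -> B < K%:R * m ->
  (forall r, exists C, forall j p s z, branch z -> `|p| <= r -> `|s| <= r ->
     - C <= H j p s z.1 z.2) ->
  @BUC_space R n K w0 ->
  forall e : R, 0 < e -> exists2 tau : R, 0 < tau & forall u eps, 0 <= eps -> eps <= 1 ->
    jusc T u -> psub T H B eps u ->
    (forall i z, branch z -> `|u i z| <= M) ->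
    (forall j z, branch z -> z.2 = 0 -> u j z <= w0 j z.1) ->
    forall j z, branch z -> z.2 <= tau -> u j z <= w0 j z.1 + e.
Proof.
move=> T0 m0 Bm lowH bw0 e e0; have wag := proj1 bw0.
have [W W0 hW] := BUC_bounded bw0.
have e80 : 0 < e / 16 by lra.
have [r r0 hr] := BUC_modulus bw0 e80.
have r20 : 0 < r ^+ 2 by rewrite exprn_gt0.
have [k kE] : exists k, k = 4 * W / r ^+ 2 + 2 * m ^+ 2 / e + 1 by eexists.
have k1 : 0 <= 4 * W / r ^+ 2 by rewrite divr_ge0 ?mulr_ge0// ltW.
have k2 : 0 <= 2 * m ^+ 2 / e by rewrite divr_ge0 ?mulr_ge0 ?sqr_ge0// ltW.
have k0 : 0 < k by rewrite kE; lra_on k1 k2.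
have gk : m ^+ 2 / (2 * k) <= e / 4.
  rewrite ler_pdivrMr ?mulr_gt0//.
  have : 2 * m ^+ 2 / e * e <= k * e by rewrite ler_pM2r// kE; lra_on k1.
  by rewrite divfK ?gt_eqF//; lra_goal.
have kr : 2 * W <= k / 2 * r ^+ 2.
  have : 4 * W / r ^+ 2 * r ^+ 2 <= k * r ^+ 2 by rewrite ler_pM2r// kE; lra_on k2.
  by rewrite divfK ?gt_eqF//; lra_goal.
have [G GE] : exists G, G = 2 * (`|M| + W + e) / k by eexists.
have G0 : 0 <= G by rewrite GE divr_ge0 ?(ltW k0)// mulr_ge0// !addr_ge0// ltW.
have [C hC] := lowH (2 * k * (1 + G) + m + `|M|).
have [C1 C1E] : exists C1, C1 = `|C| + k + 1 by eexists.
have C10 : 0 < C1 by rewrite C1E; have := normr_ge0 C; lra_on k0.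
have Ck0 : 0 < C1 + k by rewrite addr_gt0.
exists (Num.min 1 (e / 2 / (C1 + k))); first by rewrite lt_min ltr01 !divr_gt0.
move=> u eps ep0 ep1 uu su uM ini i zt bzt; rewrite le_min => /andP[zt1 ztau].
pose z0 : st := (zt.1, 0).
have [hx ht] := bzt; have [t0 tT] := andP ht.
have bz0 : branch z0 by split => //=; rewrite lexx ltW.
rewrite leNgt; apply/negP => bad.
have cc : continuous (fun t : R => w0 i zt.1 + e / 2 + C1 * t).
  move=> t; apply: cvgD; first exact: cvg_cst.
  by apply: cvgM; [exact: cvg_cst|exact: cvg_id].
have low t : 0 <= t <= T -> - W + e / 2 <= w0 i zt.1 + e / 2 + C1 * t.
  move=> /andP[h _]; have := hW i zt.1 hx; rewrite ler_norml => /andP[h1 _].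
  by have := mulr_ge0 (ltW C10) h; lra_on h1.
have tan t t1 : 0 <= t <= T -> 0 <= t1 <= T -> w0 i zt.1 + e / 2 + C1 * t <=
   w0 i zt.1 + e / 2 + C1 * t1 + C1 * (t - t1) + 0 * (t - t1) ^+ 2.
  by move=> _ _; lra_goal.
have start : exists j z, branch z /\
    w0 i zt.1 + e / 2 + C1 * z.2 + k * gdist i z0 j z + m * (xd z - xd z0) < u j z.
  exists i, zt; split => //; apply: le_lt_trans bad.
  have -> : xd zt - xd z0 = 0 by exact: subrr.
  have -> : gdist i z0 i zt = zt.2 ^+ 2.
    rewrite /gdist eqxx addr0 /sq /ip /z0 /= subr0 big1 ?add0r ?expr2// => l _.
    by rewrite subrr mxE mul0r.
  have h1 : zt.2 ^+ 2 <= zt.2 by rewrite expr2 ler_piMl.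
  have h2 : (C1 + k) * zt.2 <= e / 2 by rewrite mulrC -ler_pdivlMr.
  have := ler_wpM2l (ltW k0) h1; move: h2; lra_goal.
have [j [z [bz lt hz]]] := barrier_principle uu su uM bz0 k0 m0 Bm (lexx 0) cc low tan start.
have gl := gdist_low i j m bz0 bz k0.
have D0 : 0 <= gdist i z0 j z := le_trans (sq_ge0 _) (gdist_sq i j bz0 bz).
have [hxz htz] := bz; have [tz0 tzT] := andP htz.
have lowz := low z.2 htz.
have um := uM j z bz.
have um1 : u j z <= `|M| by apply: le_trans (ler_norm _) (le_trans um (ler_norm _)).
case: hz => [tz|[p [hp hH]]].
- have := ini j z bz tz; apply/negP; rewrite -ltNge; apply: le_lt_trans lt.
  rewrite tz mulr0 addr0.
  suff : w0 j z.1 <= w0 i zt.1 + e / 4 + k / 2 * gdist i z0 j z.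
    by move: gl gk; lra_goal.
  have h1 := hW j z.1 hxz; have h2 := hW i zt.1 hx.
  have [near|far] := ltP (gdist i z0 j z) (r ^+ 2); last first.
    have : k / 2 * r ^+ 2 <= k / 2 * gdist i z0 j z by rewrite ler_wpM2l// divr_ge0// ltW.
    by move: h1 h2; rewrite !ler_norml => /andP[_ h1] /andP[h2 _]; lra_on kr h1 h2 e0.
  have q0 : 0 <= k / 2 * gdist i z0 j z by rewrite mulr_ge0// divr_ge0// ltW.
  have sm (y : R) : y ^+ 2 < r ^+ 2 -> `|y| < r.
    by move=> h; rewrite -ltr_sqr ?nnegrE ?(ltW r0)// real_normK ?num_real.
  have sqr : sq (z - z0) < r ^+ 2 := le_lt_trans (gdist_sq i j bz0 bz) near.
  have dzz : `|z.1 - zt.1| < r.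
    apply: le_lt_trans (space_le (z - z0)) _; rewrite -(ger0_norm (normr_ge0 (z - z0))).
    by apply: sm; apply: le_lt_trans (norm_sq _) sqr.
  have [ji|ji] := eqVneq j i.
    rewrite ji in q0 *; have := hr i z.1 zt.1 hxz hx dzz; rewrite ltr_norml => /andP[_ h].
    by lra_on h q0 e0.
  have oth := gdist_other z0 z ji.
  (* On two different branches both points are close to the junction, where the
     initial values agree. *)
  pose flat (x : 'rV[R]_n.+1) : 'rV[R]_n.+1 := x - x ord0 ord_max *: delta_mx ord0 ord_max.
  have flat0 x : junction (flat x).
    by rewrite /junction /flat /= !mxE !eqxx mulr1 subrr.
  have flath x : halfspace (flat x) by rewrite /halfspace /=; rewrite (flat0 x).
  have dn : `|delta_mx ord0 ord_max : 'rV[R]_n.+1| <= 1.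
    by have := space_le (@ed R n); rewrite norm_ed.
  have fl (x : 'rV[R]_n.+1) : `|x ord0 ord_max| < r -> `|x - flat x| < r.
    move=> h; rewrite /flat opprD addrA subrr add0r opprK normrZ.
    by apply: le_lt_trans h; rewrite ler_piMr.
  have f1 : `|z.1 ord0 ord_max| < r.
    by apply: sm; apply: le_lt_trans near; apply: le_trans oth; rewrite lerDr sqr_ge0.
  have f2 : `|zt.1 ord0 ord_max| < r.
    by apply: sm; apply: le_lt_trans near; apply: le_trans oth; rewrite lerDl sqr_ge0.
  have w1 := hr j z.1 (flat z.1) hxz (flath _) (fl _ f1).
  have w2 := hr i z.1 (flat z.1) hxz (flath _) (fl _ f1).
  have w3 := hr i z.1 zt.1 hxz hx dzz.
  have w4 := wag j i (flat z.1) (flat0 _).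
  move: w1 w2 w3; rewrite w4 !ltr_norml => /andP[_ w1] /andP[w2 _] /andP[_ w3].
  by lra_on w1 w2 w3 q0 e0.
have DG : gdist i z0 j z <= G.
  rewrite GE ler_pdivlMr//.
  by move: lt gl lowz um1 gk e0; lra_goal.
have pG : `|p| <= 2 * k * (1 + G) + m + `|M|.
  apply: le_trans hp _; rewrite -[leLHS]addr0 lerD// lerD2r ler_pM2l ?mulr_gt0//.
  by rewrite lerD2l.
have sG : `|u j z| <= 2 * k * (1 + G) + m + `|M|.
  apply: le_trans um _; apply: le_trans (ler_norm _) _; rewrite lerDr addr_ge0//.
  by rewrite !mulr_ge0 ?addr_ge0// ltW.
have := hC j p (u j z) z bz pG sG.
have ek : eps * (k + 0) <= k by rewrite addr0 ler_piMl// ltW.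
have tk : 0 <= 2 * k * (z.2 - z0.2) by rewrite /z0 /= subr0 !mulr_ge0// ltW.
have := ler_norm C; move: hH ek tk; rewrite C1E; lra_goal.
Qed.

End uniform_estimates.

(** * Paraboloids as test functions *)

Section derivatives_of_paraboloids.
Context {R : realType}.

Lemma within_dnbhs_proper (A : set R) :
  (forall e : R, 0 < e -> exists h, [/\ A h, h != 0 & `|h| < e]) ->
  ProperFilter (within A (0 : R)^').
Proof.
move=> h; split; last exact: within_filter.
rewrite /within /= => /nbhs_distP[r r0 hr].
have [x [Ax x0 xr]] := h r r0.
by apply: (hr x) => //; rewrite subr0.
Qed.

Lemma diff_quot_on_eq (V : normedModType R) (A : set V) (f g : V -> R) v z :
  (forall h : R, A (z + h *: v) -> f (z + h *: v) = g (z + h *: v)) -> f z = g z ->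
  diff_quot_on A f v z = diff_quot_on A g v z.
Proof.
move=> fg fgz; apply/funext => S; apply/propext.
suff sub f' g' : (forall h : R, A (z + h *: v) -> f' (z + h *: v) = g' (z + h *: v)) ->
    f' z = g' z -> diff_quot_on A f' v z S -> diff_quot_on A g' v z S.
  by split; apply: sub => // h Ah; rewrite fg.
move=> fg' fgz'; apply: (@filterS _ (0 : R)^' (dnbhs_filter (0 : R))) => h hS Ah.
by have := hS Ah; rewrite /= (fg' _ Ah) fgz'.
Qed.

Lemma diff_quot_on_ext (V : normedModType R) (A : set V) (f g : V -> R) v z :
  (forall y, A y -> f y = g y) -> A z ->
  diff_quot_on A f v z = diff_quot_on A g v z.
Proof. by move=> fg Az; apply: diff_quot_on_eq => [h /fg|]; last exact: fg. Qed.

Lemma diff_quot_on_quadratic (V : normedModType R) (A : set V) (f : V -> R) v z (l k : R) :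
  (forall h, A (z + h *: v) -> f (z + h *: v) - f z = h * l + h ^+ 2 * k) ->
  diff_quot_on A f v z --> l.
Proof.
move=> hf; have FF : Filter (within [set h : R | A (z + h *: v)] (0 : R)^') by exact: within_filter.
apply/(@cvgrPdist_lt _ R^o _ _ FF) => e e0; rewrite /within /=.
have k1 : 0 < `|k| + 1 by rewrite ltr_wpDl.
apply/nbhs_distP; exists (e / (`|k| + 1)); first by rewrite divr_gt0.
move=> h; rewrite subr0 => he h0 Ah; rewrite (hf h Ah).
have -> : l - h^-1 * (h * l + h ^+ 2 * k) = - (h * k) by field; exact: h0.
rewrite normrN normrM; apply: (@le_lt_trans _ _ (`|h| * (`|k| + 1))).
  by rewrite ler_wpM2l// lerDl.
by rewrite -ltr_pdivlMr.
Qed.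

Lemma within_continuous_distP (V : normedModType R) (A : set V) (f : V -> R) :
  {within A, continuous f} <-> forall z, A z -> forall e : R, 0 < e ->
    exists2 r : R, 0 < r & forall w, A w -> `|w - z| < r -> `|f w - f z| < e.
Proof.
split=> [/subspace_continuousP cf z Az e e0|h].
  have /cvgrPdist_lt/(_ _ e0) := cf z Az; rewrite /within /= => /nbhs_distP[r r0 hr].
  by exists r => // w Aw wz; rewrite distrC; exact: hr.
apply/subspace_continuousP => z Az; apply/cvgrPdist_lt => e e0; rewrite /within /=.
apply/nbhs_distP; have [r r0 hr] := h z Az e e0.
by exists r => // w wz Aw; rewrite distrC; exact: hr.
Qed.

End derivatives_of_paraboloids.

Section test_paraboloids.
Context {R : realType} {n : nat} (T : R).
Notation st := (spacetime R n).
Notation branch := (cylinder T (@halfspace R n)).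
Implicit Types (z w P : st).

Definition paraboloid (c : R) P (k : R) z0 z : R := c + ip P (z - z0) + k * sq (z - z0).

(** The difference quotients along v determine a limit at every point of the
    branch. *)
Definition admissible_direction (v : st) := forall z, branch z ->
  ProperFilter (within [set h : R | branch (z + h *: v)] 0^').

Lemma ip_e_space P j : ip P (@e_space R n j) = P.1 ord0 j.
Proof.
rewrite /ip /e_space /= mulr0 addr0 (bigD1 j)//= mxE !eqxx mulr1.
by rewrite big1 ?addr0// => k /negPf kj; rewrite mxE kj andbF mulr0.
Qed.

Lemma ip_e_time P : ip P (@e_time R n) = P.2.
Proof. by rewrite ipC -/et ip_et. Qed.

Lemma space_admissible j : admissible_direction (@e_space R n j).
Proof.
move=> z [hx ht]; apply: within_dnbhs_proper => e e0; exists (- (e / 2)); split.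
- split; last by rewrite /= scaler0 addr0.
  rewrite /halfspace /= !mxE; have hx' : z.1 ord0 ord_max <= 0 := hx.
  by case: (_ && _); rewrite ?mulr1 ?mulr0 ?addr0//; move: hx' e0; lra_goal.
- by rewrite oppr_eq0 gt_eqF// divr_gt0.
- by rewrite normrN gtr0_norm ?divr_gt0//; move: e0; lra_goal.
Qed.

Lemma time_admissible : 0 < T -> admissible_direction (@e_time R n).
Proof.
move=> T0 z [hx /andP[t0 tT]]; apply: within_dnbhs_proper => e e0.
have [h [h0 he hT]] : exists h : R, [/\ h != 0, `|h| < e & 0 <= z.2 + h <= T].
  have [m m0] := @small_pos R [:: e / 2; T / 2] ltac:(by rewrite /= !divr_gt0).
  move=> /= /and3P[me mT _].
  have [zT|zT] := leP z.2 (T / 2).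
    exists m; rewrite gt_eqF// gtr0_norm//; split => //; first by move: me e0; lra_goal.
    by apply/andP; split; [move: t0 m0|move: zT mT]; lra_goal.
  exists (- m); rewrite oppr_eq0 gt_eqF// normrN gtr0_norm//; split => //; first by move: me e0; lra_goal.
  by apply/andP; split; [move: zT mT|move: tT m0]; lra_goal.
exists h; split => //; split; last by rewrite /= /GRing.scale /= mulr1.
by rewrite /halfspace /= scaler0 addr0.
Qed.

Lemma paraboloid_diff_quot c P k z0 v z :
  diff_quot_on branch (paraboloid c P k z0) v z --> ip (P + (2 * k) *: (z - z0)) v.
Proof.
apply: (@diff_quot_on_quadratic _ _ _ _ _ _ _ (k * sq v)) => h _; rewrite /paraboloid.
have -> : z + h *: v - z0 = (z - z0) + h *: v by rewrite addrAC.
rewrite sqD sqZ !(ipDr, ipDl, ipZr, ipZl, ipNr, ipNl); ring.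
Qed.

Lemma paraboloid_derive c P k z0 v z : admissible_direction v -> branch z ->
  derive_on branch (paraboloid c P k z0) v z = ip (P + (2 * k) *: (z - z0)) v.
Proof.
move=> av bz; have := av z bz => pf.
by apply: cvg_lim; [exact: Rhausdorff|exact: paraboloid_diff_quot].
Qed.

Lemma paraboloid_derive_on c P k z0 v z : admissible_direction v -> branch z ->
  derive_on branch (paraboloid c P k z0) v z =
  paraboloid (ip P v) ((2 * k) *: v) 0 z0 z.
Proof.
move=> av bz; rewrite paraboloid_derive// /paraboloid ipDl !ipZl (ipC v).
by rewrite mul0r addr0.
Qed.

Lemma paraboloid_continuous c P k z0 : continuous (paraboloid c P k z0).
Proof.
have -> : paraboloid c P k z0 =
    fun z => c + ip P (z - z0) + k * sq (z - z0) + 0 * xd z + 0 * xd z ^+ 2.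
  by apply/funext => z; rewrite /paraboloid; ring.
exact: quad_continuous.
Qed.

Lemma paraboloid_within c P k z0 : {within branch, continuous (paraboloid c P k z0)}.
Proof. exact/continuous_subspaceT/paraboloid_continuous. Qed.

Lemma paraboloid_like_derivable f c P k z0 v : admissible_direction v ->
  (forall z, branch z -> f z = paraboloid c P k z0 z) ->
  cont_derivable_on branch f v.
Proof.
move=> av fE; split.
  move=> z bz; rewrite (diff_quot_on_ext v fE bz); apply/cvg_ex.
  by eexists; exact: paraboloid_diff_quot.
have dE z : branch z -> derive_on branch f v z = paraboloid (ip P v) ((2 * k) *: v) 0 z0 z.
  by move=> bz; rewrite /derive_on (diff_quot_on_ext v fE bz); exact: paraboloid_derive_on.
apply/within_continuous_distP => z bz e e0.
have [r r0 hr] := (continuous_distP _).1 (@paraboloid_continuous (ip P v) ((2 * k) *: v) 0 z0) z e e0.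
by exists r => // w bw wz; rewrite !dE//; exact: hr.
Qed.

Lemma paraboloid_smooth c P k z0 : 0 < T -> C2x_C1t T (paraboloid c P k z0).
Proof.
move=> T0; split.
  split; first exact: paraboloid_within.
    by apply: (paraboloid_like_derivable (c := c) (P := P) (k := k) (z0 := z0)) => //; exact: time_admissible.
  by move=> j; apply: (paraboloid_like_derivable (c := c) (P := P) (k := k) (z0 := z0)) => //; exact: space_admissible.
move=> j l; apply: (@paraboloid_like_derivable _ (ip P (@e_space R n j)) ((2 * k) *: @e_space R n j) 0 z0).
  exact: space_admissible.
by move=> z bz; apply: paraboloid_derive_on => //; exact: space_admissible.
Qed.

Lemma paraboloid_dt c P k z0 : 0 < T -> branch z0 -> dt T (paraboloid c P k z0) z0 = P.2.
Proof.
move=> T0 bz; rewrite /dt paraboloid_derive//; last exact: time_admissible.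
by rewrite subrr scaler0 addr0 ip_e_time.
Qed.

Lemma paraboloid_dx c P k z0 j z : branch z ->
  dx T j (paraboloid c P k z0) z = P.1 ord0 j + 2 * k * (z - z0).1 ord0 j.
Proof.
move=> bz; rewrite /dx paraboloid_derive//; last exact: space_admissible.
by rewrite ipDl ipZl !ip_e_space.
Qed.

Lemma paraboloid_grad c P k z0 : branch z0 -> grad T (paraboloid c P k z0) z0 = P.1.
Proof.
move=> bz; apply/rowP => j; rewrite mxE paraboloid_dx// subrr.
have -> : (0 : st).1 ord0 j = 0 by rewrite /= mxE.
by rewrite mulr0 addr0.
Qed.

Lemma paraboloid_laplacian c P k z0 : branch z0 ->
  laplacian T (paraboloid c P k z0) z0 = n.+1%:R * (2 * k).
Proof.
move=> bz; rewrite /laplacian (eq_bigr (fun _ => 2 * k)).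
  by rewrite sumr_const card_ord -[LHS]mulr_natl.
move=> j _; rewrite {1}/dx /derive_on.
rewrite (@diff_quot_on_ext _ _ _ _ (paraboloid (ip P (@e_space R n j)) ((2 * k) *: @e_space R n j) 0 z0)) //.
  rewrite -/(derive_on _ _ _ _) paraboloid_derive//; last exact: space_admissible.
  by rewrite mulr0 scale0r addr0 ipZl ip_e_space mxE !eqxx mulr1.
by move=> y by_; apply: paraboloid_derive_on => //; exact: space_admissible.
Qed.

End test_paraboloids.

(** * Solutions are sub-solutions for paraboloids *)

Section solutions_and_paraboloids.
Context {R : realType} {n K : nat} (T B : R).
Notation st := (spacetime R n).
Notation branch := (cylinder T (@halfspace R n)).
Notation line := (cylinder T (@junction R n)).
Implicit Types (z w P : st) (u v : 'I_K -> st -> R).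
Implicit Types H : 'I_K -> 'rV[R]_n.+1 -> R -> 'rV[R]_n.+1 -> R -> R.

Lemma lineP z : branch z -> line z <-> xd z = 0.
Proof. by move=> [hx ht]; split=> [[]//|h]; split. Qed.

Lemma line_branch z : line z -> branch z /\ xd z = 0.
Proof. by move=> [hx ht]; split => //; split => //; rewrite /halfspace /=; rewrite hx. Qed.

Lemma continuous_jusc u : continuous_on_junction branch line u -> jusc T u.
Proof.
move=> [ag cu] i z0 bz0 e e0; suff [r r0 hr] : exists2 r : R, 0 < r & forall j,
    (j = i \/ xd z0 = 0) -> forall z, branch z -> `|z - z0| < r -> u j z < u i z0 + e.
  by exists r => // j z aj; exact: hr.
apply: fin_common_small => [j|j a b b0 ba h aj z bz zr]; last first.
  by apply: h => //; exact: lt_le_trans ba.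
have [r r0 hr] := (within_continuous_distP _ _).1 (cu j) z0 bz0 e e0.
exists r => // aj z bz zr; have -> : u i z0 = u j z0.
  by case: aj => [->//|x0]; apply: ag; apply/lineP.
by have := hr z bz zr; rewrite ltr_norml => /andP[_ h]; move: h; lra_goal.
Qed.

Section paraboloids_suffice.
Context (H : 'I_K -> 'rV[R]_n.+1 -> R -> 'rV[R]_n.+1 -> R -> R) (E : R).
Context (smooth : (st -> R) -> Prop) (F : 'I_K -> (st -> R) -> R -> st -> R).
Context (T0 : 0 < T) (para_smooth : forall c P k z0, smooth (paraboloid c P k z0)).
Context (opF : forall i c P k z0 s, branch z0 ->
  F i (paraboloid c P k z0) s z0 = op H i P s z0 - E * k).

(* Off the junction only branch i is tested, and giving all the branches the
   slope r i keeps the test function continuous across the junction. *)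
Let slope (r : 'I_K -> R) i z0 j := if xd z0 == 0 then r j else r i.

Let slopeE r i z0 j : j = i \/ xd z0 = 0 -> slope r i z0 j = r j.
Proof. by rewrite /slope; case=> [->|->]; [case: ifP|rewrite eqxx]. Qed.

Let para_test (sg k : R) P r i z0 : branch z0 ->
  test_function T smooth (fun j => paraboloid 0 (sg *: (P + slope r i z0 j *: ed)) k z0).
Proof.
move=> bz0; split=> [|j]; last exact: para_smooth.
split=> [j l z /line_branch[bz x0]|j]; last exact: paraboloid_within.
rewrite /paraboloid !ipZl !ipDl !ipZl !ip_ed /slope.
by case: eqP => [x00|_] //; rewrite xdB x0 x00 subrr !mulr0.
Qed.

Let kirchhoff_para (sg k : R) P r i z0 : branch z0 -> xd z0 = 0 ->
  kirchhoff T B (fun j => paraboloid 0 (sg *: (P + slope r i z0 j *: ed)) k z0) z0 =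
  sg * (\sum_j (xd P + r j)) - B.
Proof.
move=> bz0 x0; rewrite /kirchhoff mulr_sumr; congr (_ - _); apply: eq_bigr => j _.
rewrite paraboloid_dx// subrr -/(xd _) xdZ xd_shift_ed slopeE; last by right.
by rewrite (_ : (0 : st).1 ord0 ord_max = 0) ?mulr0 ?addr0// mxE.
Qed.

Lemma para_at0 P k z0 : paraboloid 0 P k z0 z0 = 0.
Proof. by rewrite /paraboloid subrr ip0r sq0 mulr0 !addr0. Qed.

Lemma subsolution_psub u : subsolution T B smooth F u -> psub T H B E u.
Proof.
move=> [cu su] k P r i z0 k0 bz0 t0 [rho rho0 touch].
have [] := su _ i z0 (para_test 1 k P r i bz0) bz0 t0.
  move=> j aj; rewrite /within /=; apply/nbhs_distP; exists rho => // z zr bz.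
  have aj' : j = i \/ xd z0 = 0 by case: aj => [->|/line_branch[]]; [left|right].
  rewrite para_at0 subr0 /paraboloid scale1r ipDl ipZl ip_ed (slopeE r aj').
  by have := touch j z aj' bz zr; lra.
move=> int jun; have [x0|/eqP x0] := eqVneq (xd z0) 0; last first.
  right; exists i; first by left.
  have := int _; rewrite opF// scale1r slopeE; last by left.
  by rewrite subr_le0; apply => /(lineP bz0).
have := jun ((lineP bz0).2 x0) => le; apply: contrapT => /not_orP[nk nj].
move: le; apply/negP; rewrite -ltNge; apply: lt_bigmin => [|j _].
  rewrite kirchhoff_para// mul1r subr_gt0 ltNge; apply/negP => h.
  by apply: nk; split.
rewrite opF// scale1r slopeE; last by right.
rewrite subr_gt0 ltNge; apply/negP => h; apply: nj; exists j => //; by right.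
Qed.

Lemma supersolution_psub u : supersolution T B smooth F u ->
  psub T (reflect_H H) (- B) E (fun i z => - u i z).
Proof.
move=> [cu su] k P r i z0 k0 bz0 t0 [rho rho0 touch].
have [] := su _ i z0 (para_test (- 1) (- k) P r i bz0) bz0 t0.
  move=> j aj; rewrite /within /=; apply/nbhs_distP; exists rho => // z zr bz.
  have aj' : j = i \/ xd z0 = 0 by case: aj => [->|/line_branch[]]; [left|right].
  rewrite para_at0 subr0 /paraboloid scaleN1r ipNl ipDl ipZl ip_ed (slopeE r aj').
  by have := touch j z aj' bz zr; lra.
move=> int jun; have [x0|/eqP x0] := eqVneq (xd z0) 0; last first.
  right; exists i; first by left.
  have := int _; rewrite opF// scaleN1r slopeE; last by left.
  by rewrite op_reflect opprK => /(_ (fun h => x0 ((lineP bz0).1 h))); lra.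
have := jun ((lineP bz0).2 x0) => le; apply: contrapT => /not_orP[nk nj].
move: le; apply/negP; rewrite -ltNge; apply: bigmax_lt => [|j _].
  rewrite kirchhoff_para// mulN1r subr_lt0 ltrNl ltNge; apply/negP => h.
  by apply: nk; split.
rewrite opF// scaleN1r slopeE; last by right.
rewrite mulrN opprK ltNge; apply/negP => h; apply: nj; exists j; first by right.
by rewrite op_reflect opprK; move: h; lra.
Qed.

End paraboloids_suffice.

Lemma viscous_psub H eps u : 0 < T -> viscous_solution T B H eps u ->
  psub T H B (2 * n.+1%:R * eps) u /\
  psub T (reflect_H H) (- B) (2 * n.+1%:R * eps) (fun i z => - u i z).
Proof.
move=> T0 [sub sup].
have ps c P k z0 : C2x_C1t T (paraboloid c P k z0) by exact: paraboloid_smooth.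
have oF i c P k z0 s : branch z0 -> viscous_op T H eps i (paraboloid c P k z0) s z0 =
    op H i P s z0 - 2 * n.+1%:R * eps * k.
  move=> bz; rewrite /viscous_op paraboloid_dt// paraboloid_laplacian// paraboloid_grad//.
  by rewrite /op; ring.
by split; [exact: subsolution_psub ps oF _ sub|exact: supersolution_psub ps oF _ sup].
Qed.

Lemma generalized_psub H u : 0 < T -> generalized_solution T B H u ->
  psub T H B 0 u /\ psub T (reflect_H H) (- B) 0 (fun i z => - u i z).
Proof.
move=> T0 [sub sup].
have ps c P k z0 : C1 T (paraboloid c P k z0) by case: (paraboloid_smooth c P k z0 T0).
have oF i c P k z0 s : branch z0 -> first_order_op T H i (paraboloid c P k z0) s z0 =
    op H i P s z0 - 0 * k.
  by move=> bz; rewrite /first_order_op paraboloid_dt// paraboloid_grad// mul0r subr0.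
by split; [exact: subsolution_psub ps oF _ sub|exact: supersolution_psub ps oF _ sup].
Qed.

End solutions_and_paraboloids.

(** * First-order expansion of test functions *)

Section mean_value.
Context {R : realType} {V : normedModType R}.
Implicit Types (A : set V) (f : V -> R).

Lemma diff_quot_on_interior A f (v z : V) : cvg (diff_quot_on A f v z) ->
  (exists2 r : R, 0 < r & forall h : R, `|h| < r -> A (z + h *: v)) ->
  (fun h : R => h^-1 * (f (z + h *: v) - f z)) @ (0 : R)^' --> derive_on A f v z.
Proof.
move=> cf [r r0 hr].
have FF : Filter (within [set h : R | A (z + h *: v)] (0 : R)^') by exact: within_filter.
apply/cvgrPdist_lt => e e0.
have /(@cvgrPdist_lt _ R^o _ _ FF)/(_ _ e0) : diff_quot_on A f v z --> derive_on A f v z := cf.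
rewrite /within /= => near1.
have near2 : \forall h \near (0 : R)^', A (z + h *: v).
  apply/nbhs_distP; exists r => // h; rewrite subr0 => hh _; exact: hr.
near=> h; have Ah : A (z + h *: v) by near: h.
by move: Ah; near: h; exact: near1.
Unshelve. all: by end_near. Qed.

Lemma mean_value_pos A f (v a : V) (d : R) : 0 < d ->
  (forall s : R, 0 <= s <= d -> A (a + s *: v)) ->
  {within A, continuous f} -> cont_derivable_on A f v ->
  exists2 s : R, 0 <= s <= d & f (a + d *: v) - f a = d * derive_on A f v (a + s *: v).
Proof.
move=> d0 hA cf [df _].
pose g s := f (a + s *: v).
have der x : x \in `]0, d[%R -> is_derive (x : R) (1 : R) (g : R^o -> R^o) (derive_on A f v (a + x *: v)).
  rewrite in_itv /= => /andP[x0 xd].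
  have Ax : A (a + x *: v) by apply: hA; rewrite !ltW.
  have int : exists2 r : R, 0 < r & forall h : R, `|h| < r -> A (a + x *: v + h *: v).
    exists (Num.min x (d - x)); first by rewrite lt_min x0 subr_gt0.
    move=> h; rewrite lt_min !ltr_norml => /andP[/andP[h1 h2] /andP[h3 h4]].
    rewrite -addrA -scalerDl; apply: hA; apply/andP; split; lra.
  have cg := diff_quot_on_interior (df _ Ax) int.
  have E : (fun h : R => h^-1 *: ((g \o shift x) (h *: (1 : R)) - g x)) =
      (fun h : R => h^-1 * (f (a + x *: v + h *: v) - f (a + x *: v))).
    apply/funext => h; rewrite /g /= /GRing.scale /= mulr1.
    by rewrite -/(GRing.scale _ _) -addrA -scalerDl (addrC h).
  split; first by rewrite /derivable E; apply/cvg_ex; eexists; exact: cg.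
  by rewrite /derive E; apply: cvg_lim; [exact: Rhausdorff|exact: cg].
have cg : {within `[0, d], continuous (g : R^o -> R^o)}.
  apply/within_continuous_distP => s; rewrite /= in_itv /= => hs e e0.
  have [r r0 hr] := (within_continuous_distP _ _).1 cf _ (hA s hs) e e0.
  have v1 : 0 < `|v| + 1 by rewrite ltr_wpDl.
  exists (r / (`|v| + 1)) => [|s']; first by rewrite divr_gt0.
  rewrite /= in_itv /= => hs' ss; apply: hr; first exact: hA.
  rewrite opprD addrACA subrr add0r -scalerBl normrZ.
  apply: (@le_lt_trans _ _ (`|s' - s| * (`|v| + 1))).
    by rewrite ler_wpM2l// lerDl.
  by rewrite -ltr_pdivlMr.
have [s sd Es] := MVT d0 der cg.
exists s; first by move: sd; rewrite in_itv /= => /andP[h1 h2]; rewrite !ltW.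
by move: Es; rewrite /g scale0r addr0 subr0 mulrC.
Qed.

Lemma mean_value_on A f (v a : V) (d : R) :
  (forall s : R, 0 <= s <= 1 -> A (a + (s * d) *: v)) ->
  {within A, continuous f} -> cont_derivable_on A f v ->
  exists2 s : R, 0 <= s <= 1 &
    f (a + d *: v) - f a = d * derive_on A f v (a + (s * d) *: v).
Proof.
move=> hA cf df; have [d0|d0|->] := ltgtP d 0; last first.
- by exists 0; rewrite ?lexx ?ler01// scale0r addr0 subrr mul0r.
- have hA' s : 0 <= s <= d -> A (a + s *: v).
    move=> /andP[s0 sd]; rewrite -(divfK (lt0r_neq0 d0) s); apply: hA.
    by rewrite divr_ge0 ?(ltW d0)//= ler_pdivrMr// mul1r.
  have [s /andP[s0 sd] E] := mean_value_pos d0 hA' cf df.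
  exists (s / d); first by rewrite divr_ge0 ?(ltW d0)//= ler_pdivrMr// mul1r.
  by rewrite divfK// lt0r_neq0.
have d0' : 0 < - d by rewrite oppr_gt0.
have hA' s : 0 <= s <= - d -> A (a + d *: v + s *: v).
  move=> /andP[s0 sd]; rewrite -addrA -scalerDl.
  have -> : d + s = ((d + s) / d) * d by rewrite divfK// lt_eqF.
  apply: hA; rewrite ler_ndivlMr// ler_ndivrMr// mul0r mul1r.
  by apply/andP; split; lra.
have [s /andP[s0 sd] E] := mean_value_pos d0' hA' cf df.
exists ((d + s) / d).
  rewrite ler_ndivlMr// ler_ndivrMr// mul0r mul1r.
  by apply/andP; split; lra.
rewrite divfK ?lt_eqF//; move: E; rewrite scaleNr addrK scalerDl addrA => E.
by rewrite -[LHS]opprB E mulNr opprK.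
Qed.

End mean_value.

Section taylor.
Context {R : realType} {n : nat} (T : R).
Notation st := (spacetime R n).
Notation branch := (cylinder T (@halfspace R n)).
Implicit Types (z w P : st) (phi : st -> R).

Definition st_grad phi z : st := (grad T phi z, dt T phi z).

Let between (z0 z y : st) := (forall k, exists2 s : R, 0 <= s <= 1 &
    y.1 ord0 k = z0.1 ord0 k + s * (z.1 ord0 k - z0.1 ord0 k)) /\
  exists2 s : R, 0 <= s <= 1 & y.2 = z0.2 + s * (z.2 - z0.2).

Let between_branch (z0 z y : st) : between z0 z y -> branch z0 -> branch z -> branch y.
Proof.
have conv (s x x' : R) : x + s * (x' - x) = (1 - s) * x + s * x' by ring.
move=> [hx [s /andP[s0 s1] hs]] [x0 /andP[t0 tT]] [x1 /andP[t0' tT']].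
have q : 0 <= 1 - s by rewrite subr_ge0.
split; last first.
  rewrite hs conv; apply/andP; split; first by rewrite addr_ge0// mulr_ge0.
  apply: (@le_trans _ _ ((1 - s) * T + s * T)); last by rewrite le_eqVlt; apply/orP; left; apply/eqP; ring.
  by apply: lerD; apply: ler_wpM2l.
have [r /andP[r0 r1] hr] := hx ord_max.
rewrite /halfspace /= hr conv; have q' : 0 <= 1 - r by rewrite subr_ge0.
have h1 : (1 - r) * z0.1 ord0 ord_max <= 0 by exact: mulr_ge0_le0.
have h2 : r * z.1 ord0 ord_max <= 0 by exact: mulr_ge0_le0.
by lra.
Qed.

Let between_norm (z0 z y : st) : between z0 z y -> `|y - z0| <= `|z - z0|.
Proof.
have le (s x : R) : 0 <= s <= 1 -> `|s * x| <= `|x|.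
  by move=> /andP[s0 s1]; rewrite normrM (ger0_norm s0) ler_piMl.
move=> [hx [s hs Es]]; rewrite st_normE ge_max; apply/andP; split.
  apply: rV_norm_le => // k; have [r hr Er] := hx k.
  have -> : (y - z0).1 ord0 k = r * (z - z0).1 ord0 k.
    by rewrite /= !mxE Er addrC addKr.
  exact: le_trans (le _ _ hr) (coord_le _ _).
have -> : (y - z0).2 = s * (z - z0).2 by rewrite /= Es addrC addKr.
exact: le_trans (le _ _ hs) (time_le _).
Qed.

(** First-order expansion of a test function along a path that moves one
    coordinate at a time and therefore stays in the branch. *)
Lemma C1_expansion phi z0 : C1 T phi -> branch z0 -> forall d : R, 0 < d ->
  exists2 rho : R, 0 < rho & forall z, branch z -> `|z - z0| < rho ->
    `|phi z - phi z0 - ip (st_grad phi z0) (z - z0)| <= d * `|z - z0|.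
Proof.
move=> [cphi dtphi dxphi] bz0 d d0.
have n2 : 0 < n.+2%:R :> R by [].
have [d' d'E] : exists d', d' = d / n.+2%:R by eexists.
have d'0 : 0 < d' by rewrite d'E divr_gt0.
have [rx rx0 hrx] : exists2 r : R, 0 < r & forall j y, branch y -> `|y - z0| < r ->
    `|dx T j phi y - dx T j phi z0| < d'.
  apply: fin_common_small => [j|j a b b0 ba h y bY yb]; last first.
    by apply: h => //; exact: lt_le_trans ba.
  by have [r r0 hr] := (within_continuous_distP _ _).1 (proj2 (dxphi j)) z0 bz0 d' d'0; exists r.
have [rt rt0 hrt] := (within_continuous_distP _ _).1 (proj2 dtphi) z0 bz0 d' d'0.
exists (Num.min rx rt); first by rewrite lt_min rx0.
move=> z bz; rewrite lt_min => /andP[zx zt].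
pose pt (m : nat) : st := (\row_k (if (k < m)%N then z.1 ord0 k else z0.1 ord0 k), z0.2).
have pt0 : pt 0 = z0.
  rewrite /pt [RHS]surjective_pairing; congr pair.
  by apply/rowP => k; rewrite mxE.
have ptn : pt n.+1 = (z.1, z0.2).
  by rewrite /pt; congr pair; apply/rowP => k; rewrite mxE ltn_ord.
have step (m : nat) (mn : (m < n.+1)%N) (s : R) :
    pt m + (s * (z - z0).1 ord0 (Ordinal mn)) *: @e_space R n (Ordinal mn) =
    (\row_k (if (k < m)%N then z.1 ord0 k else if k == m :> nat then
       z0.1 ord0 k + s * (z.1 ord0 k - z0.1 ord0 k) else z0.1 ord0 k), z0.2).
  rewrite /pt /e_space; congr pair; last by rewrite /= scaler0 addr0.
  apply/rowP => k; rewrite !mxE eqxx /=.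
  have -> : (k == Ordinal mn) = (k == m :> nat) by [].
  case: ltnP => [km|mk]; first by rewrite (ltn_eqF km) mulr0 addr0.
  case: eqP => [km|_]; last by rewrite mulr0 addr0.
  have -> : Ordinal mn = k by apply/val_inj.
  by rewrite mulr1.
have btw (m : nat) (mn : (m < n.+1)%N) (s : R) : 0 <= s <= 1 ->
    between z0 z (pt m + (s * (z - z0).1 ord0 (Ordinal mn)) *: @e_space R n (Ordinal mn)).
  move=> hs; rewrite step; split=> [k|]; last by exists 0; rewrite ?lexx ?ler01// mul0r addr0.
  rewrite /= mxE; case: ltnP => _.
    by exists 1; rewrite ?ler01 ?lexx// mul1r addrC subrK.
  by case: eqP => _; [exists s|exists 0; rewrite ?lexx ?ler01// mul0r addr0].
have ind (m : nat) : (m <= n.+1)%N ->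
    `|phi (pt m) - phi z0 - \sum_(k < n.+1 | (k < m)%N) (st_grad phi z0).1 ord0 k * (z - z0).1 ord0 k|
    <= m%:R * (d' * `|z - z0|).
  elim: m => [_|m ih mn].
    by rewrite pt0 big_pred0// !subrr normr0 mul0r.
  set j := Ordinal mn.
  have [s hs Es] := mean_value_on (fun s hs => between_branch (btw m mn s hs) bz0 bz) cphi (dxphi j).
  have nx : pt m + (z - z0).1 ord0 j *: @e_space R n j = pt m.+1.
    have := step m mn 1; rewrite mul1r => ->; rewrite /pt; congr pair.
    apply/rowP => k; rewrite !mxE ltnS; case: (ltngtP k m) => //= _.
    by rewrite mul1r addrC subrK.
  rewrite nx in Es.
  have -> : phi (pt m.+1) = phi (pt m) + (z - z0).1 ord0 j * derive_on branch phi (@e_space R n j)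
      (pt m + (s * (z - z0).1 ord0 j) *: @e_space R n j) by rewrite -Es addrC subrK.
  rewrite (bigD1 j) ?ltnSn//=.
  rewrite (eq_bigl (fun k : 'I_n.+1 => (k < m)%N)); last first.
    move=> k; rewrite ltnS leq_eqVlt -(inj_eq val_inj) /=.
    by case: ltngtP.
  have bb := btw m mn s hs.
  have close := hrx j _ (between_branch bb bz0 bz) (le_lt_trans (between_norm bb) zx).
  rewrite /dx in close; move: (derive_on branch phi _ (pt m + _)) close => D close.
  rewrite (_ : (st_grad phi z0).1 ord0 j = derive_on branch phi (@e_space R n j) z0); last by rewrite /st_grad /= mxE.
  move: (derive_on _ _ _ z0) close => D0 close.
  set S := \sum_(_ < _ | _) _; set y := (z - z0).1 ord0 j.
  have -> : phi (pt m) + y * D - phi z0 - (D0 * y + S) = (phi (pt m) - phi z0 - S) + y * (D - D0) by ring.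
  apply: le_trans (ler_normD _ _) _; rewrite -natr1 mulrDl mul1r; apply: lerD; first exact: ih (ltnW mn).
  by rewrite normrM mulrC; apply: ler_pM => //; [exact: ltW|exact: coord_le].
have tbtw (s : R) : 0 <= s <= 1 -> between z0 z (pt n.+1 + (s * (z.2 - z0.2)) *: @e_time R n).
  move=> hs; rewrite ptn; split=> [k|].
    by exists 1; rewrite ?ler01 ?lexx//= scaler0 addr0 mul1r addrC subrK.
  by exists s => //; rewrite /= /GRing.scale /= mulr1.
have [s hs Es] := mean_value_on (fun s hs => between_branch (tbtw s hs) bz0 bz) cphi dtphi.
have nx : pt n.+1 + (z.2 - z0.2) *: @e_time R n = z.
  rewrite ptn [RHS]surjective_pairing /e_time; congr pair; first by rewrite /= scaler0 addr0.
  by rewrite /= /GRing.scale /= mulr1 addrC subrK.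
rewrite nx in Es.
have bb := tbtw s hs.
have close := hrt _ (between_branch bb bz0 bz) (le_lt_trans (between_norm bb) zt).
have := ind n.+1 (leqnn _).
rewrite (eq_bigl predT); last by move=> k; rewrite ltn_ord.
rewrite /ip -/(dt T phi z0).
have -> : (st_grad phi z0).2 = derive_on branch phi (@e_time R n) z0 by [].
move: (derive_on branch phi _ (pt n.+1 + _)) close Es => D close Es.
move: (derive_on _ _ _ z0) close => D0 close.
have -> : (z - z0).2 = z.2 - z0.2 by [].
set S := \sum_(_ < _ | _) _ => h1.
have -> : phi z - phi z0 - (S + D0 * (z.2 - z0.2)) =
  (phi (pt n.+1) - phi z0 - S) + (z.2 - z0.2) * (D - D0).
  by have -> : phi z = phi (pt n.+1) + (z.2 - z0.2) * D by [rewrite -Es addrC subrK]; ring.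
apply: le_trans (ler_normD _ _) _.
have -> : d * `|z - z0| = n.+1%:R * (d' * `|z - z0|) + d' * `|z - z0|.
  have -> : d = d' * n.+2%:R by rewrite d'E divfK// gt_eqF.
  by rewrite -[n.+2%:R]natr1; ring.
apply: lerD => //; rewrite normrM mulrC; apply: ler_pM => //; first exact: ltW.
exact: (time_le (z - z0)).
Qed.

End taylor.

(** * Superdifferentials give all test functions *)

Section superdifferentials_suffice.
Context {R : realType} {n K : nat} (T B : R).
Notation st := (spacetime R n).
Notation branch := (cylinder T (@halfspace R n)).
Notation line := (cylinder T (@junction R n)).
Implicit Types (z w P : st) (u v : 'I_K -> st -> R) (phi : 'I_K -> st -> R).
Implicit Types H : 'I_K -> 'rV[R]_n.+1 -> R -> 'rV[R]_n.+1 -> R -> R.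

(** A test function is continuous across the junction, so that only its normal
    derivative depends on the branch. *)
Lemma tangential_agree phi i j z : agree_on line phi -> line z ->
  st_grad T (phi j) z =
  st_grad T (phi i) z + (xd (st_grad T (phi j) z) - xd (st_grad T (phi i) z)) *: ed.
Proof.
move=> ag Lz; have [bz x0] := line_branch Lz.
have eqd (d : st) : xd d = 0 -> derive_on branch (phi j) d z = derive_on branch (phi i) d z.
  move=> xv; rewrite /derive_on (@diff_quot_on_eq _ _ _ (phi j) (phi i))//; last exact: ag.
  move=> h bh; apply: ag; apply/(lineP bh).
  by rewrite xdD xdZ xv x0 mulr0 addr0.
rewrite [RHS]surjective_pairing [LHS]surjective_pairing; congr pair; last first.
  by rewrite time_shift_ed /st_grad /= /dt eqd// xd_et.
apply/rowP => k; rewrite /st_grad /= !mxE eqxx /=.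
case: eqP => [->|/eqP km]; first by rewrite mulr1 /xd /= !mxE addrC subrK.
rewrite mulr0 addr0 /dx eqd// /xd /= mxE.
by rewrite eq_sym (negPf km) andbF.
Qed.

Lemma kirchhoff_st_grad phi z :
  kirchhoff T B phi z = \sum_j xd (st_grad T (phi j) z) - B.
Proof. by rewrite /kirchhoff; congr (_ - _); apply: eq_bigr => j _; rewrite /xd mxE. Qed.

Lemma test_expansion phi i z0 (f : 'I_K -> st -> R) (sg : R) :
  test_function T (C1 T) phi -> branch z0 -> `|sg| = 1 ->
  (forall j, (j = i \/ line z0) -> \forall z \near within branch (nbhs z0),
     f j z - sg * phi j z <= f i z0 - sg * phi i z0) ->
  forall d : R, 0 < d -> exists2 rho : R, 0 < rho & forall j z,
     (j = i \/ xd z0 = 0) -> branch z -> `|z - z0| < rho ->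
     f j z <= f i z0 + ip (sg *: st_grad T (phi i) z0) (z - z0) +
       sg * (xd (st_grad T (phi j) z0) - xd (st_grad T (phi i) z0)) * xd (z - z0) +
       d * `|z - z0|.
Proof.
move=> [[ag cphi] sm] bz0 sg1 loc d d0.
suff [r r0 hr] : exists2 rho : R, 0 < rho & forall j, (j = i \/ xd z0 = 0) -> forall z,
     branch z -> `|z - z0| < rho ->
     f j z <= f i z0 + ip (sg *: st_grad T (phi i) z0) (z - z0) +
       sg * (xd (st_grad T (phi j) z0) - xd (st_grad T (phi i) z0)) * xd (z - z0) +
       d * `|z - z0|.
  by exists r => // j z aj; exact: hr.
apply: fin_common_small => [j|j a b b0 ba h aj z bz zr]; last first.
  by apply: h => //; exact: lt_le_trans ba.
have [aj|naj] := pselect (j = i \/ xd z0 = 0); last by exists 1 => // /naj.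
have aj' : j = i \/ line z0 by case: aj => [->|x0]; [left|right; apply/lineP].
have := loc j aj'; rewrite /within /= => /nbhs_distP[r r0 hr].
have [s s0 hs] := C1_expansion (sm j) bz0 d0.
exists (Num.min r s); first by rewrite lt_min r0.
move=> _ z bz; rewrite lt_min => /andP[zr zs].
have h1 := hr z zr bz; have h2 := hs z bz zs.
have pE : phi j z0 = phi i z0 by case: aj' => [->//|]; exact: ag.
have gE : st_grad T (phi j) z0 = st_grad T (phi i) z0 +
    (xd (st_grad T (phi j) z0) - xd (st_grad T (phi i) z0)) *: ed.
  by case: aj' => [->|Lz]; [rewrite subrr scale0r addr0|exact: tangential_agree].
have h3 : sg * (phi j z - phi j z0 - ip (st_grad T (phi j) z0) (z - z0)) <= d * `|z - z0|.
  by apply: le_trans (ler_norm _) _; rewrite normrM sg1 mul1r.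
have h4 : ip (st_grad T (phi j) z0) (z - z0) = ip (st_grad T (phi i) z0) (z - z0) +
  (xd (st_grad T (phi j) z0) - xd (st_grad T (phi i) z0)) * xd (z - z0).
  by rewrite {1}gE ipDl ipZl ip_ed.
rewrite ipZl; move: h1 h3; rewrite h4 -pE.
move: (xd (z - z0)) (ip _ (z - z0)) (xd _) (xd _) => x p y y'.
lra_goal.
Qed.

Lemma ssub_subsolution H u : ssub T H B u -> continuous_on_junction branch line u ->
  subsolution T B (C1 T) (first_order_op T H) u.
Proof.
move=> su cu; split=> // phi i z0 tphi bz0 t0 lmax.
have [[ag cphi] sm] := tphi.
have lmax' j : j = i \/ line z0 -> \forall z \near within branch (nbhs z0),
    u j z - 1 * phi j z <= u i z0 - 1 * phi i z0.
  by move=> aj; have := lmax j aj; apply: filterS => z; lra_goal.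
have expn := test_expansion tphi bz0 (normr1 R) lmax'.
have gE j : j = i \/ xd z0 = 0 -> st_grad T (phi i) z0 +
    (xd (st_grad T (phi j) z0) - xd (st_grad T (phi i) z0)) *: ed = st_grad T (phi j) z0.
  case=> [->|x0]; first by rewrite subrr scale0r addr0.
  by rewrite -tangential_agree//; apply/lineP.
have opE j s : j = i \/ xd z0 = 0 -> op H j (st_grad T (phi i) z0 +
    (xd (st_grad T (phi j) z0) - xd (st_grad T (phi i) z0)) *: ed) s z0 =
    first_order_op T H j (phi j) s z0.
  by move=> aj; rewrite gE.
have dich := su (st_grad T (phi i) z0)
  (fun j => xd (st_grad T (phi j) z0) - xd (st_grad T (phi i) z0)) i z0 bz0 t0.
have {dich} [d d0|[x0 le]|[j aj le]] := dich.
- have [rho rho0 h] := expn d d0; exists rho => // j z aj bz zr.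
  by have := h j z aj bz zr; rewrite scale1r mul1r.
- split=> [nL|_]; first by case: nL; apply/lineP.
  apply: le_trans (bigmin_le_id _ _ _ _) _; rewrite kirchhoff_st_grad subr_le0.
  apply: le_trans le; apply: ler_sum => j _; by rewrite addrC subrK.
- move: le; rewrite opE// => le; split=> [nL|_].
    by case: aj => [<-//|x0]; case: nL; apply/lineP.
  by apply: le_trans le; exact: bigmin_le_cond.
Qed.

Lemma ssub_supersolution H u : ssub T (reflect_H H) (- B) (fun i z => - u i z) ->
  continuous_on_junction branch line u ->
  supersolution T B (C1 T) (first_order_op T H) u.
Proof.
move=> su cu; split=> // phi i z0 tphi bz0 t0 lmin.
have [[ag cphi] sm] := tphi.
have lmin' j : j = i \/ line z0 -> \forall z \near within branch (nbhs z0),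
    - u j z - - 1 * phi j z <= - u i z0 - - 1 * phi i z0.
  move=> aj; have := lmin j aj; apply: filterS => z; lra_goal.
have expn := test_expansion tphi bz0 (normrN1 R) lmin'.
have gE j : j = i \/ xd z0 = 0 -> - (- st_grad T (phi i) z0 +
    (xd (st_grad T (phi i) z0) - xd (st_grad T (phi j) z0)) *: ed) = st_grad T (phi j) z0.
  case=> [->|x0]; first by rewrite subrr scale0r addr0 opprK.
  rewrite opprD opprK -scaleNr opprB -tangential_agree//; exact/lineP.
have opE j s : j = i \/ xd z0 = 0 -> op (reflect_H H) j (- st_grad T (phi i) z0 +
    (xd (st_grad T (phi i) z0) - xd (st_grad T (phi j) z0)) *: ed) (- s) z0 =
    - first_order_op T H j (phi j) s z0.
  by move=> aj; rewrite op_reflect gE// opprK.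
have dich := su (- st_grad T (phi i) z0)
  (fun j => xd (st_grad T (phi i) z0) - xd (st_grad T (phi j) z0)) i z0 bz0 t0.
have {dich} [d d0|[x0 le]|[j aj le]] := dich.
- have [rho rho0 h] := expn d d0; exists rho => // j z aj bz zr.
  by have := h j z aj bz zr; rewrite scaleN1r mulN1r opprB.
- split=> [nL|_]; first by case: nL; apply/lineP.
  apply: le_trans _ (bigmax_ge_id _ _ _ _); rewrite kirchhoff_st_grad subr_ge0.
  rewrite -lerN2; apply: le_trans le; rewrite -sumrN; apply: ler_sum => j _.
  by rewrite xdN; lra_goal.
- move: le; rewrite opE// oppr_le0 => le; split=> [nL|_].
    by case: aj => [<-//|x0]; case: nL; apply/lineP.
  by apply: le_trans le _; exact: le_bigmax_cond.
Qed.
End superdifferentials_suffice.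

(** * Regularity across the junction *)

Section lipschitz_across.
Context {R : realType} {n K : nat} (T : R).
Notation st := (spacetime R n).
Notation branch := (cylinder T (@halfspace R n)).
Implicit Types (z w : st) (u : 'I_K -> st -> R).
Implicit Types H : 'I_K -> 'rV[R]_n.+1 -> R -> 'rV[R]_n.+1 -> R -> R.

(** A cone in the last coordinate with vertex x0 on branch i0: the slope is P1
    from the vertex to the junction, and P0 in absolute value beyond the vertex
    and on the other branches. *)
Definition cone (P1 P0 x0 : R) (i0 j : 'I_K) (x : R) : R :=
  if j == i0 then (P1 - P0) / 2 * (x - x0) + (P1 + P0) / 2 * `|x - x0|
  else - P1 * x0 - P0 * x.

Definition cone_slope (P1 P0 x0 : R) (i0 : 'I_K) (x1 : R) (j : 'I_K) : R :=
  if (j == i0) && (x0 < x1) then P1 else - P0.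

Lemma cone_ge0 (P1 P0 x0 : R) (i0 j : 'I_K) (x : R) : 0 <= P1 -> 0 <= P0 -> x0 <= 0 -> x <= 0 ->
  0 <= cone P1 P0 x0 i0 j x.
Proof.
move=> p1 p0 h0 h; rewrite /cone; case: eqP => _; last first.
  have q1 := mulr_ge0_le0 p1 h0; have q0 := mulr_ge0_le0 p0 h; lra_on q1 q0.
have [h1|h1] := ger0P (x - x0).
  by have q1 := mulr_ge0 p1 h1; lra_on q1.
by have q0 := mulr_ge0_le0 p0 (ltW h1); lra_on q0.
Qed.

Lemma cone_linear (P1 P0 x0 : R) (i0 j1 j : 'I_K) (x1 x : R) :
  (j1 = i0 -> x1 <> x0) -> (x1 = 0 -> x0 < 0) -> (j = j1 \/ x1 = 0) -> x0 <= 0 ->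
  `|x - x1| < `|x1 - x0| \/ j <> i0 ->
  cone P1 P0 x0 i0 j x - cone_slope P1 P0 x0 i0 x1 j * x =
  cone P1 P0 x0 i0 j1 x1 - cone_slope P1 P0 x0 i0 x1 j1 * x1.
Proof.
move=> h1 h2 aj x00 close.
have gl y : x0 < x1 -> `|y - x1| < `|x1 - x0| ->
    cone P1 P0 x0 i0 i0 y - cone_slope P1 P0 x0 i0 x1 i0 * y = - P1 * x0.
  move=> lt; rewrite /cone /cone_slope eqxx lt /= => hy.
  have y0 : 0 <= y - x0.
    by move: hy; rewrite (@gtr0_norm _ (x1 - x0)) ?subr_gt0// ltr_norml => /andP[? _]; lra.
  by rewrite (ger0_norm y0); lra.
have gr y : x1 < x0 -> `|y - x1| < `|x1 - x0| ->
    cone P1 P0 x0 i0 i0 y - cone_slope P1 P0 x0 i0 x1 i0 * y = P0 * x0.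
  move=> lt; rewrite /cone /cone_slope eqxx (ltNge x0) (ltW lt) /= => hy.
  have y0 : y - x0 <= 0.
    by move: hy; rewrite (@ltr0_norm _ (x1 - x0)) ?subr_lt0// ltr_norml => /andP[_ ?]; lra.
  by rewrite (ler0_norm y0); lra.
have go l y : l != i0 -> cone P1 P0 x0 i0 l y - cone_slope P1 P0 x0 i0 x1 l * y = - P1 * x0.
  by move=> /negPf li; rewrite /cone /cone_slope li /=; ring.
have self : x1 <> x0 -> `|x1 - x1| < `|x1 - x0|.
  by move=> /eqP ne; rewrite subrr normr0 normr_gt0 subr_eq0.
have [ji|ji] := eqVneq j i0.
  have cl : `|x - x1| < `|x1 - x0| by case: close => // /(_ ji).
  have ne : x1 <> x0 by case: aj => [E|E] h; [apply: h1 => //; rewrite -E|have := h2 E; rewrite -h E ltxx].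
  rewrite ji; have [lt|lt|eq01] := ltgtP x0 x1; last by case: ne.
    rewrite gl//; have [E|E] := eqVneq j1 i0; last by rewrite go.
    by rewrite E gl//; exact: self.
  have E : j1 = i0 by case: aj => [<-//|E]; have := lt_trans lt (h2 E); rewrite E ltxx.
  by rewrite E !gr//; exact: self.
rewrite (go j)//; have [E|E] := eqVneq j1 i0; last by rewrite (go j1).
have x10 : x1 = 0 by case: aj => // E'; move: ji; rewrite E' E eqxx.
rewrite E gl//; first by rewrite x10; exact: h2.
by apply: self; exact: h1.
Qed.

(** Coercivity forbids steep cones from touching u from above, which turns
    a one-sided modulus along the junction into one across it. *)
Lemma lipschitz_in_xd H B u (M e N tau : R) :
  (forall i, coercive T H i) -> 0 <= T -> jusc T u -> psub T H B 0 u ->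
  (forall i z, branch z -> `|u i z| <= M) -> 0 <= M -> 0 <= e -> 0 <= N -> 0 < tau ->
  (forall j z w, branch z -> branch w -> xd z = xd w ->
     u j z <= u j w + e + N * sq (z - w)) ->
  exists N' L : R, [/\ 0 <= N', 0 <= L & forall i z0 z, branch z0 -> tau <= z0.2 ->
    branch z -> u i z <= u i z0 + e + N' * sq (z - z0) + L * `|xd z - xd z0|].
Proof.
move=> co T0 uu su uM M0 e0 N0 tau0 tang.
(* The additional term makes the barrier exceed M at distance tau, so that the
   contact points have positive time. *)
have [N' N'E] : exists N', N' = N + (2 * M + 1) / tau ^+ 2 by eexists.
have q0 : 0 <= (2 * M + 1) / tau ^+ 2 by rewrite divr_ge0 ?sqr_ge0//; lra_on M0.
have N'0 : 0 <= N' by rewrite N'E addr_ge0.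
have [c cE] : exists c, c = M + 2 * N' * T by eexists.
have [b b0 hb] := op_coercive co c 1.
have [P0 P0E] : exists P0, P0 = b + 2 * N' + 4 * M by eexists.
have P00 : 0 <= P0 by rewrite P0E; lra_on b0 N'0 M0.
have KP0 : 0 <= K%:R * P0 by rewrite mulr_ge0.
(* At the junction the slopes add up to P1 - (K - 1) * P0 > B. *)
have [P1 P1E] : exists P1, P1 = K%:R * P0 + P0 + `|B| + 1 by eexists.
have P10 : P0 <= P1 by have := normr_ge0 B; rewrite P1E; lra_on KP0.
have P1_ge0 : 0 <= P1 by lra_on P00 P10.
exists N', P1; split => // i z0 z bz0 tz0 bz.
have [x0 x0E] : exists x0, x0 = xd z0 by eexists.
have x00 : x0 <= 0 by rewrite x0E; case: bz0.
have [C CE] : exists C, C = u i z0 + e by eexists.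
pose g := cone P1 P0 x0 i.
pose phi j y := C + ip 0 (y - z0) + N' * sq (y - z0) + 0 * xd y + 0 * xd y ^+ 2 + g j (xd y).
have phiE j y : phi j y = C + N' * sq (y - z0) + g j (xd y) by rewrite /phi ip0l; ring.
have cphi j : continuous (phi j).
  move=> y; apply: cvgD; first exact: quad_continuous.
  rewrite /g /cone; case: (j == i); last first.
    apply: cvgB; first exact: cvg_cst.
    by apply: cvgM; [exact: cvg_cst|exact: xd_continuous].
  have cs : (fun w => xd w - x0) @ y --> xd y - x0.
    by apply: cvgB; [exact: xd_continuous|exact: cvg_cst].
  by apply: cvgD; (apply: cvgM; first exact: cvg_cst) => //; exact: cvg_norm.
have cone_le : phi i z <= C + N' * sq (z - z0) + P1 * `|xd z - x0|.
  rewrite phiE /g /cone eqxx lerD2l.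
  have := ler_norm (xd z - x0); have : 0 <= (P1 - P0) / 2 by lra_on P10.
  by move=> h1 h2; have := ler_wpM2l h1 h2; lra_goal.
rewrite -x0E -CE; apply: le_trans cone_le; rewrite leNgt; apply/negP => lt.
have g0 j y : branch y -> 0 <= g j (xd y).
  by move=> [hy _]; exact: cone_ge0.
have uhi j y : branch y -> u j y <= M by move=> /(uM j); rewrite ler_norml => /andP[].
have ulo : - M <= u i z0 by have := uM i z0 bz0; rewrite ler_norml => /andP[].
have near_z0 j y : branch y -> phi j y < u j y -> `|y - z0| < tau /\ N' * sq (y - z0) <= 2 * M.
  move=> by_ lty; rewrite phiE CE in lty; have h1 := g0 j y by_; have h2 := uhi j y by_.
  split; last by lra_on lty h1 h2 ulo e0.
  rewrite ltNge; apply/negP => far.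
  have : tau ^+ 2 <= sq (y - z0).
    by apply: le_trans (norm_sq _); rewrite ler_sqr ?nnegrE// ltW.
  move=> h3; have h4 := ler_wpM2l q0 h3.
  have h5 : (2 * M + 1) / tau ^+ 2 * tau ^+ 2 = 2 * M + 1 by rewrite divfK// gt_eqF// exprn_gt0.
  have h6 : 0 <= N * sq (y - z0) by rewrite mulr_ge0// sq_ge0.
  by move: lty; rewrite N'E mulrDl; lra_on h1 h2 h4 h5 h6 ulo e0.
have Ab : [set y | branch y /\ `|y - z0| <= tau] `<=` branch by move=> y [].
have [ztau _] := near_z0 i z bz lt.
have [j1 [z1 [_ [bz1 z1r] hmax]]] := @glued_max R n K T u phi (fun _ => True) _ i z
  uu cphi (@compact_branch_ball R n T z0 tau) Ab I (conj bz (ltW ztau)).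
have pos : phi j1 z1 < u j1 z1.
  by have := hmax i z I (conj bz (ltW ztau)); move: lt; lra_goal.
have [z1tau N'sq] := near_z0 j1 z1 bz1 pos.
have gmax j y : branch y -> u j y - phi j y <= u j1 z1 - phi j1 z1.
  move=> by_; have [yr|yr] := leP `|y - z0| tau; first exact: hmax.
  have [lty|ley] := ltP (phi j y) (u j y).
    by have [] := near_z0 j y by_ lty; move: yr; lra_goal.
  by move: ley pos; lra_goal.
have t10 : 0 < z1.2.
  by have := le_lt_trans (time_le _) z1tau; rewrite /= ltr_norml => /andP[h _]; lra_on h tz0.
have [x1 x1E] : exists x1, x1 = xd z1 by eexists.
have x10 : x1 <= 0 by rewrite x1E; case: bz1.
have not_aligned : j1 = i -> x1 <> x0.
  move=> ji xE; have := tang i z1 z0 bz1 bz0; rewrite -x1E -x0E => /(_ xE).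
  have h1 := g0 j1 z1 bz1; have h2 : 0 <= (N' - N) * sq (z1 - z0).
    by rewrite mulr_ge0 ?sq_ge0// N'E addrAC subrr add0r.
  by move: pos; rewrite phiE CE ji in h1 *; lra_on h1 h2.
have junction_left : x1 = 0 -> x0 < 0.
  move=> x1z; rewrite lt_neqAle x00 andbT; apply/eqP => x0z.
  have xz : xd z1 = 0 by rewrite -x1E.
  have uE := jusc_agree j1 i uu bz1 xz.
  have := tang i z1 z0 bz1 bz0; rewrite -x1E -x0E x0z => /(_ x1z).
  have h1 := g0 j1 z1 bz1; have h2 : 0 <= (N' - N) * sq (z1 - z0).
    by rewrite mulr_ge0 ?sq_ge0// N'E addrAC subrr add0r.
  by move: pos; rewrite phiE CE uE; lra_on h1 h2.
have touch : exists2 rho : R, 0 < rho & forall j y, (j = j1 \/ xd z1 = 0) -> branch y ->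
    `|y - z1| < rho ->
    u j y - (ip 0 (y - z0) + cone_slope P1 P0 x0 i x1 j * xd y + N' * sq (y - z0)) <=
    u j1 z1 - (ip 0 (z1 - z0) + cone_slope P1 P0 x0 i x1 j1 * xd z1 + N' * sq (z1 - z0)).
  exists (if x1 == x0 then 1 else `|x1 - x0|).
    by case: eqP => // /eqP ne; rewrite normr_gt0 subr_eq0.
  move=> j y aj by_ yz; have := gmax j y by_; rewrite !phiE.
  have := @cone_linear P1 P0 x0 i j1 j x1 (xd y) not_aligned junction_left.
  rewrite {1}x1E => /(_ aj x00); rewrite -/g.
  have -> : (g j (xd y) - cone_slope P1 P0 x0 i x1 j * xd y =
     g j1 x1 - cone_slope P1 P0 x0 i x1 j1 * x1) =
    (g j (xd y) = g j1 x1 - cone_slope P1 P0 x0 i x1 j1 * x1 + cone_slope P1 P0 x0 i x1 j * xd y).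
    by apply/propext; split => [<-|->]; ring.
  rewrite -x1E !ip0l => ->; first by lra_goal.
  have [E|/eqP ji] := eqVneq j i; last by right.
  left; move: yz; case: eqP => [xE|_ h].
    case: aj => [E'|E']; first by have /not_aligned : j1 = i by rewrite -E'.
    by have := junction_left (etrans x1E E'); rewrite -xE x1E E' ltxx.
  by apply: le_lt_trans h; rewrite x1E -xdB; exact: xd_le.
have := psub_at su N'0 bz1 t10 touch; rewrite mul0r.
have slope_out j : j <> i \/ x1 <= x0 -> cone_slope P1 P0 x0 i x1 j = - P0.
  by rewrite /cone_slope; case=> [/eqP/negPf->//|h]; rewrite (ltNge x0) h andbF.
case=> [[xz1 le]|[j aj]].
  have {}xz1 : x1 = 0 by rewrite x1E.
  have lt0 := junction_left xz1; move: le; apply/negP; rewrite -ltNge.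
  rewrite (bigD1 i)//=.
  have -> : cone_slope P1 P0 x0 i x1 i = P1 by rewrite /cone_slope eqxx xz1 lt0.
  have xz : xd (z1 - z0) = - x0 by rewrite xdB -x1E -x0E xz1 sub0r.
  have p1 : 0 <= 2 * N' * - x0 by rewrite mulr_ge0 ?oppr_ge0// mulr_ge0.
  have low : - (K%:R * P0) <= \sum_(j < K | j != i) (xd (0 : st) + 2 * N' * xd (z1 - z0) + cone_slope P1 P0 x0 i x1 j).
    apply: (@le_trans _ _ (\sum_(j < K | j != i) - P0)).
      rewrite sumrN lerN2 (@le_trans _ _ (\sum_(j < K) P0))//.
        by rewrite [leRHS](bigID (fun j => j != i))/= lerDl sumr_ge0.
      by rewrite sumr_const card_ord -[leLHS]mulr_natl.
    apply: ler_sum => j /eqP ji; rewrite slope_out; last by left.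
    by rewrite xz (_ : xd (0 : st) = 0) ?add0r ?lerDr// /xd mxE.
  have xd0 : xd (0 : st) = 0 by rewrite /xd mxE.
  by have := ler_norm B; move: low; rewrite xz xd0 P1E; lra_on p1 P00.
apply/negP; rewrite -ltNge; apply: (@lt_le_trans _ _ 1) => //.
have T1 : `|(z1 - z0).2| <= T.
  have [_ /andP[p1 p2]] := bz1; have [_ /andP[p3 p4]] := bz0.
  by rewrite /= ler_norml; apply/andP; split; lra_on p1 p2 p3 p4.
apply: hb => //.
- by apply: le_trans (uM _ _ bz1) _; rewrite cE lerDl !mulr_ge0.
- rewrite time_shift_ed add0r.
  rewrite (_ : ((2 * N') *: (z1 - z0)).2 = 2 * N' * (z1 - z0).2)//.
  rewrite normrM ger0_norm ?mulr_ge0// cE.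
  have p1 : 2 * N' * `|(z1 - z0).2| <= 2 * N' * T by rewrite ler_wpM2l// mulr_ge0.
  by lra_on p1 M0.
apply: le_trans (entry_le _ ord_max); rewrite -/(xd _) xd_shift_ed add0r xdZ xdB -x1E -x0E.
have slope_bound : `|2 * N' * (x1 - x0)| <= 2 * N' + 4 * M.
  rewrite normrM ger0_norm ?mulr_ge0//.
  have p1 : N' * (x1 - x0) ^+ 2 <= 2 * M.
    apply: le_trans N'sq; rewrite ler_wpM2l// x1E x0E -xdB; exact: xd_sq.
  have p2 : `|x1 - x0| <= 1 + (x1 - x0) ^+ 2.
    have := sqr_ge0 (`|x1 - x0| - 1); rewrite sqrrB1 real_normK ?num_real//.
    by have := normr_ge0 (x1 - x0); lra_goal.
  have p3 := ler_wpM2l N'0 p2; lra_on p1 p3.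
have [/andP[/eqP ji lt01]|nsl] := boolP ((j == i) && (x0 < x1)).
  rewrite /cone_slope ji eqxx lt01 /=.
  have p1 : 0 <= 2 * N' * (x1 - x0) by rewrite !mulr_ge0// subr_ge0 ltW.
  rewrite ger0_norm; last by rewrite addr_ge0.
  by lra_on p1 P10 P0E N'0 M0.
rewrite /cone_slope (negPf nsl) ler_normr; apply/orP; right.
move: slope_bound; rewrite ler_norml => /andP[_ p1].
by lra_on p1 P0E.
Qed.
End lipschitz_across.

(** * Passage to the limit *)

Section limits_of_families.
Context {R : realType} {n K : nat} (T : R).
Notation st := (spacetime R n).
Notation branch := (cylinder T (@halfspace R n)).
Notation line := (cylinder T (@junction R n)).
Implicit Types (z w : st) (u v : 'I_K -> st -> R) (U : R -> 'I_K -> st -> R).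
Implicit Types (g : 'I_K -> 'rV[R]_n.+1 -> R).
Implicit Types H : 'I_K -> 'rV[R]_n.+1 -> R -> 'rV[R]_n.+1 -> R -> R.

Lemma BUC_continuous u : BUC_spacetime T u -> continuous_on_junction branch line u.
Proof.
move=> bu; split=> [|i]; first by case: bu.
apply/within_continuous_distP => z bz e e0.
have [r r0 h] := BUC_modulus bu e0; exists r => // w bw wz; exact: h.
Qed.

Lemma ssub_ext H (B : R) u v : (forall i z, branch z -> u i z = v i z) ->
  ssub T H B u -> ssub T H B v.
Proof.
move=> uv su P r i z0 bz0 t0 touch.
have := su P r i z0 bz0 t0; rewrite !uv//.
case=> [d d0|h|[j aj h]]; [|by left|by right; exists j => //; rewrite -uv].
by have [rho rho0 h] := touch d d0; exists rho => // j z aj bz zr; rewrite uv//; exact: h.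
Qed.

Definition initial_le u g := forall e : R, 0 < e -> exists2 tau : R, 0 < tau &
  forall j z, branch z -> z.2 <= tau -> u j z <= g j z.1 + e.

Lemma initial_order u v g : @BUC_space R n K g ->
  initial_le u g -> initial_le v (fun i x => - g i x) ->
  forall e, 0 < e -> exists2 tau : R, 0 < tau & forall j z w, branch z -> branch w ->
     z.2 <= tau -> w.2 <= tau -> `|z.1 - w.1| <= tau -> u j z + v j w <= e.
Proof.
move=> bw iu iv e e0; have e3 : 0 < e / 3 by rewrite divr_gt0.
have [t1 t10 h1] := iu _ e3; have [t2 t20 h2] := iv _ e3.
have [r r0 h3] := BUC_modulus bw e3.
have [|tau tau0] := @small_pos R [:: t1; t2; r / 2]; first by rewrite /= t10 t20 divr_gt0.
move=> /= /and4P[q1 q2 q3 _]; exists tau => // j z w bz bw' zt wt zw.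
have g1 := h1 j z bz (le_trans zt q1); have g2 := h2 j w bw' (le_trans wt q2).
have zw' : `|z.1 - w.1| < r by move: zw q3 r0; lra_goal.
have := h3 j z.1 w.1 (proj1 bz) (proj1 bw') zw'; rewrite ltr_norml => /andP[_].
by move: g1 g2; lra_goal.
Qed.

Lemma initial_le_BUC u g : BUC_spacetime T u -> initial_value g u -> initial_le u g.
Proof.
move=> bu iu e e0; have [r r0 h] := BUC_modulus bu e0.
exists (r / 2) => [|j z [hx /andP[t0 tT]] zr]; first by rewrite divr_gt0.
have b0 : branch (z.1, 0) by split=> //=; rewrite lexx (le_trans t0 tT).
have zd : `|z - (z.1, 0)| < r.
  rewrite st_normE /= subrr normr0 subr0 gt_max r0 ger0_norm//=.
  by move: zr r0; lra_goal.
have bz : branch z by split=> //; apply/andP.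
have := h j z _ bz b0 zd; rewrite (iu j z.1 hx) ltr_norml => /andP[_].
by lra_goal.
Qed.

Lemma initial_value_le u g : 0 <= T ->
  initial_le u g -> initial_le (fun i z => - u i z) (fun i x => - g i x) ->
  initial_value g u.
Proof.
move=> T0 h1 h2 i x hx.
have b0 : branch (x, 0) by split => //=; rewrite lexx.
apply/eqP; rewrite eq_le; apply/andP; split; apply/ler_addgt0Pr => e e0.
  by have [tau tau0 /(_ i _ b0 (ltW tau0))] := h1 e e0.
by have [tau tau0 /(_ i _ b0 (ltW tau0))] := h2 e e0; rewrite /=; lra_goal.
Qed.

Lemma comparison H (B M : R) u v g :
  (forall i, unif_cont_bounded T H i) -> (forall i, coercive T H i) ->
  (forall i, lipschitz_ut T H i) -> 0 < T ->
  jusc T u -> jusc T v -> psub T H B 0 u -> psub T (reflect_H H) (- B) 0 v ->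
  (forall i z, branch z -> `|u i z| <= M) -> (forall i z, branch z -> `|v i z| <= M) ->
  @BUC_space R n K g -> initial_le u g -> initial_le v (fun i x => - g i x) ->
  forall i z, branch z -> u i z + v i z <= 0.
Proof.
move=> uc co lip T0 uu vv su sv uM vM bw iu iv i z bz.
apply/ler_addgt0Pr => e e0.
have [N N0 h] := doubling_estimate uc co lip T0 uu vv su sv uM vM (initial_order bw iu iv) e0.
by have := h i z z bz bz erefl; rewrite subrr sq0 mulr0 addr0 add0r.
Qed.

(** Near the initial time the modulus of the initial value is used, and later
    the estimates along and across the junction. *)
Lemma limit_BUC H (B M : R) u g : (forall i, coercive T H i) -> 0 <= T ->
  jusc T u -> psub T H B 0 u -> (forall i z, branch z -> `|u i z| <= M) -> 0 <= M ->
  @BUC_space R n K g -> initial_le u g ->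
  initial_le (fun i z => - u i z) (fun i x => - g i x) ->
  (forall e : R, 0 < e -> exists2 N : R, 0 <= N & forall j z w, branch z -> branch w ->
    xd z = xd w -> u j z - u j w <= e + N * sq (z - w)) ->
  BUC_spacetime T u.
Proof.
move=> co T0 uu su uM M0 bw iu iv tang; split.
  by move=> i j z /line_branch[bz xz]; exact: (jusc_agree i j uu bz xz).
move=> i; split; first by exists M; exact: uM.
move=> e e0; have e4 : 0 < e / 4 by rewrite divr_gt0.
have [t1 t10 h1] := iu _ e4; have [t2 t20 h2] := iv _ e4.
have [r r0 h3] := BUC_modulus bw e4.
have [N N0 hN] := tang _ e4.
have [|tau tau0 /= /and3P[q1 q2 _]] := @small_pos R [:: t1; t2]; first by rewrite /= t10 t20.
have tau2 : 0 < tau / 2 by rewrite divr_gt0.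
have tang' j z w : branch z -> branch w -> xd z = xd w ->
    u j z <= u j w + e / 4 + N * sq (z - w).
  by move=> bz bw' xzw; have := hN j z w bz bw' xzw; lra_goal.
have [N' [L [N'0 L0 lipx]]] := lipschitz_in_xd co T0 uu su uM M0 (ltW e4) N0 tau2 tang'.
have c0 : 0 < N' * n.+2%:R + L + 1 by rewrite ltr_wpDl// addr_ge0// mulr_ge0.
have [|s s0 /= /and5P[s1 s2 s3 s4 _]] := @small_pos R [:: tau / 2; r; 1; e / 4 / (N' * n.+2%:R + L + 1)].
  by rewrite /= tau2 r0 ltr01 divr_gt0.
exists s => //.
have late y z : branch y -> branch z -> `|y - z| < s -> tau / 2 <= z.2 ->
    u i y - u i z <= e / 2.
  move=> by_ bz yz tz; have := lipx i z y bz tz by_.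
  have yn := normr_ge0 (y - z); have g1 := sq_le (y - z).
  have g2 : `|y - z| ^+ 2 <= `|y - z| by rewrite expr2 ler_piMr//; move: yz s3; lra_goal.
  have g3 : N' * sq (y - z) <= N' * (n.+2%:R * `|y - z|).
    by rewrite ler_wpM2l//; apply: le_trans g1 _; exact: ler_wpM2l.
  have g4 : L * `|xd y - xd z| <= L * `|y - z| by rewrite ler_wpM2l// -xdB xd_le.
  have g5 : (N' * n.+2%:R + L + 1) * `|y - z| <= e / 4.
    by rewrite mulrC -ler_pdivlMr//; apply: le_trans s4; exact: ltW.
  by move: g3 g4 g5 yn; lra_goal.
have early y z : branch y -> branch z -> `|y - z| < s -> z.2 < tau / 2 ->
    `|u i y - u i z| < e.
  move=> by_ bz yz tz; have tys := le_lt_trans (time_le (y - z)) yz.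
  have ty : y.2 <= tau.
    by move: tys; rewrite /= ltr_norml => /andP[_]; move: tz s1; lra_goal.
  have tz' : z.2 <= tau by move: tz tau0; lra_goal.
  have xyz := lt_le_trans (le_lt_trans (space_le (y - z)) yz) s2.
  have := h3 i y.1 z.1 (proj1 by_) (proj1 bz) xyz.
  have := h1 i y by_ (le_trans ty q1); have := h1 i z bz (le_trans tz' q1).
  have := h2 i y by_ (le_trans ty q2); have := h2 i z bz (le_trans tz' q2).
  rewrite !ltr_norml => g1 g2 g3 g4 /andP[g5 g6].
  by apply/andP; split; move: g1 g2 g3 g4 g5 g6 e0; lra_goal.
move=> y z by_ bz yz; have zy : `|z - y| < s by rewrite distrC.
have [tz|tz] := ltP z.2 (tau / 2); first exact: early.
have [ty|ty] := ltP y.2 (tau / 2); first by rewrite distrC; exact: early.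
have g1 := late y z by_ bz yz tz; have g2 := late z y bz by_ zy ty.
by rewrite ltr_norml; apply/andP; split; move: g1 g2 e0; lra_goal.
Qed.

(* One of the two families to which the bounds are applied: the viscous
   solutions, or their opposites with the reflected Hamiltonian. *)
Section half_relaxed.
Context (U : R -> 'I_K -> st -> R) (g : 'I_K -> 'rV[R]_n.+1 -> R) (c0 : R).
Context (H : 'I_K -> 'rV[R]_n.+1 -> R -> 'rV[R]_n.+1 -> R -> R) (B : R).
Context (K0 : (0 < K)%N) (T0 : 0 < T) (c00 : 0 < c0) (bw : @BUC_space R n K g).
Context (uc : forall i, unif_cont_bounded T H i) (lip : forall i, lipschitz_ut T H i).
Context (Hlow : forall r, exists C, forall j p s z, branch z -> `|p| <= r -> `|s| <= r ->
  - C <= H j p s z.1 z.2).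
Context (Uu : forall eps, 0 < eps -> jusc T (U eps)).
Context (Us : forall eps, 0 < eps -> psub T H B (c0 * eps) (U eps)).
Context (Ub : forall eps, 0 < eps -> exists M, forall i z, branch z -> `|U eps i z| <= M).
Context (U0 : forall eps, 0 < eps -> forall j z, branch z -> z.2 = 0 -> U eps j z <= g j z.1).

Let B_lt : B < K%:R * (`|B| + 1).
Proof.
have k1 : 1 <= K%:R :> R by rewrite ler1n.
have b1 : 0 <= `|B| + 1 by rewrite addr_ge0.
by have := ler_wpM2r b1 k1; have := ler_norm B; rewrite mul1r; lra.
Qed.

Let m0 : 0 <= `|B| + 1 := addr_ge0 (normr_ge0 B) ler01.

Lemma family_upper_bound : exists A, exists2 eps0 : R, 0 < eps0 &
  forall eps i z, 0 < eps -> eps < eps0 -> branch z -> U eps i z <= A.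
Proof.
have [M M0 hM] := BUC_bounded bw.
have [A [eps1 eps10 h]] := uniform_upper_bound M T0 m0 B_lt lip Hlow.
exists A; exists (eps1 / c0) => [|eps i z e0 e1 bz]; first by rewrite divr_gt0.
apply: (h (U eps) (c0 * eps)) => //.
- by rewrite mulr_ge0// ltW.
- by rewrite mulrC -ltr_pdivlMr.
- exact: Uu.
- exact: Us.
- exact: Ub.
- move=> j w bw' w2; apply: le_trans (U0 e0 j bw' w2) _.
  by apply: le_trans (ler_norm _) _; apply: hM; case: bw'.
Qed.

Lemma family_initial_le (M eps0 : R) : 0 < eps0 ->
  (forall eps i z, 0 < eps -> eps < eps0 -> branch z -> `|U eps i z| <= M) ->
  initial_le (rlim T U) g.
Proof.
move=> eps00 UM e e0; have e3 : 0 < e / 3 by rewrite divr_gt0.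
have [tau tau0 h] := initial_upper_bound M T0 m0 B_lt Hlow bw e3.
have [r r0 hr] := BUC_modulus bw e3.
exists (tau / 2) => [|j z bz zt]; first by rewrite divr_gt0.
have [|s s0 /= /and5P[s1 s2 s3 s4 _]] := @small_pos R [:: tau / 2; r; eps0; 1 / c0].
  by rewrite /= r0 eps00 !divr_gt0.
have [eps [j' [w [/andP[e1 e2] aj bw' wz le]]]] := rlim_freq eps00 UM j bz e3 s0.
have wt : w.2 <= tau.
  by have := le_lt_trans (time_le _) wz; rewrite /= ltr_norml => /andP[_]; move: zt s1; lra.
have g1 : U eps j' w <= g j' w.1 + e / 3.
  apply: (h (U eps) (c0 * eps)) => //.
  - by rewrite mulr_ge0// ltW.
  - by rewrite mulrC -ler_pdivlMr//; apply: le_trans s4; exact: ltW.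
  - exact: Uu.
  - exact: Us.
  - by move=> *; apply: UM => //; exact: lt_le_trans s3.
  - exact: U0.
have ag : g j' z.1 = g j z.1.
  by case: aj => [->//|xz]; case: bw => ag _; exact: ag.
have wz' := lt_le_trans (le_lt_trans (space_le _) wz) s2.
have := hr j' w.1 z.1 (proj1 bw') (proj1 bz) wz'; rewrite ltr_norml => /andP[_ g2].
by rewrite -ag; move: le g1 g2; lra.
Qed.

Lemma family_ssub (M eps0 : R) : 0 < eps0 ->
  (forall eps i z, 0 < eps -> eps < eps0 -> branch z -> `|U eps i z| <= M) ->
  ssub T H B (rlim T U).
Proof.
move=> eps00 UM; apply: (rlim_stability eps00 UM uc (ltW c00)); [exact: Uu|exact: Us].
Qed.

End half_relaxed.

Lemma reflect_lower H : (forall r, exists C, forall j p s z, branch z -> `|p| <= r ->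
    `|s| <= r -> H j p s z.1 z.2 <= C) ->
  forall r : R, exists C, forall j p s z, branch z -> `|p| <= r -> `|s| <= r ->
    - C <= reflect_H H j p s z.1 z.2.
Proof.
move=> h r; have [C hC] := h r; exists C => j p s z bz hp hs.
by rewrite /reflect_H lerN2; apply: hC => //; rewrite normrN.
Qed.

(** The two half-relaxed limits squeeze the family. *)
Lemma rlim_cvg U (M eps0 : R) : 0 < eps0 ->
  (forall eps i z, 0 < eps -> eps < eps0 -> branch z -> `|U eps i z| <= M) ->
  (forall i z, branch z -> rlim T (fun eps i z => - U eps i z) i z = - rlim T U i z) ->
  forall i z, branch z -> U eps i z @[eps --> 0^'+] --> rlim T U i z.
Proof.
move=> eps00 UM opp i z bz.
have UMN eps j w : 0 < eps -> eps < eps0 -> branch w -> `|- U eps j w| <= M.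
  by rewrite normrN; exact: UM.
apply/cvgrPdist_lt => e e0; have e2 : 0 < e / 2 by rewrite divr_gt0.
have [r1 r10 h1] := rlim_upper eps00 UM i bz e2.
have [r2 r20 h2] := rlim_upper eps00 UMN i bz e2.
have z0 (r : R) : 0 < r -> `|z - z| < r by rewrite subrr normr0.
near=> eps.
have eps_pos : 0 < eps by near: eps; exact: nbhs_right_gt.
have g1 : U eps i z <= rlim T U i z + e / 2.
  apply: h1 => //; [by left|exact: z0].
have : - U eps i z <= rlim T (fun eps i z => - U eps i z) i z + e / 2.
  apply: h2 => //; [by left|exact: z0].
rewrite opp// => g2; rewrite ltr_norml; apply/andP; split; move: g1 g2 e0; lra_goal.
Unshelve. all: by end_near. Qed.

End limits_of_families.

(** * The vanishing viscosity limit *)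

Theorem theorem2p2 (R : realType) (n K : nat) (T B : R)
    (H : 'I_K -> 'rV[R]_n.+1 -> R -> 'rV[R]_n.+1 -> R -> R)
    (u0 : 'I_K -> 'rV[R]_n.+1 -> R)
    (ueps : R -> 'I_K -> spacetime R n -> R)
    (hK : (0 < K)%N) (hT : 0 < T)
    (hu0 : BUC_space u0)
    (hcoercive : forall i, coercive T H i)
    (hlipschitz : forall i, lipschitz_ut T H i)
    (hunif : forall i, unif_cont_bounded T H i)
    (hueps : forall eps : R, 0 < eps ->
       [/\ BUC_spacetime T (ueps eps),
           viscous_solution T B H eps (ueps eps) &
           initial_value u0 (ueps eps)]) :
  exists u : 'I_K -> spacetime R n -> R,
    (forall i z, cylinder T (@halfspace R n) z ->
       ueps eps i z @[eps --> 0^'+] --> u i z) /\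
    [/\ BUC_spacetime T u, generalized_solution T B H u & initial_value u0 u] /\
    (forall v : 'I_K -> spacetime R n -> R,
       [/\ BUC_spacetime T v, generalized_solution T B H v &
           initial_value u0 v] ->
       forall i z, cylinder T (@halfspace R n) z -> v i z = u i z).
Proof.
have [c0 c0E] : exists c0 : R, c0 = 2 * n.+1%:R by eexists.
have c00 : 0 < c0 by rewrite c0E mulr_gt0.
pose neg (w : 'I_K -> spacetime R n -> R) i z := - w i z.
pose U eps := ueps eps; pose V eps := neg (ueps eps).
have buc eps : 0 < eps -> BUC_spacetime T (U eps) by move=> /hueps[].
have bucN eps : 0 < eps -> BUC_spacetime T (V eps).
  by move=> e0; apply: BUCN; exact: buc.
have bu0N : @BUC_space R n K (fun i x => - u0 i x) by exact: BUCN.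
have jU eps : 0 < eps -> jusc T (U eps).
  by move=> e0; apply/continuous_jusc/BUC_continuous/buc.
have jV eps : 0 < eps -> jusc T (V eps).
  by move=> e0; apply/continuous_jusc/BUC_continuous/bucN.
have ps eps : 0 < eps -> psub T H B (c0 * eps) (U eps) /\
    psub T (reflect_H H) (- B) (c0 * eps) (V eps).
  by move=> /hueps[_ sol _]; rewrite c0E; exact: viscous_psub.
have sU eps e0 := proj1 (ps eps e0); have sV eps e0 := proj2 (ps eps e0).
have ucN i : unif_cont_bounded T (reflect_H H) i by exact: reflect_unif_cont.
have lipN i : lipschitz_ut T (reflect_H H) i by exact: reflect_lipschitz.
have initU eps : 0 < eps -> forall j z, cylinder T (@halfspace R n) z -> z.2 = 0 ->
    U eps j z <= u0 j z.1.
  by move=> /hueps[_ _ iv] j [x t] [hx _] /= ->; rewrite -(iv j x hx).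
have initV eps : 0 < eps -> forall j z, cylinder T (@halfspace R n) z -> z.2 = 0 ->
    V eps j z <= - u0 j z.1.
  by move=> /hueps[_ _ iv] j [x t] [hx _] /= ->; rewrite -(iv j x hx).
have bdU eps : 0 < eps -> exists M, forall i z, cylinder T (@halfspace R n) z ->
    `|U eps i z| <= M.
  by move=> /buc/BUC_bounded[M _ hM]; exists M.
have bdV eps : 0 < eps -> exists M, forall i z, cylinder T (@halfspace R n) z ->
    `|V eps i z| <= M.
  by move=> /bucN/BUC_bounded[M _ hM]; exists M.
have m0 : 0 <= `|B| + 1 by rewrite addr_ge0.
have Bm (b : R) : `|b| <= `|B| -> b < K%:R * (`|B| + 1).
  have k1 : 1 <= K%:R :> R by rewrite ler1n.
  have := ler_wpM2r m0 k1; have := ler_norm b; rewrite mul1r; lra_goal.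
(* A single viscous solution bounds the Hamiltonian from both sides. *)
have lowN : forall r : R, exists C, forall j p s (z : spacetime R n),
    cylinder T (@halfspace R n) z -> `|p| <= r -> `|s| <= r ->
    - C <= reflect_H H j p s z.1 z.2.
  have [M hM] := bdU 1 ltr01.
  apply: reflect_lower.
  exact: (hamiltonian_upper_bound hunif hT m0 (Bm B (lexx _)) (jU _ ltr01) (sU _ ltr01) hM).
have low : forall r : R, exists C, forall j p s (z : spacetime R n),
    cylinder T (@halfspace R n) z -> `|p| <= r -> `|s| <= r -> - C <= H j p s z.1 z.2.
  have [M hM] := bdV 1 ltr01.
  rewrite -(reflect_HK H); apply: reflect_lower.
  apply: (hamiltonian_upper_bound ucN hT m0 _ (jV _ ltr01) (sV _ ltr01) hM).
  by apply: Bm; rewrite normrN.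
have [A1 [e1 e10 hA1]] := family_upper_bound hK hT c00 hu0 hlipschitz low jU sU bdU initU.
have [A2 [e2 e20 hA2]] := family_upper_bound hK hT c00 bu0N lipN lowN jV sV bdV initV.
have [M [M0 MU]] : exists M : R, 0 <= M /\ forall eps i z, 0 < eps -> eps < Num.min e1 e2 ->
    cylinder T (@halfspace R n) z -> `|U eps i z| <= M.
  exists (`|A1| + `|A2|); split=> [|eps i z p]; first by rewrite addr_ge0.
  rewrite lt_min => /andP[p1 p2] bz.
  have := hA1 eps i z p p1 bz; have := hA2 eps i z p p2 bz; rewrite /V /neg /U ler_norml.
  have := ler_norm A1; have := ler_norm A2; have := normr_ge0 A1; have := normr_ge0 A2.
  by move: (ueps eps i z) => x *; apply/andP; split; lra.
have eps00 : 0 < Num.min e1 e2 by rewrite lt_min e10.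
have MV eps i z : 0 < eps -> eps < Num.min e1 e2 -> cylinder T (@halfspace R n) z ->
    `|V eps i z| <= M.
  by rewrite /V /neg normrN; exact: MU.
pose u := rlim T U; pose v := rlim T V.
have uM i z bz : `|u i z| <= M := rlim_bound eps00 MU i bz.
have vM i z bz : `|v i z| <= M := rlim_bound eps00 MV i bz.
have uu : jusc T u := rlim_usc eps00 MU.
have vv : jusc T v := rlim_usc eps00 MV.
have ssu : ssub T H B u := family_ssub c00 hunif jU sU eps00 MU.
have ssv : ssub T (reflect_H H) (- B) v := family_ssub c00 ucN jV sV eps00 MV.
have su := ssub_psub ssu; have sv := ssub_psub ssv.
have iu : initial_le T u u0 := family_initial_le hK hT c00 hu0 low jU sU initU eps00 MU.
have iv : initial_le T v (fun i x => - u0 i x) :=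
  family_initial_le hK hT c00 bu0N lowN jV sV initV eps00 MV.
(* The half-relaxed limits of u_eps and - u_eps are opposite: one inequality
   comes from the comparison principle, the other from their definition. *)
have le0 := comparison hunif hcoercive hlipschitz hT uu vv su sv uM vM hu0 iu iv.
have ge0 i z : cylinder T (@halfspace R n) z -> 0 <= u i z + v i z.
  move=> bz; apply/ler_addgt0Pl => e e0; have e2' : 0 < e / 2 by rewrite divr_gt0.
  have [r1 r10 h1] := rlim_upper eps00 MU i bz e2'.
  have [r2 r20 h2] := rlim_upper eps00 MV i bz e2'.
  have [|s s0 /= /and3P[s1 s2 _]] := @small_pos R [:: r1 / 2; r2 / 2].
    by rewrite /= !divr_gt0.
  have zz (r : R) : 0 < r -> `|z - z| < r by rewrite subrr normr0.
  have sr1 : s < r1 by move: s1 r10; lra_goal.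
  have sr2 : s < r2 by move: s2 r20; lra_goal.
  have := h1 s i z s0 sr1 (or_introl erefl) bz (zz _ r10).
  have := h2 s i z s0 sr2 (or_introl erefl) bz (zz _ r20).
  rewrite /V /neg /U -/v -/u; move: (ueps s i z) (u i z) (v i z) => x y y'; lra_goal.
have vE i z : cylinder T (@halfspace R n) z -> v i z = - u i z.
  by move=> bz; apply/eqP; rewrite -addr_eq0 addrC eq_le le0// ge0.
have iuN : initial_le T (neg u) (fun i x => - u0 i x).
  by move=> e /iv[tau tau0 h]; exists tau => // j z bz zt; rewrite /neg -vE//; exact: h.
have bu : BUC_spacetime T u.
  apply: (limit_BUC hcoercive (ltW hT) uu su uM M0 hu0 iu iuN) => e e0.
  have [N N0 h] := doubling_estimate hunif hcoercive hlipschitz hT uu vv su sv uM vM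
    (initial_order hu0 iu iv) e0.
  by exists N => // j z w bz bw xzw; rewrite -vE//; exact: h.
have cu := BUC_continuous bu.
exists u; split; first exact: (rlim_cvg eps00 MU).
split; first split => //.
- split; first exact: ssub_subsolution.
  by apply: ssub_supersolution => //; apply: ssub_ext ssv => i z; exact: vE.
- exact: (initial_value_le (ltW hT) iu iuN).
(* Uniqueness: another solution w is compared with u from both sides. *)
move=> w [bw gw iw] i z bz; have bwN := BUCN bw.
have [sw swN] := generalized_psub hT gw.
have jw := continuous_jusc (BUC_continuous bw).
have jwN := continuous_jusc (BUC_continuous bwN).
have [Mw Mw0 hMw] := BUC_bounded bw.
have inw : initial_le T w u0 by exact: initial_le_BUC.
have inwN : initial_le T (neg w) (fun i x => - u0 i x).
  by apply: initial_le_BUC => // j x hx; rewrite /neg iw.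
have u' j y : cylinder T (@halfspace R n) y -> `|u j y| <= M + Mw.
  by move=> /(uM j) h; apply: le_trans h _; rewrite lerDl.
have v' j y : cylinder T (@halfspace R n) y -> `|v j y| <= M + Mw.
  by move=> /(vM j) h; apply: le_trans h _; rewrite lerDl.
have w' j y : cylinder T (@halfspace R n) y -> `|w j y| <= M + Mw.
  by move=> /(hMw j) h; apply: le_trans h _; rewrite lerDr.
have wN' j y : cylinder T (@halfspace R n) y -> `|neg w j y| <= M + Mw.
  by rewrite /neg normrN; exact: w'.
have g1 := comparison hunif hcoercive hlipschitz hT uu jwN su swN u' wN' hu0 iu inwN i bz.
have g2 := comparison hunif hcoercive hlipschitz hT jw vv sw sv w' v' hu0 inw iv i bz.
rewrite vE// in g2.
by apply/eqP; rewrite eq_le -subr_le0 g2 -subr_le0.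
Qed.
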